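(* Let $n$ be a positive integer and let $A_0(z)\not\equiv0,A_1(z),\dots,A_{k-1}(z)$ be analytic functions in $D(0,R)=\{z\in\mathbb{C}:0<|z|<R\}$ satisfying $\sigma_n(A_j,0)<\sigma_n(A_0,0)<\infty$ for $j=1,\dots,k-1$. Then every solution $f(z)\not\equiv0$ of $$f^{(k)}+A_{k-1}(z)f^{(k-1)}+\dots+A_1(z)f'+A_0(z)f=0$$ satisfies $\sigma_{n+1}(f,0)=\sigma_n(A_0,0)$.
   Context: For an analytic function $f$ in $D(0,R)=\{z\in\mathbb{C}:0<|z|<R\}$ let $M_0(r,f)=\max\{|f(z)|:|z|=r\}$. The iterated order of $f$ near $0$ is $$\sigma_n(f,0)=\sigma_{n,M}(f,0)=\limsup_{r\to0}\frac{\log_{n+1}^+M_0(r,f)}{-\log r},$$ where $\log_1^+x=\log^+x=\max\{\log x,0\}$ and $\log_n^+x=\log^+\log_{n-1}^+x$ for $n\ge2$. (For analytic $f$ this equals $\sigma_{n,T}(f,0)=\limsup_{r\to0}\frac{\log_n^+T_0(r,f)}{-\log r}$ with $T_0(r,f)=\frac1{2\pi}\int_0^{2\pi}\ln^+|f(re^{i\varphi})|\,d\varphi$.) *)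

(* Defs.v *)
From mathcomp Require Import all_boot all_order all_algebra.
From mathcomp Require Import complex.
From mathcomp Require Import all_classical all_reals all_analysis.

Set Implicit Arguments.
Unset Strict Implicit.
Unset Printing Implicit Defensive.

Import Order.TTheory GRing.Theory Num.Theory.
Import numFieldNormedType.Exports.

Local Open Scope classical_set_scope.
Local Open Scope ring_scope.
Local Open Scope complex_scope.

(* The complex numbers, packaged as a [numFieldType] so that the topology and
   the derivative are those of a [numFieldType] over itself. *)
Definition Cplx (R : realType) : numFieldType := R[i].

Section IteratedOrder.
Context {R : realType}.
Implicit Types (f : Cplx R -> Cplx R) (r x : R) (n : nat).

Definition punctured_disc (rho : R) : set (Cplx R) :=
  [set z | 0 < `|z| < rho%:C].

(* Used only for open [D].  The ground field of [derivable] is [Cplx R], so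
   this is complex differentiability. *)
Definition analytic_on (D : set (Cplx R)) f : Prop :=
  forall z, D z -> derivable f z 1.

(* The convention [ln x = 0] for [x <= 0] agrees with log^+ 0 = 0. *)
Definition logp x : R := Num.max (ln x) 0.

(* The norm [`|_|] is [Cplx R]-valued, hence [complex.Re].  When [f] is
   continuous on the circle, the supremum is a maximum. *)
Definition max_modulus r f : R :=
  sup [set complex.Re `|f z| | z in [set z : Cplx R | `|z| = r%:C]].

(* log^+_n is the [n]-fold iterate of log^+. *)
Definition iterated_order n f : \bar R :=
  limf_esup (fun r => (iter n.+1 logp (max_modulus r f) / - ln r)%:E) 0^'+.

End IteratedOrder.

(* Main.v *)
(** Write [x = - ln r] and let [sigma] be the order of [A 0].

    Upper bound: along a ray, [f] and its derivatives solve a linear system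
    whose coefficients are at most a tower in [s * x], [s > sigma], so that
    Gronwall's inequality costs one more exponential.

    Lower bound: if the order of [f] and of the other coefficients were below
    [s < sigma], then on the annulus [r / 2 <= |z| <= 3 r / 2] we would have
    [|f| <= exp T] and [|A j| <= T] for [0 < j], with [T] a tower in [s * x].
    As [f] cannot be smaller than a power of [r] on a whole circle, three-circle
    estimates give, near any [z0] with [|z0| = r], a point [c] with
    [|f c| >= exp (- Q * T)].  The number of zeros of [f] around [c] is then
    [O(T)], so some circle around [c] enclosing [z0] avoids them well enough for
    [f] to be comparable to [f z] on the disc of radius [~ r / T ^ 2] around each
    of its points [z].  Cauchy's estimates bound the quotients
    [f ^ (j) / f], hence [A 0], by a power of [T / r] on this circle, and the
    maximum principle extends the bound to [z0]: [A 0] would have order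
    less than [sigma]. *)

Require Import Defs.
From mathcomp Require Import all_boot all_order all_algebra.
From mathcomp Require Import complex.
From mathcomp Require Import all_classical all_reals all_analysis.
From mathcomp Require Import ring lra.

Set Implicit Arguments.
Unset Strict Implicit.
Unset Printing Implicit Defensive.

Import Order.TTheory GRing.Theory Num.Theory.
Import numFieldNormedType.Exports.

Local Open Scope classical_set_scope.
Local Open Scope ring_scope.
Local Open Scope complex_scope.

(** * Complex differentiation *)

(** The usual estimates of [f ^ (j) / f] hold off an exceptional set of radii. An order is an upper
    limit over all [r], so bounding that of [A 0] requires every small radius and every point [z0]
    of the circle. Hence the circles centred at [c] instead of the origin: the zeros of [f] only
    restrict the choice of a small radius, and the maximum principle applies to [A 0], which is
    holomorphic there even where [f] vanishes.

    All losses may be polynomial in [T] because the orders of [f] and of [A j] have indices [n.+1]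
    and [n]: [ln |f|] and [|A j|] are then bounded by towers of the same height [n.+1]. Raising a
    tower to a power multiplies the exponent below it by a constant, and a slightly larger [s]
    absorbs the constant as long as that exponent is itself a tower. This is where [0 < n] enters.

    The complex analysis is kept minimal: integrals run along segments, a square replaces the circle
    in Cauchy's formula, its only role being to show that derivatives are holomorphic, and the
    maximum principle comes from a four-point mean. Power series, arguments and the complex
    exponential are avoided. *)

Section ComplexNorm.
Context {R : realType}.
Local Notation C := (Cplx R).
Implicit Types (z w : C) (x y : R).

(* Real-valued modulus: [`|z|] lives in [Cplx R]. *)
Definition nm z : R := complex.Re `|z|.

Lemma nmE z : `|z| = (nm z)%:C.
Proof. by rewrite /nm normc_def. Qed.

Lemma nm_sqrt z : nm z = Num.sqrt (complex.Re z ^+ 2 + complex.Im z ^+ 2).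
Proof. by rewrite /nm normc_def. Qed.

Lemma nm_ge0 z : 0 <= nm z.
Proof. by rewrite nm_sqrt sqrtr_ge0. Qed.

Lemma nm_eq0 z : (nm z == 0) = (z == 0).
Proof. by rewrite -[RHS]normr_eq0 nmE (inj_eq (@complexI R)). Qed.

Lemma nm0 : nm 0 = 0.
Proof. by apply/eqP; rewrite nm_eq0. Qed.

Lemma nm1 : nm 1 = 1.
Proof. by apply: (@complexI R); rewrite -nmE normr1. Qed.

Lemma nmM z w : nm (z * w) = nm z * nm w.
Proof. by apply: (@complexI R); rewrite rmorphM /= -!nmE normrM. Qed.

Lemma nmN z : nm (- z) = nm z.
Proof. by rewrite /nm normrN. Qed.

Lemma nmB z w : nm (z - w) = nm (w - z).
Proof. by rewrite -nmN opprB. Qed.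

Lemma nmD z w : nm (z + w) <= nm z + nm w.
Proof. by rewrite -lecR rmorphD /= -!nmE ler_normD. Qed.

Lemma nmBle z w : nm (z - w) <= nm z + nm w.
Proof. by rewrite -(nmN w) nmD. Qed.

Lemma nmtri z u w : nm (z - w) <= nm (z - u) + nm (u - w).
Proof. by apply: le_trans (nmD _ _); rewrite addrA subrK. Qed.

Lemma nm_sub z w : nm z - nm w <= nm (z - w).
Proof. by rewrite lerBlDr; apply: le_trans (nmD _ _); rewrite subrK. Qed.

Lemma nmV z : nm z^-1 = (nm z)^-1.
Proof. by apply: (@complexI R); rewrite fmorphV /= -!nmE normfV. Qed.

Lemma nmX z n : nm (z ^+ n) = nm z ^+ n.
Proof. by apply: (@complexI R); rewrite rmorphXn /= -!nmE normrX. Qed.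

Lemma nmR x : nm x%:C = `|x|.
Proof. by rewrite nm_sqrt /= expr0n /= addr0 sqrtr_sqr. Qed.

Lemma nm_nat n : nm n%:R = n%:R.
Proof. by apply: (@complexI R); rewrite -nmE normr_nat rmorph_nat. Qed.

Lemma nm_sum (I : Type) (s : seq I) (P : pred I) (F : I -> C) :
  nm (\sum_(i <- s | P i) F i) <= \sum_(i <- s | P i) nm (F i).
Proof.
elim/big_rec2: _ => [|i x y _ h]; first by rewrite nm0.
by apply: le_trans (nmD _ _) _; rewrite lerD2l.
Qed.

Lemma nm_prod (I : Type) (s : seq I) (P : pred I) (F : I -> C) :
  nm (\prod_(i <- s | P i) F i) = \prod_(i <- s | P i) nm (F i).
Proof.
by elim/big_rec2: _ => [|i x y _ h]; rewrite ?nm1 // nmM h.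
Qed.

Lemma Re_le_nm z : `|complex.Re z| <= nm z.
Proof. by rewrite -lecR -nmE normc_ge_Re. Qed.

Lemma Im_le_nm z : `|complex.Im z| <= nm z.
Proof.
rewrite nm_sqrt -sqrtr_sqr ler_sqrt; last by rewrite addr_ge0 ?sqr_ge0.
by rewrite lerDr sqr_ge0.
Qed.

Lemma nm_le_ReIm z : nm z <= `|complex.Re z| + `|complex.Im z|.
Proof.
have -> : z = (complex.Re z)%:C + 'i%C * (complex.Im z)%:C by exact: complexE.
apply: le_trans (nmD _ _) _.
rewrite nmM !nmR nm_sqrt /= !(expr0n, expr1n, add0r) sqrtr1 mul1r.
by rewrite !(mul0r, mul1r, mulr0, addr0, subr0, add0r, subrr) /=.
Qed.

Lemma nm_sqr z : nm z ^+ 2 = complex.Re z ^+ 2 + complex.Im z ^+ 2.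
Proof. by rewrite nm_sqrt sqr_sqrtr // addr_ge0 ?sqr_ge0. Qed.

Lemma ReD z w : complex.Re (z + w) = complex.Re z + complex.Re w.
Proof. by case: z => ? ?; case: w. Qed.
Lemma ReN z : complex.Re (- z) = - complex.Re z.
Proof. by case: z. Qed.
Lemma ImD z w : complex.Im (z + w) = complex.Im z + complex.Im w.
Proof. by case: z => ? ?; case: w. Qed.
Lemma ImN z : complex.Im (- z) = - complex.Im z.
Proof. by case: z. Qed.
Lemma ReM z w : complex.Re (z * w) =
  complex.Re z * complex.Re w - complex.Im z * complex.Im w.
Proof. by case: z => ? ?; case: w. Qed.
Lemma ImM z w : complex.Im (z * w) =
  complex.Re z * complex.Im w + complex.Im z * complex.Re w.
Proof. by case: z => ? ?; case: w. Qed.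

Lemma nm_gt0 z : (0 < nm z) = (z != 0).
Proof. by rewrite lt_def nm_ge0 andbT nm_eq0. Qed.

Lemma lt_nm z x : (`|z| < x%:C) = (nm z < x).
Proof. by rewrite nmE ltcR. Qed.
(** In the order of [Cplx R] a positive number has zero imaginary part, so balls with complex radii
    reduce to balls with real ones. *)
Lemma posC (e : C) : 0 < e -> exists2 d : R, 0 < d & e = d%:C.
Proof.
move=> e0; exists (complex.Re e); first by move: e0; rewrite ltcE => /andP[].
by move: e0; rewrite ltcE /= => /andP[/eqP h _]; rewrite [LHS]complexE h mulr0 addr0.
Qed.

Lemma nbhsC (z : C) (P : set C) :
  nbhs z P <-> exists2 d : R, 0 < d & forall w, nm (w - z) < d -> P w.
Proof.
split=> [/nbhs_ballP[e /= /posC[d d0 ->] h]|[d d0 h]].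
  by exists d => // w; rewrite nmB => hw; apply: h; rewrite /ball /= /ball_ lt_nm.
apply/nbhs_ballP; exists d%:C; first by rewrite /= ltcR.
by move=> w; rewrite /ball /= /ball_ lt_nm nmB => hw; apply: h.
Qed.

End ComplexNorm.

Section Differentiability.
Context {R : realType}.
Local Notation C := (Cplx R).
Implicit Types (f g : C -> C) (z w : C).

Definition cder f z (l : C) := is_derive z (1 : C) f l.

Lemma cderP f z l : cder f z l <-> forall e : R, 0 < e ->
  exists2 d : R, 0 < d &
    forall h : C, nm h < d -> nm (f (z + h) - f z - l * h) <= e * nm h.
Proof.
split.
  move=> [df dv] e e0.
  have : (fun h => h^-1 *: (f (h *: 1 + z) - f z)) @ 0^' --> (l : C).
    by rewrite -dv; exact: df.
  move/cvgrPdist_le => /(_ e%:C); rewrite ltcR => /(_ e0) /nbhsC[d d0 h].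
  exists d => // k kd; have [->|k0] := eqVneq k 0.
    by rewrite addr0 mulr0 subrr subr0 nm0 mulr0.
  have := h k; rewrite subr0 => /(_ kd k0) /=.
  rewrite nmE lecR => hk.
  have -> : f (z + k) - f z - l * k =
            - (k * (l - k^-1 *: (f (k *: 1 + z) - f z))).
    rewrite mulrBr /GRing.scale /= mulr1 [k + z]addrC mulrA divff // mul1r.
    by rewrite opprB [l * k]mulrC.
  by rewrite nmN nmM mulrC ler_wpM2r ?nm_ge0.
move=> H.
have K : (fun h => h^-1 *: (f (h *: 1 + z) - f z)) @ 0^' --> (l : C).
  apply/cvgrPdist_le => _ /posC[e e0 ->].
  have [d d0 h] := H e e0.
  apply/nbhsC; exists d => // k; rewrite subr0 => kd k0 /=.
  rewrite nmE lecR.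
  have k0' : 0 < nm k by rewrite nm_gt0.
  rewrite -(ler_pM2r k0') -nmM mulrBl /GRing.scale /= mulr1 [k + z]addrC.
  by rewrite mulrAC mulVf // mul1r nmB; exact: h.
split; first by apply/cvg_ex; exists l.
exact/cvg_lim.
Qed.

Lemma derivable_cder f z : derivable f z 1 <-> exists l, cder f z l.
Proof.
split=> [h|[l [h _]] //]; by exists ('D_1 f z); apply: DeriveDef.
Qed.

Lemma cder_derive1 f z l : cder f z l -> derive1 f z = l.
Proof. by move=> [h1 h2]; rewrite derive1E. Qed.

Lemma cder_uniq f z l l' : cder f z l -> cder f z l' -> l = l'.
Proof. by move=> [_ <-] [_ <-]. Qed.

Lemma cder_cst (a : C) z : cder (fun=> a) z 0.
Proof. exact: is_derive_cst. Qed.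

Lemma cder_id z : cder (fun w => w) z 1.
Proof. exact: is_derive_id. Qed.

Lemma cderD f g z l m : cder f z l -> cder g z m ->
  cder (fun w => f w + g w) z (l + m).
Proof. by move=> hf hg; exact: is_deriveD. Qed.

Lemma cderN f z l : cder f z l -> cder (fun w => - f w) z (- l).
Proof. by move=> hf; exact: is_deriveN. Qed.

Lemma cderB f g z l m : cder f z l -> cder g z m ->
  cder (fun w => f w - g w) z (l - m).
Proof. by move=> hf hg; exact: is_deriveB. Qed.

Lemma cderM f g z l m : cder f z l -> cder g z m ->
  cder (fun w => f w * g w) z (l * g z + f z * m).
Proof.
move=> hf hg; have := @is_deriveM _ _ f g z 1 l m hf hg.
by rewrite /cder addrC /GRing.scale /= [g z * _]mulrC.
Qed.

Lemma cderV f z l : f z != 0 -> cder f z l ->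
  cder (fun w => (f w)^-1) z (- (f z) ^- 2 * l).
Proof.
move=> f0 [hf <-]; split; first exact: derivableV.
by rewrite deriveV.
Qed.

Lemma cder_near f g z l (d : R) : 0 < d ->
  (forall w, nm (w - z) < d -> f w = g w) -> cder f z l -> cder g z l.
Proof.
move=> d0 h; apply: near_eq_is_derive.
by apply/nbhsC; exists d.
Qed.

Lemma cderX f z l n : cder f z l ->
  cder (fun w => f w ^+ n) z (n%:R * f z ^+ n.-1 * l).
Proof.
move=> hf; have := @is_deriveX _ _ f n z 1 l hf.
by apply: cder_near ltr01 _ => w _; rewrite exprfctE.
Qed.

Lemma cder_eq f z l m : cder f z l -> l = m -> cder f z m.
Proof. by move=> ? <-. Qed.

Lemma cder_sum n (F : 'I_n -> C -> C) (L : 'I_n -> C) z :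
  (forall i, cder (F i) z (L i)) ->
  cder (fun w => \sum_(i < n) F i w) z (\sum_(i < n) L i).
Proof.
move=> h; have := @is_derive_sum _ _ _ n F z 1 L h.
by apply: cder_near ltr01 _ => w _; rewrite fct_sumE.
Qed.

Lemma cder_cont f z l : cder f z l -> forall e : R, 0 < e ->
  exists2 d : R, 0 < d & forall w, nm (w - z) < d -> nm (f w - f z) <= e.
Proof.
move=> /cderP /(_ 1 ltr01)[d d0 H] e e0.
have l0 : 0 < nm l + 1 by rewrite ltr_pwDr // nm_ge0.
exists (Num.min d (e / (nm l + 1))); first by rewrite lt_min d0 divr_gt0.
move=> w; rewrite lt_min => /andP[w1 w2].
have := H _ w1; rewrite [z + _]addrC subrK => h.
have -> : f w - f z = (f w - f z - l * (w - z)) + l * (w - z) by rewrite subrK.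
apply: le_trans (nmD _ _) _; rewrite nmM.
rewrite ltr_pdivlMr // in w2.
lra.
Qed.

End Differentiability.

(** * Curves in the complex plane, mean value inequalities and extreme values *)

Section RealCurves.
Context {R : realType}.
Local Notation C := (Cplx R).
Implicit Types (F f : C -> C) (P : R -> C) (z w a b : C) (t s : R).

Lemma is_derive_epsP (f : R -> R) t l : is_derive t (1 : R) f l <->
  forall e : R, 0 < e -> exists2 d : R, 0 < d &
    forall s, `|s| < d -> `|f (t + s) - f t - l * s| <= e * `|s|.
Proof.
split.
  move=> [df dv] e e0.
  have : (fun h => h^-1 *: (f (h *: 1 + t) - f t)) @ 0^' --> (l : R).
    by rewrite -dv; exact: df.
  move/cvgrPdist_le => /(_ e e0) /nbhs_ballP[d d0 h].
  exists d => // k kd; have [->|k0] := eqVneq k 0.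
    by rewrite addr0 mulr0 subrr subr0 normr0 mulr0.
  have := h k; rewrite /ball /= sub0r normrN => /(_ kd k0) hk.
  have -> : f (t + k) - f t - l * k =
            - (k * (l - k^-1 *: (f (k *: 1 + t) - f t))).
    rewrite mulrBr /GRing.scale /= mulr1 [k + t]addrC mulrA divff // mul1r.
    by rewrite opprB [l * k]mulrC.
  by rewrite normrN normrM mulrC ler_wpM2r.
move=> H.
have K : (fun h => h^-1 *: (f (h *: 1 + t) - f t)) @ 0^' --> (l : R).
  apply/cvgrPdist_le => e e0.
  have [d d0 h] := H e e0.
  apply/nbhs_ballP; exists d => //= k; rewrite /ball /= sub0r normrN => kd k0 /=.
  have k0' : 0 < `|k| by rewrite normr_gt0.
  rewrite -(ler_pM2r k0') -normrM mulrBl /GRing.scale /= mulr1 [k + t]addrC.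
  by rewrite mulrAC mulVf // mul1r distrC; exact: h.
split; first by apply/cvg_ex; exists l.
exact/cvg_lim.
Qed.

(** The derivative in a real variable of a curve in [Cplx R], whose own derivative [cder] has
    complex increments; hence the explicit epsilons. *)
Definition rder P t (l : C) := forall e : R, 0 < e ->
  exists2 d : R, 0 < d & forall s, `|s| < d ->
    nm (P (t + s) - P t - l * s%:C) <= e * `|s|.

Lemma rder_line F a b t l : cder F (a + t%:C * b) l ->
  rder (fun t => F (a + t%:C * b)) t (l * b).
Proof.
move=> /cderP H e e0.
have b0 : 0 < nm b + 1 by rewrite ltr_pwDr // nm_ge0.
have [d d0 h] := H _ (divr_gt0 e0 b0).
exists (d / (nm b + 1)); first exact: divr_gt0.
move=> s; rewrite ltr_pdivlMr // => hs.
have sb : nm (s%:C * b) <= `|s| * (nm b + 1).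
  by rewrite nmM nmR ler_wpM2l // lerDl.
have := h (s%:C * b) (le_lt_trans sb hs).
have -> : (t + s)%:C = t%:C + s%:C :> C by rewrite rmorphD.
rewrite mulrDl addrA -mulrA [b * _]mulrC => /le_trans; apply.
rewrite mulrAC ler_pdivrMr // -mulrA.
by rewrite ler_wpM2l // ltW.
Qed.

(** The factor [u] selects a real coordinate of the curve: 1 gives the real part, [- 'i] the
    imaginary part, and the conjugate of an increment its squared modulus. *)
Lemma rder_Re P t l u : rder P t l ->
  is_derive t (1 : R) (fun t => complex.Re (u * P t)) (complex.Re (u * l)).
Proof.
move=> H; apply/is_derive_epsP => e e0.
have u0 : 0 < nm u + 1 by rewrite ltr_pwDr // nm_ge0.
have [d d0 h] := H _ (divr_gt0 e0 u0).
exists d => // s sd; have {h} := h s sd.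
set z := P _ - _ - _ => hz.
have -> : complex.Re (u * P (t + s)) - complex.Re (u * P t) -
  complex.Re (u * l) * s = complex.Re (u * z).
  rewrite /z; case: u (P (t + s)) (P t) l {H hz u0 z} => a b [a1 b1] [a2 b2] [a3 b3].
  rewrite !(ReM, ReD, ReN, ImD, ImN, ImM) /=; ring.
apply: le_trans (Re_le_nm _) _; rewrite nmM.
apply: le_trans (_ : nm u * (e / (nm u + 1) * `|s|) <= _).
  by rewrite ler_wpM2l // nm_ge0.
rewrite mulrA ler_wpM2r // mulrA ler_pdivrMr // mulrC ler_wpM2l ?lerDl //.
exact: ltW.
Qed.

Lemma is_derive_nm_sqr (P : R -> C) (t : R) l : rder P t l ->
  is_derive t (1 : R) (fun t => nm (P t) ^+ 2)
    (2 * (complex.Re (P t) * complex.Re l + complex.Im (P t) * complex.Im l)).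
Proof.
move=> hP; have a1 := rder_Re 1 hP; have a2 := rder_Re (- 'i) hP.
have E : (fun t => nm (P t) ^+ 2) = (fun t => complex.Re (1 * P t)) ^+ 2 +
    (fun t => complex.Re (- 'i * P t)) ^+ 2.
  apply/funext => x; rewrite addrfctE !exprfctE nm_sqr.
  case: (P x) => x1 x2 /=.
  by rewrite !(mul1r, mul0r, subr0, addr0, add0r, oppr0, sub0r, mulNr, mulrN, opprK).
rewrite E; apply: is_derive_eq (is_deriveD (is_deriveX 2 a1) (is_deriveX 2 a2)) _.
rewrite /GRing.scale /=; case: (P t) => x1 x2; case: (l) => l1 l2 /=.
rewrite !(mul1r, mul0r, expr1, subr0, addr0, add0r, oppr0, sub0r, mulNr, mulrN, opprK).
ring.
Qed.

(** A curve has no intermediate point realising its increment [D], but the real function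
    [Re (u * P t)] does, with [u] the conjugate of [D]; there [Re (u * D)] is [nm D ^+ 2], and one
    factor [nm D] cancels. *)
Lemma mean_value_curve P (p : R -> C) (x y K : R) : x <= y ->
  (forall t, x <= t <= y -> rder P t (p t)) ->
  (forall t, x <= t <= y -> nm (p t) <= K) ->
  nm (P y - P x) <= K * (y - x).
Proof.
move=> xy dP bP; set D := P y - P x.
pose u : C := (D : R[i])^*.
have nu : nm u = nm D by rewrite /nm /u normcJ.
have uD : complex.Re (u * D) = nm D ^+ 2.
  by rewrite nm_sqr /u ReM; case: (D) => ? ? /=; ring.
have [||c cxy] := @MVT_segment R (fun t => complex.Re (u * P t))
   (fun t => complex.Re (u * p t)) x y xy.
- move=> t; rewrite in_itv /= => /andP[t1 t2]; apply: rder_Re.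
  by apply: dP; rewrite !ltW.
- apply: derivable_within_continuous => t; rewrite in_itv /= => ht.
  by have [] := rder_Re u (dP t ht).
rewrite in_itv /= in cxy.
rewrite -ReN -ReD -mulrN -mulrDr -/D uD => E.
have [D0|D0] := eqVneq (nm D) 0.
  rewrite D0 mulr_ge0 ?subr_ge0 //.
  by apply: le_trans (bP c cxy); exact: nm_ge0.
have Dp : 0 < nm D by rewrite lt_def D0 nm_ge0.
rewrite -(ler_pM2l Dp) -expr2 E mulrA.
rewrite ler_wpM2r ?subr_ge0 //.
apply: le_trans (ler_norm _) _; apply: le_trans (Re_le_nm _) _.
by rewrite nmM nu ler_wpM2l ?nm_ge0 // bP.
Qed.

Lemma mean_value_segment F (f : C -> C) a b (K : R) :
  (forall t : R, 0 <= t <= 1 -> cder F (a + t%:C * (b - a)) (f (a + t%:C * (b - a)))) ->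
  (forall t : R, 0 <= t <= 1 -> nm (f (a + t%:C * (b - a))) <= K) ->
  nm (F b - F a) <= K * nm (b - a).
Proof.
move=> dF bF.
have := @mean_value_curve (fun t => F (a + t%:C * (b - a)))
  (fun t => f (a + t%:C * (b - a)) * (b - a)) 0 1 (K * nm (b - a)) ler01.
rewrite subr0 mulr1 rmorph1 rmorph0 mul1r mul0r addr0 [a + _]addrC subrK; apply.
- by move=> t t01; apply: rder_line; exact: dF.
- by move=> t t01; rewrite nmM ler_wpM2r ?nm_ge0 // bF.
Qed.

Lemma nm_seg_le a b z t d : 0 <= t <= 1 -> nm (a - z) <= d -> nm (b - z) <= d ->
  nm (a + t%:C * (b - a) - z) <= d.
Proof.
move=> /andP[t0 t1] ha hb.
have -> : a + t%:C * (b - a) - z = (1 - t)%:C * (a - z) + t%:C * (b - z).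
  have -> : (1 - t)%:C = 1 - t%:C :> C by rewrite rmorphB.
  ring.
apply: le_trans (nmD _ _) _; rewrite !nmM !nmR !ger0_norm ?subr_ge0 //.
nra.
Qed.

Lemma nm_seg_lt a b z t d : 0 <= t <= 1 -> nm (a - z) < d -> nm (b - z) < d ->
  nm (a + t%:C * (b - a) - z) < d.
Proof.
move=> t01 ha hb.
apply: (@le_lt_trans _ _ (Num.max (nm (a - z)) (nm (b - z)))).
  by apply: nm_seg_le => //; rewrite le_max lexx ?orbT.
by rewrite gt_max ha hb.
Qed.

Lemma cder_sqr_center z (l : C) w :
  cder (fun w => l / 2 * ((w - z) * (w - z))) w (l * (w - z)).
Proof.
have h : cder (fun w => w - z) w 1.
  by apply: cder_eq (cderB (cder_id w) (cder_cst z w)) _; rewrite subr0.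
apply: cder_eq (cderM (cder_cst _ w) (cderM h h)) _.
by field.
Qed.

(** Subtracting the quadratic polynomial from [F] leaves a function [G] whose derivative [g] is
    [o(|w - z|)] because [f] is differentiable at [z]; the mean value inequality gains one more
    factor [|h|]. *)
Lemma peano2 F f z (l : C) (r : R) : 0 < r ->
  (forall w, nm (w - z) < r -> cder F w (f w)) -> cder f z l ->
  forall e : R, 0 < e -> exists2 d : R, 0 < d & forall h : C, nm h < d ->
    nm (F (z + h) - F z - f z * h - l / 2 * h ^+ 2) <= e * nm h ^+ 2.
Proof.
move=> r0 dF /cderP df e e0; have [d d0 H] := df e e0.
exists (Num.min d r); first by rewrite lt_min d0.
move=> h; rewrite lt_min => /andP[hd hr].
pose G w := F w - f z * (w - z) - l / 2 * ((w - z) * (w - z)).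
pose g w := f w - f z - l * (w - z).
have -> : F (z + h) - F z - f z * h - l / 2 * h ^+ 2 = G (z + h) - G z.
  by rewrite /G; ring.
have -> : e * nm h ^+ 2 = e * nm h * nm (z + h - z).
  by rewrite addrAC subrr add0r expr2 mulrA.
have seg t : 0 <= t <= 1 -> nm (z + t%:C * (z + h - z) - z) <= nm h.
  move=> t01; apply: nm_seg_le t01 _ _; first by rewrite subrr nm0 nm_ge0.
  by rewrite addrAC subrr add0r.
apply: (@mean_value_segment G g) => t t01.
  set w := z + _; have wr : nm (w - z) < r by apply: le_lt_trans (seg t t01) hr.
  have h1 : cder (fun w => w - z) w 1.
    by apply: cder_eq (cderB (cder_id w) (cder_cst z w)) _; rewrite subr0.
  apply: cder_eq (cderB (cderB (dF w wr) (cderM (cder_cst (f z) w) h1))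
    (cder_sqr_center z l w)) _.
  by rewrite /g; ring.
have /H := le_lt_trans (seg t t01) hd.
rewrite [z + (_ - z)]addrC subrK => /le_trans; apply.
by rewrite ler_wpM2l ?seg // ltW.
Qed.

(* Explicit epsilons stand in for the topology of [Cplx R], whose balls have
   complex radii. *)
Lemma EVT_complex (K : set C) (u : C -> R) (B : R) : K !=set0 ->
  (forall z, K z -> nm z <= B) ->
  (forall z, ~ K z -> exists2 d : R, 0 < d & forall w, nm (w - z) < d -> ~ K w) ->
  (forall z, K z -> forall e : R, 0 < e -> exists2 d : R, 0 < d &
     forall w, K w -> nm (w - z) < d -> `|u w - u z| <= e) ->
  exists2 c, K c & forall z, K z -> u z <= u c.
Proof.
move=> [z0 Kz0] bK oK cu.
pose phi (p : R * R) : C := p.1 +i* p.2.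
pose psi z : R * R := (complex.Re z, complex.Im z).
have psiK z : phi (psi z) = z by case: z.
pose K' := phi @^-1` K.
have dphi p q : nm (phi p - phi q) <= `|p.1 - q.1| + `|p.2 - q.2|.
  by apply: le_trans (nm_le_ReIm _) _; rewrite /phi /= lexx.
have cK' : compact K'.
  apply: (@subclosed_compact _ K' (`[-B, B] `*` `[-B, B])).
  - move=> p clp; apply: contrapT => /oK[d d0 H].
    have /clp[q [Kq]] : nbhs p (ball p (d / 2)) by apply: nbhsx_ballx; rewrite divr_gt0.
    rewrite /ball /= /ball_ /= => -[q1 q2].
    apply: H Kq; apply: le_lt_trans (dphi _ _) _.
    by rewrite [`|q.1 - _|]distrC [`|q.2 - _|]distrC /= (splitr d) ltrD.
  - by apply: compact_setX; exact: segment_compact.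
  - move=> p /bK Kp; split => /=; rewrite in_itv /= -ler_norml.
      by apply: le_trans (Re_le_nm (phi p)) Kp.
    by apply: le_trans (Im_le_nm (phi p)) Kp.
have [||p Kp Hp] := @compact_EVT_max _ R (u \o phi) K' _ cK'.
- by exists (psi z0); rewrite /K' /= psiK.
- apply/subspace_continuousP => p Kp; apply/cvgrPdist_le => e e0.
  have [d d0 H] := cu _ Kp e e0.
  rewrite near_withinE; exists (ball p.1 (d / 2), ball p.2 (d / 2)) => /=.
    by split; apply: nbhsx_ballx; rewrite divr_gt0.
  move=> q [/= q1 q2] Kq; rewrite distrC; apply: H => //.
  apply: le_lt_trans (dphi _ _) _; rewrite [`|q.1 - _|]distrC [`|q.2 - _|]distrC.
  by rewrite (splitr d) ltrD.
exists (phi p); first exact: set_mem Kp.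
move=> z Kz; rewrite -(psiK z); apply: Hp; apply/mem_set.
by rewrite /K' /= psiK.
Qed.

End RealCurves.

(** * Integrals along segments *)

Section SegmentIntegral.
Context {R : realType}.
Local Notation C := (Cplx R).
Implicit Types (F f g : C -> C) (P Q phi : R -> C) (z w a b c : C) (t s : R).

Definition ccont f z := forall e : R, 0 < e ->
  exists2 d : R, 0 < d & forall w, nm (w - z) < d -> nm (f w - f z) <= e.

Definition continuous01 phi := forall t, 0 <= t <= 1 -> forall e : R, 0 < e ->
  exists2 d : R, 0 < d &
    forall s, 0 <= s <= 1 -> `|s - t| < d -> nm (phi s - phi t) <= e.

Definition antider phi P := forall t, 0 <= t <= 1 -> rder P t (phi t).

Lemma real_antider (g : R -> R) :
  (forall t, 0 <= t <= 1 -> forall e : R, 0 < e -> exists2 d : R, 0 < d &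
    forall s, 0 <= s <= 1 -> `|s - t| < d -> `|g s - g t| <= e) ->
  exists G : R -> R, forall t, 0 <= t <= 1 -> is_derive t (1 : R) G (g t).
Proof.
(* Clamping extends [g] continuously to the whole line, so that the antiderivative has two-sided
   derivatives even at 0 and 1. For the same reason the integral below starts at -1 and the interval
   ends at 2. *)
move=> cg; pose clamp (t : R) := Num.max 0 (Num.min t 1).
have clE t : clamp t = if t <= 0 then 0 else if 1 <= t then 1 else t.
  rewrite /clamp; case: (leP t 0) => t0; last case: (leP 1 t) => t1.
  - by rewrite (min_l (le_trans t0 ler01)) max_l.
  - by rewrite max_r.
  - by rewrite max_r // ltW.
have cl01 t : 0 <= clamp t <= 1.
  by rewrite clE; case: (leP t 0) => h1; case: (leP 1 t) => h2; lra.
have cl_id t : 0 <= t <= 1 -> clamp t = t.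
  by rewrite clE; case: (leP t 0) => h1; case: (leP 1 t) => h2; lra.
have cl_lip t s : `|clamp s - clamp t| <= `|s - t|.
  rewrite !clE; case: (leP t 0) => h1; case: (leP 1 t) => h2;
  case: (leP s 0) => h3; case: (leP 1 s) => h4; case: (lerP t s) => h5;
  rewrite ?ler_norml; try (apply/andP; split); move: h1 h2 h3 h4 h5; lra.
pose gc t := g (clamp t).
have cgc : continuous gc.
  move=> t; apply/cvgrPdist_le => e e0; have [d d0 H] := cg _ (cl01 t) e e0.
  apply/nbhs_ballP; exists d => // s; rewrite /ball /= distrC => ts.
  by rewrite distrC; apply: H => //; apply: le_lt_trans ts.
exists (fun x => (\int[lebesgue_measure]_(t in [set` `[-1, x]]) gc t)%R).
move=> t t01; have [||||h1 h2] := @continuous_FTC1_closed R gc (-1) t 2.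
- by lra.
- apply: continuous_compact_integrable; first exact: segment_compact.
  exact: continuous_subspaceT.
- by lra.
- exact: cgc.
apply: DeriveDef; first exact: h1.
by rewrite -derive1E h2 /gc cl_id.
Qed.

Lemma antider_exists phi : continuous01 phi -> exists P, antider phi P.
Proof.
move=> cphi.
have [|G1 H1] := @real_antider (fun t => complex.Re (phi t)).
  move=> t t01 e e0; have [d d0 H] := cphi t t01 e e0; exists d => // s s01 st.
  by rewrite -ReN -ReD; apply: le_trans (Re_le_nm _) _; apply: H.
have [|G2 H2] := @real_antider (fun t => complex.Im (phi t)).
  move=> t t01 e e0; have [d d0 H] := cphi t t01 e e0; exists d => // s s01 st.
  by rewrite -ImN -ImD; apply: le_trans (Im_le_nm _) _; apply: H.
exists (fun t => G1 t +i* G2 t) => t t01 e e0.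
have e20 : 0 < e / 2 by rewrite divr_gt0.
have /is_derive_epsP/(_ _ e20)[d1 d10 K1] := H1 t t01.
have /is_derive_epsP/(_ _ e20)[d2 d20 K2] := H2 t t01.
exists (Num.min d1 d2); first by rewrite lt_min d10.
move=> s; rewrite lt_min => /andP[s1 s2].
apply: le_trans (nm_le_ReIm _) _.
rewrite !(ReM, ReD, ReN, ImD, ImN, ImM) /= !(mulr0, subr0, add0r).
by have := lerD (K1 s s1) (K2 s s2); rewrite -mulrDl -splitr.
Qed.

(** The integral over [[0, 1]], encoded as the increment of a chosen antiderivative; [cintE] shows
    that the choice is immaterial. If there is none, the default curve gives 0. *)
Definition cint phi : C :=
  let P := xget (fun=> 0) [set P | antider phi P] in P 1 - P 0.

Lemma rderB P Q t l m : rder P t l -> rder Q t m ->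
  rder (fun t => P t - Q t) t (l - m).
Proof.
move=> hP hQ e e0; have e20 : 0 < e / 2 by rewrite divr_gt0.
have [d1 d10 H1] := hP _ e20; have [d2 d20 H2] := hQ _ e20.
exists (Num.min d1 d2); first by rewrite lt_min d10.
move=> s; rewrite lt_min => /andP[s1 s2].
have -> : P (t + s) - Q (t + s) - (P t - Q t) - (l - m) * s%:C =
  (P (t + s) - P t - l * s%:C) - (Q (t + s) - Q t - m * s%:C) by ring.
apply: le_trans (nmBle _ _) _.
by have := lerD (H1 s s1) (H2 s s2); rewrite -mulrDl -splitr.
Qed.

Lemma rderZ P t l a : rder P t l -> rder (fun t => a * P t) t (a * l).
Proof.
move=> hP e e0; have a0 : 0 < nm a + 1 by rewrite ltr_pwDr // nm_ge0.
have [d d0 H] := hP _ (divr_gt0 e0 a0).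
exists d => // s sd; rewrite -mulrA -!mulrBr nmM.
apply: le_trans (_ : nm a * (e / (nm a + 1) * `|s|) <= _).
  by rewrite ler_wpM2l ?nm_ge0 ?H.
rewrite mulrA ler_wpM2r // mulrA ler_pdivrMr // mulrC ler_wpM2l ?lerDl //.
exact: ltW.
Qed.

Lemma rder_eq P t l m : rder P t l -> l = m -> rder P t m.
Proof. by move=> ? <-. Qed.

Lemma rderD P Q t l m : rder P t l -> rder Q t m ->
  rder (fun t => P t + Q t) t (l + m).
Proof.
move=> hP hQ; have := rderB hP (rderZ (-1) hQ).
by under eq_fun do rewrite mulN1r opprK; rewrite mulN1r opprK.
Qed.

Lemma rder_affine P t l (u v : R) : rder P (u + v * t) l ->
  rder (fun t => P (u + v * t)) t (v%:C * l).
Proof.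
move=> hP e e0; have v0 : 0 < `|v| + 1 by rewrite ltr_pwDr.
have [d d0 H] := hP _ (divr_gt0 e0 v0).
exists (d / (`|v| + 1)); first exact: divr_gt0.
move=> s; rewrite ltr_pdivlMr // => hs.
have vs : `|v * s| <= `|s| * (`|v| + 1).
  by rewrite normrM mulrC ler_wpM2l // lerDl.
have := H (v * s) (le_lt_trans vs hs).
rewrite mulrDr addrA rmorphM /= [v%:C * l]mulrC mulrA => /le_trans; apply.
rewrite mulrAC ler_pdivrMr // -mulrA.
by rewrite ler_wpM2l // ltW.
Qed.

Lemma antider_approx phi P Q (q : R -> C) (K : R) : antider phi P ->
  antider q Q -> (forall t, 0 <= t <= 1 -> nm (phi t - q t) <= K) ->
  nm ((P 1 - P 0) - (Q 1 - Q 0)) <= K.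
Proof.
move=> hP hQ hK.
have := @mean_value_curve _ (fun t => P t - Q t) (fun t => phi t - q t) 0 1 K ler01.
rewrite subr0 mulr1; have -> : P 1 - Q 1 - (P 0 - Q 0) =
  (P 1 - P 0) - (Q 1 - Q 0) by ring.
by apply => // t t01; apply: rderB; [exact: hP|exact: hQ].
Qed.

Lemma cintE phi P : antider phi P -> cint phi = P 1 - P 0.
Proof.
move=> hP; rewrite /cint; case: xgetP => [Q _ hQ|/(_ P) //].
apply/eqP; rewrite -subr_eq0 -nm_eq0 eq_le nm_ge0 andbT.
by apply: (antider_approx hQ hP) => t _; rewrite subrr nm0.
Qed.

Definition ccont_seg f a b :=
  forall t, 0 <= t <= 1 -> ccont f (a + t%:C * (b - a)).

Definition sint f a b : C := (b - a) * cint (fun t => f (a + t%:C * (b - a))).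

Lemma continuous01_seg f a b : ccont_seg f a b ->
  continuous01 (fun t => f (a + t%:C * (b - a))).
Proof.
move=> cf t t01 e e0; have [d d0 H] := cf t t01 e e0.
have b0 : 0 < nm (b - a) + 1 by rewrite ltr_pwDr // nm_ge0.
exists (d / (nm (b - a) + 1)); first exact: divr_gt0.
move=> s s01; rewrite ltr_pdivlMr // => hs; apply: H.
have -> : a + s%:C * (b - a) - (a + t%:C * (b - a)) = (s - t)%:C * (b - a).
  by rewrite rmorphB; ring.
by rewrite nmM nmR; apply: le_lt_trans hs; rewrite ler_wpM2l // lerDl.
Qed.

Lemma sintP f a b : ccont_seg f a b ->
  exists2 P, antider (fun t => f (a + t%:C * (b - a))) P &
             sint f a b = (b - a) * (P 1 - P 0).
Proof.
move=> /continuous01_seg/antider_exists[P hP]; exists P => //.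
by rewrite /sint (cintE hP).
Qed.

Lemma cder_ccont f z l : cder f z l -> ccont f z.
Proof. by move=> h e e0; exact: cder_cont h e e0. Qed.

(** The one estimate behind all uses of the integral: [g = f] and [K = 0] give the fundamental
    theorem, [F = 0] the length bound, a quadratic [F] the local step of Goursat's theorem, a linear
    [F] the derivative of a primitive. *)
Lemma sint_approx f F g a b (K : R) : ccont_seg f a b ->
  (forall t, 0 <= t <= 1 -> let w := a + t%:C * (b - a) in
     cder F w (g w) /\ nm (f w - g w) <= K) ->
  nm (sint f a b - (F b - F a)) <= K * nm (b - a).
Proof.
move=> cf H; have [P hP ->] := sintP cf.
have := @mean_value_curve _ (fun t => (b - a) * P t - F (a + t%:C * (b - a)))
  (fun t => (b - a) * f (a + t%:C * (b - a)) - g (a + t%:C * (b - a)) * (b - a))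
  0 1 (K * nm (b - a)) ler01.
rewrite subr0 mulr1 rmorph1 rmorph0 mul1r mul0r addr0 [a + _]addrC subrK.
have -> : (b - a) * P 1 - F b - ((b - a) * P 0 - F a) =
  (b - a) * (P 1 - P 0) - (F b - F a) by ring.
apply=> t t01; have [h1 h2] := H t t01.
  by apply: rderB; [exact/rderZ/hP|exact: rder_line].
by rewrite [_ * (b - a)]mulrC -mulrBr nmM mulrC ler_wpM2r ?nm_ge0.
Qed.

Lemma sint_deriv f F a b : ccont_seg f a b ->
  (forall t, 0 <= t <= 1 -> let w := a + t%:C * (b - a) in cder F w (f w)) ->
  sint f a b = F b - F a.
Proof.
move=> cf H; apply/eqP; rewrite -subr_eq0 -nm_eq0 eq_le nm_ge0 andbT.
rewrite -[0 in leRHS](mul0r (nm (b - a))).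
apply: (sint_approx cf) => t t01 w; split; first exact: H.
by rewrite subrr nm0.
Qed.

Lemma sint_bound f a b (K : R) : ccont_seg f a b ->
  (forall t, 0 <= t <= 1 -> nm (f (a + t%:C * (b - a))) <= K) ->
  nm (sint f a b) <= K * nm (b - a).
Proof.
move=> cf H; have := @sint_approx f (fun=> 0) (fun=> 0) a b K cf.
rewrite subrr subr0; apply => t t01 w; split; first exact: cder_cst.
by rewrite /= subr0 H.
Qed.

Lemma ccontD f g z : ccont f z -> ccont g z -> ccont (fun w => f w + g w) z.
Proof.
move=> hf hg e e0; have e20 : 0 < e / 2 by rewrite divr_gt0.
have [d1 d10 H1] := hf _ e20; have [d2 d20 H2] := hg _ e20.
exists (Num.min d1 d2); first by rewrite lt_min d10.
move=> w; rewrite lt_min => /andP[w1 w2]; rewrite opprD addrACA.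
by apply: le_trans (nmD _ _) _; rewrite (splitr e) lerD ?H1 ?H2.
Qed.

Lemma ccontZ f z a : ccont f z -> ccont (fun w => a * f w) z.
Proof.
move=> hf e e0; have a0 : 0 < nm a + 1 by rewrite ltr_pwDr // nm_ge0.
have [d d0 H] := hf _ (divr_gt0 e0 a0).
exists d => // w wd; rewrite -mulrBr nmM.
apply: le_trans (_ : nm a * (e / (nm a + 1)) <= _).
  by rewrite ler_wpM2l ?nm_ge0 ?H.
by rewrite mulrA ler_pdivrMr // mulrC ler_wpM2l ?lerDl // ltW.
Qed.

Lemma sintD f g a b : ccont_seg f a b -> ccont_seg g a b ->
  sint (fun w => f w + g w) a b = sint f a b + sint g a b.
Proof.
move=> cf cg; have [P hP ->] := sintP cf; have [Q hQ ->] := sintP cg.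
rewrite /sint (@cintE _ (fun t => P t + Q t)); first by ring.
by move=> t t01; apply: rderD; [exact: hP|exact: hQ].
Qed.

Lemma sintZ f a b c : ccont_seg f a b ->
  sint (fun w => c * f w) a b = c * sint f a b.
Proof.
move=> cf; have [P hP ->] := sintP cf.
rewrite /sint (@cintE _ (fun t => c * P t)); first by ring.
by move=> t t01; apply: rderZ; exact: hP.
Qed.

Lemma sint_rev f a b : ccont_seg f a b -> sint f b a = - sint f a b.
Proof.
move=> cf; have [P hP ->] := sintP cf.
rewrite /sint (@cintE _ (fun t => -1 * P (1 + - 1 * t))).
  by rewrite [-1 * 1]mulr1 mulr0 subrr addr0; ring.
move=> t t01.
have t01' : 0 <= 1 + -1 * t <= 1 by lra.
apply: rder_eq (rderZ (-1) (rder_affine (hP _ t01'))) _.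
rewrite mulrA rmorphN1 mulrNN mulr1 mul1r; congr f.
by rewrite mulN1r rmorphB rmorph1; ring.
Qed.

Lemma sint_split f a b : ccont_seg f a b ->
  sint f a b = sint f a ((a + b) / 2) + sint f ((a + b) / 2) b.
Proof.
move=> cf; have [P hP ->] := sintP cf.
have h2 : (2^-1 : R)%:C != 0 :> C.
  by rewrite fmorphV rmorph_nat invr_eq0 pnatr_eq0.
rewrite /sint (@cintE _ (fun t => 2 * P (0 + 2^-1 * t))); last first.
  move=> t t01; have t01' : 0 <= 0 + 2^-1 * t <= 1 by lra.
  apply: rder_eq (rderZ 2 (rder_affine (hP _ t01'))) _.
  rewrite mulrA fmorphV rmorph_nat mulfV ?pnatr_eq0 // mul1r; congr f.
  by rewrite add0r rmorphM fmorphV rmorph_nat; field.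
rewrite (@cintE _ (fun t => 2 * P (2^-1 + 2^-1 * t))); last first.
  move=> t t01; have t01' : 0 <= 2^-1 + 2^-1 * t <= 1 by lra.
  apply: rder_eq (rderZ 2 (rder_affine (hP _ t01'))) _.
  rewrite mulrA fmorphV rmorph_nat mulfV ?pnatr_eq0 // mul1r; congr f.
  by rewrite rmorphD rmorphM fmorphV rmorph_nat; field.
rewrite !(mulr0, mulr1, addr0, add0r).
have -> : 2^-1 + 2^-1 = 1 :> R by lra.
by field.
Qed.

End SegmentIntegral.

(** * Goursat's theorem and Cauchy's formula *)

Section Goursat.
Context {R : realType}.
Local Notation C := (Cplx R).
Implicit Types (F f g : C -> C) (z w a b c : C) (t : C * C * C) (r : R).

Definition hol_ball f z r := forall w, nm (w - z) < r -> exists l, cder f w l.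

Lemma hol_ball_seg f z r a b : hol_ball f z r -> nm (a - z) < r ->
  nm (b - z) < r -> ccont_seg f a b.
Proof.
move=> hf ha hb t t01; have [l hl] := hf _ (nm_seg_lt t01 ha hb).
exact: cder_ccont hl.
Qed.

Lemma half_pow_lt (D e : R) : 0 < e -> exists n, D / 2 ^+ n < e.
Proof.
move=> e0; have [n hn] : exists n : nat, D / e < n%:R.
  by exists (Num.truncn (`|D / e|)).+1; apply: le_lt_trans (ler_norm _) _;
     rewrite truncnS_gt.
exists n; rewrite ltr_pdivrMr ?exprn_gt0 // mulrC -ltr_pdivrMr //.
apply: lt_le_trans hn _; rewrite -natrX ler_nat.
by apply: ltnW; exact: ltn_expl.
Qed.

(** The intervals [[v n, w n]] below are nested, their half-width [2 * D / 2 ^+ n] being the tail of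
    the geometric series; the supremum of the left ends lies in all of them. *)
Lemma geometric_limit (u : nat -> R) (D : R) :
  (forall n, `|u n.+1 - u n| <= D / 2 ^+ n) ->
  exists x, forall n, `|u n - x| <= 2 * D / 2 ^+ n.
Proof.
move=> H.
have D0 n : 0 <= D / 2 ^+ n by apply: le_trans (H n).
have S n : D / 2 ^+ n = 2 * (D / 2 ^+ n.+1).
  by rewrite exprS invfM mulrCA mulrA [D * _]mulrC; field;
     rewrite expf_neq0 ?pnatr_eq0.
pose v n := u n - 2 * (D / 2 ^+ n).
pose w n := u n + 2 * (D / 2 ^+ n).
have vS n : v n <= v n.+1.
  by have := H n; rewrite ler_norml /v [in 2 * (D / 2 ^+ n)]S => /andP[? ?]; have := S n; lra.
have wS n : w n.+1 <= w n.
  by have := H n; rewrite ler_norml /w [in 2 * (D / 2 ^+ n)]S => /andP[? ?]; have := S n; lra.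
have vm m n : v n <= v (n + m)%N.
  by elim: m => [|m IH]; rewrite ?addn0 // addnS; apply: le_trans IH (vS _).
have wm m n : w (n + m)%N <= w n.
  by elim: m => [|m IH]; rewrite ?addn0 // addnS; apply: le_trans (wS _) IH.
have vw m n : v m <= w n.
  apply: le_trans (vm n m) _; apply: le_trans (wm m n); rewrite addnC /v /w.
  by have := D0 (n + m)%N; lra.
have hs : has_sup (range v).
  by split; [exists (v 0%N), 0%N|exists (w 0%N) => _ [m _ <-]].
exists (sup (range v)) => n; rewrite ler_norml.
have h1 : v n <= sup (range v) by apply: (sup_upper_bound hs); exists n.
have h2 : sup (range v) <= w n.
  by apply: ge_sup; [case: hs|move=> _ [m _ <-]].
by move: h1 h2; rewrite /v /w -mulrA => h1 h2; apply/andP; split; lra.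
Qed.

Lemma geometric_limitC (u : nat -> C) (D : R) :
  (forall n, nm (u n.+1 - u n) <= D / 2 ^+ n) ->
  exists p, forall n, nm (u n - p) <= 4 * D / 2 ^+ n.
Proof.
move=> H.
have [|x Hx] := @geometric_limit (fun n => complex.Re (u n)) D.
  by move=> n; rewrite -ReN -ReD; apply: le_trans (Re_le_nm _) _.
have [|y Hy] := @geometric_limit (fun n => complex.Im (u n)) D.
  by move=> n; rewrite -ImN -ImD; apply: le_trans (Im_le_nm _) _.
exists (x +i* y) => n; apply: le_trans (nm_le_ReIm _) _.
rewrite ReD ReN ImD ImN /=.
have := lerD (Hx n) (Hy n); rewrite -!mulrA -mulrDl => /le_trans; apply.
by rewrite ler_wpM2r ?lexx //; [apply: le_trans (H n); exact: nm_ge0 | lra].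
Qed.

Definition tri f t := sint f t.1.1 t.1.2 + sint f t.1.2 t.2 + sint f t.2 t.1.1.
Definition perim t : R := nm (t.1.2 - t.1.1) + nm (t.2 - t.1.2) + nm (t.1.1 - t.2).

Let mid a b : C := (a + b) / 2.

Lemma tri_split f z r a b c : hol_ball f z r ->
  nm (a - z) < r -> nm (b - z) < r -> nm (c - z) < r ->
  tri f (a, b, c) = tri f (a, mid a b, mid c a) + tri f (mid a b, b, mid b c)
     + tri f (mid c a, mid b c, c) + tri f (mid a b, mid b c, mid c a).
Proof.
move=> hf ha hb hc.
have hm x y : nm (x - z) < r -> nm (y - z) < r -> nm (mid x y - z) < r.
  move=> hx hy; have := @nm_seg_lt _ x y z (2^-1) r _ hx hy.
  have -> : x + (2^-1 : R)%:C * (y - x) = mid x y.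
    by rewrite /mid fmorphV rmorph_nat; field.
  by apply; lra.
have cs x y : nm (x - z) < r -> nm (y - z) < r -> ccont_seg f x y.
  exact: hol_ball_seg hf.
have h1 := hm _ _ ha hb; have h2 := hm _ _ hb hc; have h3 := hm _ _ hc ha.
rewrite /tri /= (sint_split (cs a b ha hb)) (sint_split (cs b c hb hc)).
rewrite (sint_split (cs c a hc ha)) -/(mid a b) -/(mid b c) -/(mid c a).
rewrite (sint_rev (cs (mid c a) (mid a b) _ _)) //.
rewrite (sint_rev (cs (mid a b) (mid b c) _ _)) //.
rewrite (sint_rev (cs (mid b c) (mid c a) _ _)) //.
ring.
Qed.

(** The four half-size triangles add up to the whole integral, so one of them carries at least a
    quarter of it. The bound on [a' - a] will make the first vertices converge. *)
Lemma tri_next f z r r1 a b c : hol_ball f z r -> r1 < r ->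
  nm (a - z) <= r1 -> nm (b - z) <= r1 -> nm (c - z) <= r1 ->
  exists a' b' c', [/\ nm (tri f (a, b, c)) <= 4 * nm (tri f (a', b', c')),
    perim (a', b', c') = perim (a, b, c) / 2, nm (a' - a) <= perim (a, b, c) &
    [/\ nm (a' - z) <= r1, nm (b' - z) <= r1 & nm (c' - z) <= r1]].
Proof.
move=> hf r1r ha hb hc.
have hm x y : nm (x - z) <= r1 -> nm (y - z) <= r1 -> nm (mid x y - z) <= r1.
  move=> hx hy; have := @nm_seg_le _ x y z (2^-1) r1 _ hx hy.
  have -> : x + (2^-1 : R)%:C * (y - x) = mid x y.
    by rewrite /mid fmorphV rmorph_nat; field.
  by apply; lra.
have half x y (e : C) : x - y = e / 2 -> nm (x - y) = nm e / 2.
  by move=> ->; rewrite nmM nmV nm_nat.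
have E := tri_split hf (le_lt_trans ha r1r) (le_lt_trans hb r1r)
  (le_lt_trans hc r1r).
have tri4 (x y u v : C) : nm (x + y + u + v) <= nm x + nm y + nm u + nm v.
  by do 3 (apply: le_trans (nmD _ _) _; rewrite lerD2r).
have := tri4 (tri f (a, mid a b, mid c a)) (tri f (mid a b, b, mid b c))
  (tri f (mid c a, mid b c, c)) (tri f (mid a b, mid b c, mid c a)).
rewrite -E => {}E.
have n1 := nm_ge0 (b - a); have n2 := nm_ge0 (c - b); have n3 := nm_ge0 (a - c).
have [h1|h1] := leP (nm (tri f (a, b, c))) (4 * nm (tri f (a, mid a b, mid c a))).
  exists a, (mid a b), (mid c a); split; rewrite ?subrr ?nm0 ?addr_ge0 //; last first.
    by split=> //; exact: hm.
  rewrite /perim /= (half (mid a b) a (b - a)); last by rewrite /mid; field.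
  rewrite (half (mid c a) (mid a b) (c - b)); last by rewrite /mid; field.
  rewrite (half a (mid c a) (a - c)); last by rewrite /mid; field.
  lra.
have [h2|h2] := leP (nm (tri f (a, b, c))) (4 * nm (tri f (mid a b, b, mid b c))).
  exists (mid a b), b, (mid b c); split=> //; last by split=> //; exact: hm.
    rewrite /perim /= (half b (mid a b) (b - a)); last by rewrite /mid; field.
    rewrite (half (mid b c) b (c - b)); last by rewrite /mid; field.
    rewrite (half (mid a b) (mid b c) (a - c)); last by rewrite /mid; field.
    lra.
  rewrite /perim /= (half (mid a b) a (b - a)); last by rewrite /mid; field.
  lra.
have [h3|h3] := leP (nm (tri f (a, b, c))) (4 * nm (tri f (mid c a, mid b c, c))).
  exists (mid c a), (mid b c), c; split=> //; last by split=> //; exact: hm.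
    rewrite /perim /= (half (mid b c) (mid c a) (b - a)); last by rewrite /mid; field.
    rewrite (half c (mid b c) (c - b)); last by rewrite /mid; field.
    rewrite (half (mid c a) c (a - c)); last by rewrite /mid; field.
    lra.
  rewrite /perim /= nmB (half a (mid c a) (a - c)); last by rewrite /mid; field.
  lra.
exists (mid a b), (mid b c), (mid c a); split=> //; last by split; exact: hm.
- by move: E h1 h2 h3; lra.
- rewrite /perim /= (half (mid b c) (mid a b) (c - a)); last by rewrite /mid; field.
  rewrite (half (mid c a) (mid b c) (a - b)); last by rewrite /mid; field.
  rewrite (half (mid a b) (mid c a) (b - c)); last by rewrite /mid; field.
  rewrite (nmB c a) (nmB a b) (nmB b c); lra.
- rewrite /perim /= (half (mid a b) a (b - a)); last by rewrite /mid; field.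
  lra.
Qed.

(** Bisection: the [n]-th triangle has perimeter [q / 2 ^+ n] and carries at least [4 ^- n] of the
    integral. At the limit point [p], [f] is affine up to [e * |w - p|] and the affine part has a
    primitive, so the integral there is [O(e / 4 ^+ n)]. Keeping all triangles in the closed disc of
    radius [r1 < r] puts [p] inside the open one. *)
Lemma goursat f z r a b c : hol_ball f z r ->
  nm (a - z) < r -> nm (b - z) < r -> nm (c - z) < r -> tri f (a, b, c) = 0.
Proof.
move=> hf ha hb hc.
pose r1 := Num.max (nm (a - z)) (Num.max (nm (b - z)) (nm (c - z))).
have r1r : r1 < r by rewrite !gt_max ha hb hc.
pose inb t := [/\ nm (t.1.1 - z) <= r1, nm (t.1.2 - z) <= r1 & nm (t.2 - z) <= r1].
have next t : exists t', inb t -> [/\ nm (tri f t) <= 4 * nm (tri f t'),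
    perim t' = perim t / 2, nm (t'.1.1 - t.1.1) <= perim t & inb t'].
  have [ht|ht] := pselect (inb t); last by exists t.
  case: t ht => [[a0 b0] c0] [/= h1 h2 h3].
  have [a' [b' [c' h]]] := tri_next hf r1r h1 h2 h3.
  by exists (a', b', c').
have [nx Hnx] := choice next.
pose s n := iter n nx (a, b, c).
pose q := perim (a, b, c).
have Hs n : [/\ inb (s n), perim (s n) = q / 2 ^+ n &
                nm (tri f (a, b, c)) <= 4 ^+ n * nm (tri f (s n))].
  elim: n => [|n [h1 h2 h3]].
    rewrite /s /= !expr0 mul1r divr1; split => //.
    by rewrite /inb /= /r1; split; rewrite !le_max lexx ?orbT.
  have [k1 k2 k3 k4] := Hnx (s n) h1; rewrite [s n.+1]iterS -/(s n); split=> //.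
    by rewrite k2 h2 exprSr invfM mulrA.
  apply: le_trans h3 _; rewrite exprSr -mulrA ler_wpM2l // exprn_ge0 //.
have [n|p Hp] := @geometric_limitC (fun n => (s n).1.1) q.
  have [h1 h2 _] := Hs n; have [_ _ k3 _] := Hnx (s n) h1.
  by rewrite [s n.+1]iterS -/(s n) -h2.
have pr : nm (p - z) < r.
  have [n hn] := @half_pow_lt (4 * q) (r - r1) ltac:(by rewrite subr_gt0).
  have [[h1 _ _] _ _] := Hs n; have := Hp n; rewrite nmB => hpn.
  apply: le_lt_trans (nmtri _ (s n).1.1 _) _; lra.
have [l hl] := hf p pr; have q0 : 0 <= q by rewrite /q /perim !addr_ge0 ?nm_ge0.
(* The 5 is 4, from the distance of the first vertex to [p], plus 1 for the perimeter, which bounds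
   the distance to the other two. *)
have key (e : R) : 0 < e -> nm (tri f (a, b, c)) <= 5 * e * q ^+ 2.
  move=> e0; have [d d0 Hd] := (cderP _ _ _).1 hl e e0.
  have [n hn] := @half_pow_lt (5 * q) d d0.
  have [[h1 h2 h3] k1 k2] := Hs n; have k3 := Hp n.
  apply: le_trans k2 _.
  move: h1 h2 h3 k1 k3; case: (s n) => [[a0 b0] c0] /= h1 h2 h3 k1 k3.
  set qn := q / 2 ^+ n in k1.
  have k3' : nm (a0 - p) <= 4 * qn by rewrite /qn mulrA.
  have hn' : 5 * qn < d by rewrite /qn mulrA.
  have [/= na nb nc] : [/\ nm (b0 - a0) >= 0, nm (c0 - b0) >= 0 & nm (a0 - c0) >= 0].
    by split; exact: nm_ge0.
  rewrite /perim /= in k1.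
  have ka : nm (a0 - p) <= 5 * qn by lra.
  have kb : nm (b0 - p) <= 5 * qn by apply: le_trans (nmtri _ a0 _) _; lra.
  have kc : nm (c0 - p) <= 5 * qn.
    by apply: le_trans (nmtri _ a0 _) _; rewrite (nmB c0); lra.
  pose G w := f p * (w - p) + l / 2 * ((w - p) * (w - p)).
  have edge x y : nm (x - z) <= r1 -> nm (y - z) <= r1 -> nm (x - p) <= 5 * qn ->
      nm (y - p) <= 5 * qn ->
      nm (sint f x y - (G y - G x)) <= e * (5 * qn) * nm (y - x).
    move=> x1 y1 x2 y2.
    apply: (@sint_approx _ _ _ (fun w => f p + l * (w - p))).
      by apply: hol_ball_seg hf _ _; apply: le_lt_trans r1r.
    move=> t t01 w; have wp : nm (w - p) <= 5 * qn by apply: nm_seg_le.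
    split.
      have h : cder (fun w => w - p) w 1.
        by apply: cder_eq (cderB (cder_id w) (cder_cst p w)) _; rewrite subr0.
      apply: cder_eq (cderD (cderM (cder_cst (f p) w) h) (cder_sqr_center p l w)) _.
      by ring.
    have := Hd _ (le_lt_trans wp hn'); rewrite [p + _]addrC subrK opprD addrA.
    by move=> /le_trans; apply; rewrite ler_wpM2l // ltW.
  have -> : tri f (a0, b0, c0) = (sint f a0 b0 - (G b0 - G a0)) +
     (sint f b0 c0 - (G c0 - G b0)) + (sint f c0 a0 - (G a0 - G c0)).
    by rewrite /tri /=; ring.
  have /= := lerD (lerD (edge a0 b0 h1 h2 ka kb) (edge b0 c0 h2 h3 kb kc))
    (edge c0 a0 h3 h1 kc ka).
  rewrite -!mulrDr k1 => hT.
  have -> : 5 * e * q ^+ 2 = 4 ^+ n * (e * (5 * qn) * qn).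
    have -> : 4 ^+ n = 2 ^+ n * 2 ^+ n :> R by rewrite -exprMn; congr (_ ^+ _); lra.
    rewrite /qn; field; rewrite expf_neq0 ?pnatr_eq0 //.
  rewrite ler_wpM2l ?exprn_ge0 //; apply: le_trans hT.
  by apply: le_trans (nmD _ _) _; rewrite lerD2r nmD.
apply/eqP; rewrite -nm_eq0 eq_le nm_ge0 andbT; apply/ler_addgt0Pl => e e0.
rewrite addr0; have q20 : 0 < 5 * q ^+ 2 + 1 by rewrite ltr_pwDr // mulr_ge0 ?sqr_ge0.
apply: le_trans (key (e / (5 * q ^+ 2 + 1)) (divr_gt0 e0 q20)) _.
rewrite mulrAC mulrA ler_pdivrMr // mulrC ler_wpM2l ?lerDl //; exact: ltW.
Qed.

Lemma primitive_ball f z r : 0 < r -> hol_ball f z r ->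
  exists F, forall w, nm (w - z) < r -> cder F w (f w).
Proof.
move=> r0 hf; exists (fun w => sint f z w) => w wr.
have zr : nm (z - z) < r by rewrite subrr nm0.
apply/cderP => e e0; have [l hl] := hf w wr.
have [d d0 H] := cder_cont hl e0.
have rw : 0 < r - nm (w - z) by rewrite subr_gt0.
exists (Num.min d (r - nm (w - z))); first by rewrite lt_min d0.
move=> h; rewrite lt_min => /andP[hd hr].
have whr : nm (w + h - z) < r.
  by rewrite addrAC; apply: le_lt_trans (nmD _ _) _; lra.
have := goursat hf zr wr whr; rewrite /tri /= => E.
rewrite (sint_rev (hol_ball_seg hf zr whr)) in E.
have -> : sint f z (w + h) = sint f z w + sint f w (w + h).
  by apply/eqP; rewrite -subr_eq0 -oppr_eq0 opprB -E.
have -> : sint f z w + sint f w (w + h) - sint f z w - f w * h =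
  sint f w (w + h) - (f w * (w + h) - f w * w) by ring.
have -> : nm h = nm (w + h - w) by rewrite [w + h]addrC addrK.
apply: (@sint_approx _ f (fun x => f w * x) (fun=> f w)).
  exact: hol_ball_seg hf wr whr.
move=> t t01 x; split.
  by apply: cder_eq (cderM (cder_cst (f w) x) (cder_id x)) _; rewrite mul0r mulr1 add0r.
apply: H; apply: le_lt_trans hd.
apply: nm_seg_le => //; first by rewrite subrr nm0 nm_ge0.
by rewrite [w + h]addrC addrK.
Qed.

End Goursat.

(** * Cauchy's formula on a square and differentiability of the derivative *)

Section CauchyFormula.
Context {R : realType}.
Local Notation C := (Cplx R).
Implicit Types (F f g : C -> C) (z w a b c h x v : C) (r : R).

Lemma nm_bounded (K : set C) (f : C -> C) (B : R) :
  (forall z, K z -> nm z <= B) ->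
  (forall z, ~ K z -> exists2 d : R, 0 < d & forall w, nm (w - z) < d -> ~ K w) ->
  (forall z, K z -> ccont f z) -> exists M : R, forall z, K z -> nm (f z) <= M.
Proof.
move=> bK oK cf; have [[z0 Kz0]|K0] := pselect (K !=set0); last first.
  by exists 0 => z Kz; case: K0; exists z.
have [||c Kc H] := @EVT_complex _ K (fun z => nm (f z)) B _ bK oK.
- by exists z0.
- move=> z Kz e e0; have [d d0 H] := cf z Kz e e0; exists d => // w _ /H.
  apply: le_trans; rewrite ler_norml nm_sub andbT lerNl opprB.
  by rewrite [nm (_ - f z)]nmB nm_sub.
by exists (nm (f c)).
Qed.

Lemma closed_disc_compl z r w : ~ nm (w - z) <= r ->
  exists2 d : R, 0 < d & forall v, nm (v - w) < d -> ~ nm (v - z) <= r.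
Proof.
move=> /negP; rewrite -ltNge => h; exists (nm (w - z) - r); first by rewrite subr_gt0.
move=> v; rewrite nmB => hv; apply/negP; rewrite -ltNge.
by have := nmtri w v z; lra.
Qed.

Lemma nm_bounded_disc z r f : (forall w, nm (w - z) <= r -> ccont f w) ->
  exists M : R, forall w, nm (w - z) <= r -> nm (f w) <= M.
Proof.
move=> cf; apply: (@nm_bounded [set w | nm (w - z) <= r] f (nm z + r)) => //.
- by move=> w /= wr; have := nm_sub w z; lra.
- by move=> w; exact: closed_disc_compl.
Qed.

Lemma sint_eq f g a b : ccont_seg f a b ->
  (forall t : R, 0 <= t <= 1 -> f (a + t%:C * (b - a)) = g (a + t%:C * (b - a))) ->
  sint f a b = sint g a b.
Proof.
move=> cf H; have [P hP ->] := sintP cf.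
rewrite /sint (@cintE _ _ P) // => t t01; rewrite -H //; exact: hP.
Qed.

Lemma cder_invX x h m : x - h != 0 ->
  cder (fun h => (x - h)^-1 ^+ m) h (m%:R * (x - h)^-1 ^+ m.+1).
Proof.
move=> xh; have h1 : cder (fun h => x - h) h (-1).
  by apply: cder_eq (cderB (cder_cst x h) (cder_id h)) _; rewrite sub0r.
apply: cder_eq (cderX m (@cderV _ (fun h => x - h) h _ xh h1)) _.
case: m => [|m]; first by rewrite !mul0r.
by rewrite mulrN1 opprK -[_ ^- 2]exprVn -mulrA -exprD addn2.
Qed.

Lemma invX_bound x m (eta : R) : 0 < eta -> eta <= nm x ->
  nm (x^-1 ^+ m) <= eta^-1 ^+ m.
Proof.
move=> e0 ex; rewrite nmX nmV; apply: lerXn2r; rewrite ?nnegrE ?invr_ge0 ?nm_ge0 //.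
  exact: ltW.
by rewrite lef_pV2 ?posrE //; apply: lt_le_trans ex.
Qed.

(** The constant is uniform in [x] at distance at least [eta] from 0, which is what differentiation
    under the integral sign requires. The mean value inequality is used twice, first for the power
    [m.+1], then for the remainder itself; [|x - k|] stays above [eta / 2] throughout. *)
Lemma kernel_taylor x h m (eta : R) : 0 < eta -> eta <= nm x -> nm h <= eta / 2 ->
  nm ((x - h)^-1 ^+ m - x^-1 ^+ m - m%:R * x^-1 ^+ m.+1 * h) <=
  m%:R * (m.+1%:R * (eta / 2)^-1 ^+ m.+2) * nm h ^+ 2.
Proof.
move=> e0 ex hh; have e20 : 0 < eta / 2 by rewrite divr_gt0.
have far k : nm k <= nm h -> eta / 2 <= nm (x - k).
  by move=> kh; have := nm_sub x k; have := nm_sub k x; lra.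
have far0 k : nm k <= nm h -> x - k != 0.
  by move=> kh; rewrite -nm_gt0; apply: lt_le_trans (far k kh).
have seg (t : R) k : 0 <= t <= 1 -> nm (0 + t%:C * (k - 0)) <= nm k.
  move=> /andP[t0 t1]; rewrite add0r subr0 nmM nmR ger0_norm //.
  by rewrite ler_piMl ?nm_ge0.
have first k : nm k <= nm h ->
    nm ((x - k)^-1 ^+ m.+1 - x^-1 ^+ m.+1) <= m.+1%:R * (eta / 2)^-1 ^+ m.+2 * nm h.
  move=> kh; apply: le_trans (_ : m.+1%:R * (eta / 2)^-1 ^+ m.+2 * nm k <= _); last first.
    by rewrite ler_wpM2l // mulr_ge0 // exprn_ge0 // invr_ge0 ltW.
  have := @mean_value_segment _ (fun h => (x - h)^-1 ^+ m.+1)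
    (fun h => m.+1%:R * (x - h)^-1 ^+ m.+2) 0 k (m.+1%:R * (eta / 2)^-1 ^+ m.+2).
  rewrite !subr0; apply=> t t01; rewrite -[k in t%:C * k]subr0.
    by apply: cder_invX; apply: far0; apply: le_trans kh; exact: seg.
  rewrite nmM nm_nat ler_wpM2l //; apply: invX_bound => //.
  by apply: far; apply: le_trans kh; exact: seg.
set A := m%:R * (m.+1%:R * (eta / 2)^-1 ^+ m.+2).
have := @mean_value_segment _
  (fun h => (x - h)^-1 ^+ m - m%:R * x^-1 ^+ m.+1 * h)
  (fun h => m%:R * (x - h)^-1 ^+ m.+1 - m%:R * x^-1 ^+ m.+1)
  0 h (A * nm h).
rewrite !subr0 mulr0 subr0 [nm h ^+ 2]expr2 [A * (_ * _)]mulrA.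
have -> : (x - h)^-1 ^+ m - m%:R * x^-1 ^+ m.+1 * h - x^-1 ^+ m =
  (x - h)^-1 ^+ m - x^-1 ^+ m - m%:R * x^-1 ^+ m.+1 * h by rewrite addrAC.
apply=> t t01; rewrite -[h in t%:C * h]subr0; have sh := seg t h t01.
  apply: cder_eq (cderB (cder_invX m (far0 _ sh)) (cderM (cder_cst _ _) (cder_id _))) _.
  by rewrite mul0r mulr1 [0 + _ * x^-1 ^+ _]add0r.
by rewrite -mulrBr nmM nm_nat /A -mulrA ler_wpM2l // first.
Qed.

Lemma ccontM f g z : ccont f z -> ccont g z -> ccont (fun w => f w * g w) z.
Proof.
move=> hf hg e e0; set A := nm (f z) + 1; set B := nm (g z) + 1.
have A0 : 0 < A by rewrite ltr_pwDr // nm_ge0.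
have B0 : 0 < B by rewrite ltr_pwDr // nm_ge0.
have e1 : 0 < Num.min 1 (e / 2 / B) by rewrite lt_min ltr01 !divr_gt0.
have e2 : 0 < e / 2 / A by rewrite !divr_gt0.
have [d1 d10 H1] := hf _ e1; have [d2 d20 H2] := hg _ e2.
exists (Num.min d1 d2); first by rewrite lt_min d10.
move=> w; rewrite lt_min => /andP[/H1 w1 /H2 w2].
move: w1; rewrite le_min => /andP[w1 w1'].
have -> : f w * g w - f z * g z = f w * (g w - g z) + (f w - f z) * g z by ring.
apply: le_trans (nmD _ _) _; rewrite !nmM.
rewrite ler_pdivlMr // in w1'; rewrite ler_pdivlMr // in w2.
have hfw : nm (f w) <= A by have := nm_sub (f w) (f z); rewrite /A; lra.
have := nm_ge0 (f w - f z); have := nm_ge0 (g w - g z); have := nm_ge0 (g z).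
have := nm_ge0 (f w); rewrite /B in w1' *; nra.
Qed.

(** Differentiation under the integral sign: by [kernel_taylor] the remainder [E] of the integrand
    is at most a constant times [nm h ^+ 2], uniformly on the segment. *)
Lemma cder_sint_kernel g v w a m (eta M : R) : 0 < eta ->
  (forall t : R, 0 <= t <= 1 -> let s := v + t%:C * (w - v) in
     [/\ ccont g s, nm (g s) <= M & eta <= nm (s - a)]) ->
  cder (fun a => sint (fun s => g s * (s - a)^-1 ^+ m) v w) a
       (m%:R * sint (fun s => g s * (s - a)^-1 ^+ m.+1) v w).
Proof.
move=> e0 H; have e20 : 0 < eta / 2 by rewrite divr_gt0.
have ck n b : (forall t : R, 0 <= t <= 1 -> v + t%:C * (w - v) - b != 0) ->
    ccont_seg (fun s => g s * (s - b)^-1 ^+ n) v w.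
  move=> hb t t01; have [h1 _ _] := H t t01; apply: ccontM => //.
  apply: (@cder_ccont _ _ _ (n%:R * (v + t%:C * (w - v) - b)^-1 ^+ n.-1 *
    (- (v + t%:C * (w - v) - b) ^- 2 * (1 - 0)))).
  by apply/cderX/cderV; [exact: hb|exact: cderB (cder_id _) (cder_cst _ _)].
have M0 : 0 <= M.
  have [|_ h _] := H 0; first by rewrite lexx ler01.
  by apply: le_trans h; exact: nm_ge0.
set D := m%:R * (m.+1%:R * (eta / 2)^-1 ^+ m.+2).
have D0 : 0 <= D by rewrite /D mulr_ge0 // mulr_ge0 // exprn_ge0 // invr_ge0 ltW.
have MD0 : 0 <= M * D * nm (w - v) by apply: mulr_ge0 (nm_ge0 _); apply: mulr_ge0.
have MD1 : 0 < M * D * nm (w - v) + 1 by rewrite ltr_pwDr.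
apply/cderP => e ee0.
exists (Num.min (eta / 2) (e / (M * D * nm (w - v) + 1))).
  by rewrite lt_min e20 divr_gt0.
move=> h; rewrite lt_min => /andP[h1]; rewrite ltr_pdivlMr // => h2.
have nz b : nm (b - a) < eta -> forall t : R, 0 <= t <= 1 -> v + t%:C * (w - v) - b != 0.
  move=> hb t /H[_ _ hs]; rewrite -nm_gt0.
  by have := nmtri (v + t%:C * (w - v)) b a; lra.
have aa : nm (a - a) < eta by rewrite subrr nm0.
have aha : nm (a + h - a) < eta by rewrite addrAC subrr add0r; lra.
have c1 := ck m _ (nz _ aha); have c2 := ck m _ (nz _ aa); have c3 := ck m.+1 _ (nz _ aa).
pose E s := (g s * (s - (a + h))^-1 ^+ m + (-1) * (g s * (s - a)^-1 ^+ m)) +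
   (- (m%:R * h)) * (g s * (s - a)^-1 ^+ m.+1).
have cE1 : ccont_seg (fun s => g s * (s - (a + h))^-1 ^+ m + (-1) * (g s * (s - a)^-1 ^+ m)) v w.
  by move=> t t01; apply: ccontD; [exact: c1|apply: ccontZ; exact: c2].
have cE2 : ccont_seg (fun s => (- (m%:R * h)) * (g s * (s - a)^-1 ^+ m.+1)) v w.
  by move=> t t01; apply: ccontZ; exact: c3.
have -> : sint (fun s => g s * (s - (a + h))^-1 ^+ m) v w -
  sint (fun s => g s * (s - a)^-1 ^+ m) v w -
  m%:R * sint (fun s => g s * (s - a)^-1 ^+ m.+1) v w * h = sint E v w.
  rewrite /E (sintD cE1 cE2) (sintZ _ c3) sintD //; last first.
    by move=> t t01; apply: ccontZ; exact: c2.
  rewrite (sintZ _ c2).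
  move: (sint (fun s => g s * (s - (a + h))^-1 ^+ m) v w) => S1.
  move: (sint (fun s => g s * (s - a)^-1 ^+ m) v w) => S2.
  by move: (sint (fun s => g s * (s - a)^-1 ^+ m.+1) v w) => S3; ring.
apply: le_trans (_ : (M * (D * nm h ^+ 2)) * nm (w - v) <= _).
  apply: sint_bound; first by move=> t t01; apply: ccontD; [exact: cE1|exact: cE2].
  move=> t t01; have [_ k2 k3] := H t t01; rewrite /E; set s := v + _.
  have -> : g s * (s - (a + h))^-1 ^+ m + -1 * (g s * (s - a)^-1 ^+ m) +
    - (m%:R * h) * (g s * (s - a)^-1 ^+ m.+1) =
    g s * ((s - a - h)^-1 ^+ m - (s - a)^-1 ^+ m - m%:R * (s - a)^-1 ^+ m.+1 * h).
    by rewrite opprD addrA; ring.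
  rewrite nmM ler_pM ?nm_ge0 //.
  by apply: kernel_taylor => //; apply: ltW.
have -> : M * (D * nm h ^+ 2) * nm (w - v) = M * D * nm (w - v) * nm h * nm h.
  by ring.
rewrite ler_wpM2r ?nm_ge0 //; apply: le_trans (ltW h2).
by rewrite mulrC ler_wpM2l ?nm_ge0 // lerDl.
Qed.

(** Only the point [a] is in question: there the second-order expansion of [F] shows that the
    quotient has derivative [l / 2], where [l] is the derivative of [f] at [a]. *)
Lemma removable_quotient F f z r a : hol_ball f z r ->
  (forall w, nm (w - z) < r -> cder F w (f w)) -> nm (a - z) < r ->
  hol_ball (fun w => if w == a then f a else (F w - F a) / (w - a)) z r.
Proof.
move=> hf hF ar; set q := fun w => _; move=> w wr.
have [->|wa] := eqVneq w a.
  have [l hl] := hf a ar; exists (l / 2); apply/cderP => e e0.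
  have ra : 0 < r - nm (a - z) by rewrite subr_gt0.
  have hFa x : nm (x - a) < r - nm (a - z) -> cder F x (f x).
    by move=> xa; apply: hF; apply: le_lt_trans (nmtri _ a _) _; lra.
  have [d d0 H] := peano2 ra hFa hl e0.
  exists d => // h hd; rewrite /q eqxx.
  have [->|h0] := eqVneq h 0.
    by rewrite addr0 eqxx subrr mulr0 subrr nm0 mulr0.
  rewrite -subr_eq0 [a + h - a]addrAC subrr add0r (negbTE h0).
  have -> : (F (a + h) - F a) / h - f a - l / 2 * h =
    h^-1 * (F (a + h) - F a - f a * h - l / 2 * h ^+ 2) by field.
  rewrite nmM nmV mulrC ler_pdivrMr ?nm_gt0 //.
  by rewrite -[leRHS]mulrA -[nm h * nm h]expr2; exact: H.
have d0 : 0 < nm (w - a) by rewrite nm_gt0 subr_eq0.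
have wa0 : w - a != 0 by rewrite subr_eq0.
exists ((f w - 0) * (w - a)^-1 + (F w - F a) * (- (w - a) ^- 2 * (1 - 0))).
apply: (@cder_near _ (fun w => (F w - F a) / (w - a)) _ _ _ _ d0).
  move=> x; rewrite /q; case: eqP => [->|//]; by rewrite nmB ltxx.
apply: cderM; first by apply: cderB; [exact: hF|exact: cder_cst].
by apply: cderV => //; apply: cderB; [exact: cder_id|exact: cder_cst].
Qed.

(** The contour is the square with vertices [z + 'i ^+ k * p], which closes up since
    ['i ^+ 4 = 1]. *)
Definition square_int g z p : C :=
  \sum_(k < 4) sint g (z + 'i ^+ k * p) (z + 'i ^+ k.+1 * p).

Lemma nm_i : nm ('i : C) = 1.
Proof. by rewrite nm_sqrt /= expr0n expr1n /= add0r sqrtr1. Qed.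

Lemma square_edgeE z p (t : R) k :
  z + 'i ^+ k * p + t%:C * (z + 'i ^+ k.+1 * p - (z + 'i ^+ k * p)) =
  z + 'i ^+ k * p * (1 + t%:C * ('i - 1)).
Proof. by rewrite exprS; ring. Qed.

(** The point is [(1 - t) + t 'i], of squared modulus [1 - 2 * t * (1 - t)], hence at least 1/2;
    7/10 is a rational number below the square root of 1/2. *)
Lemma nm_edge (t : R) : 0 <= t <= 1 -> 7 / 10 <= nm (1 + t%:C * ('i - 1) : C) <= 1.
Proof.
move=> /andP[t0 t1]; pose y : C := (1 - t) +i* t.
have <- : y = 1 + t%:C * ('i - 1).
  by apply/eqP; rewrite eq_complex /= !(mulr0, mulr1, mul0r, subr0, addr0, add0r, oppr0, sub0r) mulrN1 !eqxx.
have hy : nm y ^+ 2 = (1 - t) ^+ 2 + t ^+ 2 by rewrite nm_sqr.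
have y0 := nm_ge0 y.
have y1 : nm y * nm y = 1 - 2 * (t * (1 - t)) by rewrite -expr2 hy; ring.
have t2 : 0 <= t * (1 - t) by rewrite mulr_ge0 ?subr_ge0.
have t3 : t * (1 - t) <= 1 / 4 by have := sqr_ge0 (t - 1 / 2); rewrite expr2; lra.
by apply/andP; split; nra.
Qed.

Lemma square_bounds z p (t : R) k : 0 <= t <= 1 ->
  7 / 10 * nm p <=
    nm (z + 'i ^+ k * p + t%:C * (z + 'i ^+ k.+1 * p - (z + 'i ^+ k * p)) - z) <= nm p.
Proof.
move=> /nm_edge H; rewrite square_edgeE [z + _]addrC addrK !nmM nmX nm_i expr1n mul1r.
have := nm_ge0 p; nra.
Qed.

Lemma square_int_primitive g G z p :
  (forall k (t : R), 0 <= t <= 1 ->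
    let s := z + 'i ^+ k * p + t%:C * (z + 'i ^+ k.+1 * p - (z + 'i ^+ k * p)) in
    ccont g s /\ cder G s (g s)) -> square_int g z p = 0.
Proof.
move=> H; rewrite /square_int.
under eq_bigr => k _.
  rewrite (@sint_deriv _ _ G); last 2 first.
  - by move=> t /(H k)[].
  - by move=> t /(H k)[].
  over.
rewrite -(big_mkord predT (fun k => G (z + 'i ^+ k.+1 * p) - G (z + 'i ^+ k * p))).
rewrite telescope_sumr // (_ : 'i ^+ 4 = 1 :> C) ?expr0 ?subrr //.
by rewrite (exprM _ 2 2) sqr_i expr2 mulrNN mulr1.
Qed.

(** Cauchy's formula only divides by this integral, so its exact value is not computed. The four
    edges contribute equally by rotation. With [y = (1 - t) + t 'i] and [v = 1 + 'i], the real part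
    of [v / y] is [1 / |y| ^ 2 > 0], so by the mean value theorem one edge cannot contribute 0. *)
Lemma winding_neq0 z p : p != 0 ->
  square_int (fun s => 1 * (s - z)^-1 ^+ 1) z p != 0.
Proof.
move=> p0; have yn0 t : 0 <= t <= 1 -> 1 + t%:C * ('i - 1) != 0 :> C.
  by move=> /nm_edge H; rewrite -nm_gt0; lra.
have [|Q hQ] := @antider_exists R (fun t => (1 + t%:C * ('i - 1))^-1).
  apply: (@continuous01_seg _ (fun w => w^-1) 1 'i) => t t01.
  by apply: cder_ccont (@cderV _ (fun w => w) _ _ (yn0 t t01) (cder_id _)).
have E k : sint (fun s => 1 * (s - z)^-1 ^+ 1) (z + 'i ^+ k * p) (z + 'i ^+ k.+1 * p)
    = ('i - 1) * (Q 1 - Q 0).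
  set u := 'i ^+ k * p.
  have u0 : u != 0 by rewrite -nm_eq0 nmM nmX nm_i expr1n mul1r nm_eq0.
  rewrite exprS -mulrA -/u /sint (@cintE _ _ (fun t => u^-1 * Q t)); first by field.
  move=> t t01; apply: rder_eq (rderZ u^-1 (hQ t t01)) _.
  by rewrite -invfM mul1r expr1; congr (_^-1); ring.
have -> : square_int (fun s => 1 * (s - z)^-1 ^+ 1) z p =
    \sum_(k < 4) ('i - 1) * (Q 1 - Q 0) by apply: eq_bigr => k _; exact: E.
rewrite sumr_const card_ord -mulr_natl mulf_neq0 ?pnatr_eq0 //.
pose v : C := 1 +i* 1.
have [||c c01] := @MVT_segment R (fun t => complex.Re (v * Q t))
  (fun t => complex.Re (v * (1 + t%:C * ('i - 1))^-1)) 0 1 ler01.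
- move=> t; rewrite in_itv /= => /andP[t1 t2]; 
  have t01 : 0 <= t <= 1 by rewrite !ltW.
  exact: (rder_Re v (hQ t t01)).
- apply: derivable_within_continuous => t; rewrite in_itv /= => t01.
  by have [] := rder_Re v (hQ t t01).
rewrite in_itv /= in c01; rewrite subr0 mulr1 -ReN -ReD -mulrN -mulrDr.
set w := _^-1; set D := Q 1 - Q 0 => EQ.
apply/eqP => /eqP; rewrite mulf_eq0 => /orP[/eqP/(congr1 (@complex.Im R)) /=|/eqP D0].
  by rewrite oppr0 addr0 => /eqP; rewrite oner_eq0.
move: EQ; rewrite D0 mulr0 => EQ.
have wy : w * (1 + c%:C * ('i - 1)) = 1 by rewrite mulVf // yn0.
have := congr1 (@complex.Re R) wy; have := congr1 (@complex.Im R) wy.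
move: w EQ {wy} => [a b]; rewrite /= !(mulr0, mulr1, mul0r, mul1r, subr0, addr0, add0r, oppr0, sub0r).
rewrite mulrN1 => e1 e2 e3.
have e1' : a = b by move: e1; lra.
have b0 : b = 0 by move: e2; rewrite e1'; lra.
by move: e3; rewrite e1' b0 !mul0r; lra.
Qed.

(* Cauchy's formula is first proved for a primitive [F] of [f]: as [F' = f] is
   itself differentiable, the difference quotients of [F] are holomorphic, so
   that Goursat's theorem applies to them without exceptional points. *)
Lemma cder_derive1_hol f z r : 0 < r -> hol_ball f z r ->
  exists l, cder (derive1 f) z l.
Proof.
move=> r0 hf; have [F hF] := primitive_ball r0 hf.
pose rho := r / 2; pose p : C := rho%:C.
have rho0 : 0 < rho by rewrite divr_gt0.
have np : nm p = rho by rewrite nmR gtr0_norm.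
have p0 : p != 0 by rewrite -nm_gt0 np.
pose pt k (t : R) := z + 'i ^+ k * p + t%:C * (z + 'i ^+ k.+1 * p - (z + 'i ^+ k * p)).
have ptin k (t : R) : 0 <= t <= 1 -> nm (pt k t - z) < r.
  by move=> /(square_bounds z p k)/andP[_]; rewrite np /pt /rho; lra.
(* The square is at distance at least [7 / 10 * rho] from [z], and [7 / 10 - 1 / 2 = 1 / 5]. *)
have ptfar k (t : R) a : nm (a - z) < rho / 2 -> 0 <= t <= 1 -> rho / 5 <= nm (pt k t - a).
  move=> ha /(square_bounds z p k)/andP[h _].
  have := nmtri (pt k t) a z; rewrite np -/(pt k t) in h; move: h ha; lra.
have ptn k (t : R) a : nm (a - z) < rho / 2 -> 0 <= t <= 1 -> pt k t - a != 0.
  by move=> h1 h2; rewrite -nm_gt0; apply: lt_le_trans (ptfar k t a h1 h2); lra.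
have zz : nm (z - z) < rho / 2 by rewrite subrr nm0 divr_gt0.
have ck g m a k (t : R) : nm (a - z) < rho / 2 -> 0 <= t <= 1 -> ccont g (pt k t) ->
    ccont (fun s => g s * (s - a)^-1 ^+ m) (pt k t).
  move=> ha t01 hg; apply: ccontM => //.
  apply: (@cder_ccont _ _ _ (m%:R * (pt k t - a)^-1 ^+ m.-1 *
    (- (pt k t - a) ^- 2 * (1 - 0)))).
  by apply/cderX/cderV; [exact: ptn|exact: cderB (cder_id _) (cder_cst _ _)].
pose Phi g m a := square_int (fun s => g s * (s - a)^-1 ^+ m) z p.
have dPhi g M m a : (forall w, nm (w - z) <= rho -> ccont g w /\ nm (g w) <= M) ->
    nm (a - z) < rho / 2 -> cder (Phi g m) a (m%:R * Phi g m.+1 a).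
  move=> hg ha; rewrite /Phi /square_int mulr_sumr.
  apply: (@cder_sum _ _ (fun (k : 'I_4) a => sint (fun s => g s * (s - a)^-1 ^+ m)
    (z + 'i ^+ k * p) (z + 'i ^+ k.+1 * p))) => k.
  have eta0 : 0 < rho / 5 by rewrite divr_gt0.
  apply: (@cder_sint_kernel _ _ _ _ _ _ M eta0) => t t01.
  have [|h1 h2] := hg (pt k t).
    by have /andP[_] := square_bounds z p k t01; rewrite np.
  by split=> //; exact: ptfar.
have rr w : nm (w - z) <= rho -> nm (w - z) < r by rewrite /rho; lra.
have cF w : nm (w - z) <= rho -> ccont F w.
  by move=> /rr/hF; exact: cder_ccont.
have [M hM] := nm_bounded_disc cF.
have dF m a : nm (a - z) < rho / 2 -> cder (Phi F m) a (m%:R * Phi F m.+1 a).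
  by apply: (dPhi F M) => w hw; split; [exact: cF|exact: hM].
have c1 w : ccont (fun=> 1 : C) w by apply: cder_ccont (cder_cst 1 w).
(* The integral of [(s - a) ^- 1] is constant in [a]: its derivative is the integral of
   [(s - a) ^- 2], which has the primitive [- (s - a)^-1] along the closed contour. *)
have dc a : nm (a - z) < rho / 2 -> cder (Phi (fun=> 1) 1) a 0.
  move=> ha; apply: cder_eq (dPhi (fun=> 1) 1 1 a _ ha) _.
    by move=> w _; split; [exact: c1|rewrite nm1].
  rewrite mul1r; apply: (@square_int_primitive _ (fun s => - (s - a)^-1)) => k t t01 s.
  have sa := ptn k t a ha t01.
  split; first exact: (ck (fun=> 1)).
  have := cderN (@cderV _ (fun s => s - a) s _ sa (cderB (cder_id s) (cder_cst a s))).
  by move=> /cder_eq; apply; rewrite mulNr opprK subr0 mulr1 mul1r exprVn.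
pose c0 := Phi (fun=> 1) 1 z.
have cc a : nm (a - z) < rho / 2 -> Phi (fun=> 1) 1 a = c0.
  move=> ha; apply/eqP; rewrite -subr_eq0 -nm_eq0 eq_le nm_ge0 andbT.
  rewrite -[0 in leRHS](mul0r (nm (a - z))).
  apply: (@mean_value_segment _ _ (fun=> 0)) => t t01; last by rewrite nm0.
  by apply: dc; exact: nm_seg_lt.
have c00 : c0 != 0 by exact: winding_neq0.
have formula a : nm (a - z) < rho / 2 -> F a = c0^-1 * Phi F 1 a.
  move=> ha; have ar : nm (a - z) < r by move: ha; rewrite /rho; lra.
  pose q w := if w == a then f a else (F w - F a) / (w - a).
  have hq : hol_ball q z r by exact: removable_quotient.
  have [Q hQ] := primitive_ball r0 hq.
  have cq k t : 0 <= t <= 1 -> ccont q (pt k t).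
    move=> /(ptin k) h; have [l hl] := hq _ h.
    exact: cder_ccont hl.
  have q0 : square_int q z p = 0.
    by apply: (@square_int_primitive _ Q) => k t t01 s; split; [exact: cq|apply/hQ/ptin].
  have E : square_int q z p = Phi F 1 a + (- F a) * Phi (fun=> 1) 1 a.
    rewrite /Phi /square_int mulr_sumr -big_split /=; apply: eq_bigr => k _.
    have k1 : ccont_seg (fun s => F s * (s - a)^-1 ^+ 1) (z + 'i ^+ k * p) (z + 'i ^+ k.+1 * p).
      by move=> t t01; apply: ck => //; apply/cF; have /andP[_] := square_bounds z p k t01; rewrite np.
    have k2 : ccont_seg (fun s => 1 * (s - a)^-1 ^+ 1) (z + 'i ^+ k * p) (z + 'i ^+ k.+1 * p).
      by move=> t t01; apply: (ck (fun=> 1)).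
    rewrite -(sintZ _ k2) -sintD //; last by move=> t t01; apply: ccontZ; exact: k2.
    apply: sint_eq => [t t01|t t01]; first exact: cq.
    have := ptn k t a ha t01; rewrite -/(pt k t) /q subr_eq0 => /negbTE ->.
    by rewrite !expr1 mul1r mulrBl mulNr.
  move: E; rewrite q0 (cc a ha) => /esym/eqP; rewrite mulNr subr_eq0 => /eqP ->.
  by rewrite mulrC mulfK.
have loc a : nm (a - z) < rho / 2 -> 0 < rho / 2 - nm (a - z) /\
    forall w, nm (w - a) < rho / 2 - nm (a - z) -> nm (w - z) < rho / 2.
  move=> ha; split; first by rewrite subr_gt0.
  by move=> w wa; apply: le_lt_trans (nmtri _ a _) _; lra.
(* Cauchy's formula for [F] is differentiated under the integral: once for [f], twice for the
   derivative of [f], and a third time to see that the latter is differentiable. *)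
have f2 a : nm (a - z) < rho / 2 -> f a = c0^-1 * Phi F 2 a.
  move=> ha; have [d0 hd] := loc a ha.
  have ar : nm (a - z) < r by move: ha; rewrite /rho; lra.
  apply: (cder_uniq (hF a ar)).
  apply: (@cder_near _ (fun a => c0^-1 * Phi F 1 a) _ _ _ _ d0).
    by move=> w /hd /formula ->.
  apply: cder_eq (cderM (cder_cst _ _) (dF 1%N a ha)) _.
  by rewrite mul0r add0r mul1r.
have f3 a : nm (a - z) < rho / 2 -> derive1 f a = c0^-1 * (2 * Phi F 3 a).
  move=> ha; have [d0 hd] := loc a ha; apply: cder_derive1.
  apply: (@cder_near _ (fun a => c0^-1 * Phi F 2 a) _ _ _ _ d0).
    by move=> w /hd /f2 ->.
  by apply: cder_eq (cderM (cder_cst _ _) (dF 2%N a ha)) _; rewrite mul0r add0r.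
have [d0 hd] := loc z zz.
exists (0 * (2 * Phi F 3 z) + c0^-1 * (0 * Phi F 3 z + 2 * (3%:R * Phi F 4 z))).
apply: (@cder_near _ (fun a => c0^-1 * (2 * Phi F 3 a)) _ _ _ _ d0).
  by move=> w /hd /f3 ->.
by apply: cderM (cder_cst _ _) (cderM (cder_cst _ _) (dF 3 z zz)).
Qed.

Lemma hol_ball_derive1 f z r : hol_ball f z r -> hol_ball (derive1 f) z r.
Proof.
move=> hf w wr; apply: (@cder_derive1_hol _ _ (r - nm (w - z))).
  by rewrite subr_gt0.
by move=> v vw; apply: hf; apply: le_lt_trans (nmtri _ w _) _; lra.
Qed.

End CauchyFormula.

(** * The maximum principle *)

Section MaximumPrinciple.
Context {R : realType}.
Local Notation C := (Cplx R).
Implicit Types (F f g : C -> C) (z w a b c h x y : C) (r M : R).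

(** Differentiability in a neighbourhood of [z], not just at [z]: this is stable under [derive1] and
    can be asked of the points of a closed disc or annulus without naming a larger open set. *)
Definition hol f z := exists2 r : R, 0 < r & hol_ball f z r.

Lemma hol_near f g z r : 0 < r -> (forall w, nm (w - z) < r -> f w = g w) ->
  hol f z -> hol g z.
Proof.
move=> r0 fg [d d0 H]; exists (Num.min d r); first by rewrite lt_min d0.
move=> w; rewrite lt_min => /andP[wd wr]; have [l hl] := H w wd; exists l.
apply: (@cder_near _ f _ _ _ (r - nm (w - z))); rewrite ?subr_gt0 //.
by move=> v vw; apply: fg; apply: le_lt_trans (nmtri _ w _) _; lra.
Qed.

Lemma hol_open f z : hol f z ->
  exists2 r : R, 0 < r & forall w, nm (w - z) < r -> hol f w.
Proof.
move=> [d d0 H]; exists d => // w wd; exists (d - nm (w - z)).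
  by rewrite subr_gt0.
by move=> v vw; apply: H; apply: le_lt_trans (nmtri _ w _) _; lra.
Qed.

Lemma hol_cder f z : hol f z -> cder f z (derive1 f z).
Proof.
move=> [r r0 H]; have [|l hl] := H z; first by rewrite subrr nm0.
by rewrite (cder_derive1 hl).
Qed.

Lemma hol_ccont f z : hol f z -> ccont f z.
Proof. by move=> /hol_cder; exact: cder_ccont. Qed.

Lemma hol_derive1 f z : hol f z -> hol (derive1 f) z.
Proof. by move=> [r r0 H]; exists r => //; exact: hol_ball_derive1. Qed.

Lemma hol_derive1n f z n : hol f z -> hol (derive1n n f) z.
Proof. by move=> h; elim: n => [//|n IH]; rewrite derive1nS; exact: hol_derive1. Qed.

Lemma hol_cst a z : hol (fun=> a) z.
Proof. by exists 1 => // w _; exists 0; exact: cder_cst. Qed.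

Lemma hol_id z : hol (fun w => w) z.
Proof. by exists 1 => // w _; exists 1; exact: cder_id. Qed.

Let hol2 (op : (C -> C) -> (C -> C) -> C -> C) f g z :
  (forall w l m, cder f w l -> cder g w m -> exists k, cder (op f g) w k) ->
  hol f z -> hol g z -> hol (op f g) z.
Proof.
move=> hop [r r0 hf] [s s0 hg]; exists (Num.min r s); first by rewrite lt_min r0.
move=> w; rewrite lt_min => /andP[wr ws].
by have [l hl] := hf w wr; have [m hm] := hg w ws; exact: hop hl hm.
Qed.

Lemma holB f g z : hol f z -> hol g z -> hol (fun w => f w - g w) z.
Proof.
apply: (@hol2 (fun f g w => f w - g w)) => w l m hl hm.
by exists (l - m); exact: cderB.
Qed.

Lemma holM f g z : hol f z -> hol g z -> hol (fun w => f w * g w) z.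
Proof.
apply: (@hol2 (fun f g w => f w * g w)) => w l m hl hm.
by exists (l * g w + f w * m); exact: cderM.
Qed.

Lemma holX f z n : hol f z -> hol (fun w => f w ^+ n) z.
Proof.
move=> [r r0 hf]; exists r => // w wr; have [l hl] := hf w wr.
by exists (n%:R * f w ^+ n.-1 * l); exact: cderX.
Qed.

Lemma holV f z : hol f z -> f z != 0 -> hol (fun w => (f w)^-1) z.
Proof.
move=> hf fz0; have n0 : 0 < nm (f z) / 2 by rewrite divr_gt0 // nm_gt0.
have [d d0 H] := hol_ccont hf n0; have [r r0 hr] := hf.
exists (Num.min r d); first by rewrite lt_min r0.
move=> w; rewrite lt_min => /andP[wr /H wd]; have [l hl] := hr w wr.
exists (- (f w) ^- 2 * l); apply: cderV => //; rewrite -nm_gt0.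
by have := nm_sub (f z) (f w); rewrite nmB; lra.
Qed.

Lemma hol_peano g z : hol g z -> exists l1 l2 : C, forall e : R, 0 < e ->
  exists2 d : R, 0 < d & forall h, nm h < d ->
    nm (g (z + h) - g z - l1 * h - l2 * h ^+ 2) <= e * nm h ^+ 2.
Proof.
move=> hg; exists (derive1 g z), (derive1 (derive1 g) z / 2).
have [r r0 hr] := hol_open hg.
apply: (@peano2 _ _ (derive1 g) _ _ r r0).
  by move=> w /hr; exact: hol_cder.
exact/hol_cder/hol_derive1.
Qed.

(** The terms on the left are the values of [x + y h + w h ^ 2] at [h = 1, 'i, -1, - 'i]: the cross
    terms cancel, as in Parseval's identity. *)
Lemma nm_four_points x y w :
  nm (x + y + w) ^+ 2 + nm (x + 'i * y - w) ^+ 2 + nm (x - y + w) ^+ 2 +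
  nm (x - 'i * y - w) ^+ 2 = 4 * (nm x ^+ 2 + nm y ^+ 2 + nm w ^+ 2).
Proof.
rewrite !nm_sqr !(ReD, ImD, ReN, ImN, ReM, ImM) /=; ring.
Qed.

(* The mean of [|g| ^+ 2 + eps |z| ^+ 2] over the four points [c + t 'i ^ k]
   exceeds its value at [c] by at least [eps t ^+ 2 / 2]. *)
Lemma no_interior_max g c (eps : R) : hol g c -> 0 < eps ->
  forall d : R, 0 < d -> exists2 w, nm (w - c) < d &
    nm (g c) ^+ 2 + eps * nm c ^+ 2 < nm (g w) ^+ 2 + eps * nm w ^+ 2.
Proof.
move=> hg e0 d d0; apply: contrapT => Hno.
have {Hno}U w : nm (w - c) < d ->
    nm (g w) ^+ 2 + eps * nm w ^+ 2 <= nm (g c) ^+ 2 + eps * nm c ^+ 2.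
  by move=> wd; rewrite leNgt; apply/negP => H; apply: Hno; exists w.
have [l1 [l2 H]] := hol_peano hg.
pose Pm := nm (g c) + nm l1 + nm l2.
have Pm0 : 0 <= Pm by rewrite /Pm !addr_ge0 ?nm_ge0.
(* This accuracy keeps the total expansion error at the four points, [8 * Pm * eta * t ^+ 2], below
   [2 * eps * t ^+ 2], half of what the term [eps * |z| ^ 2] gains there. *)
have [|d1 d10 {}H] := H (eps / (4 * (Pm + 1))); first by rewrite divr_gt0 // mulr_gt0 // ltr_pwDr.
set eta := eps / _ in H.
have eta0 : 0 < eta by rewrite divr_gt0 // mulr_gt0 // ltr_pwDr.
have etaE : eta * (4 * (Pm + 1)) = eps by rewrite divfK // mulf_neq0 // gt_eqF // ltr_pwDr.
pose t : R := Num.min (1 / 2) (Num.min (d / 2) (d1 / 2)).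
have t0 : 0 < t by rewrite !lt_min !divr_gt0.
have t1 : t <= 1 by rewrite /t ge_min; apply/orP; left; lra.
have td : t < d by rewrite /t !gt_min; apply/orP; right; apply/orP; left; lra.
have td1 : t < d1 by rewrite /t !gt_min; apply/orP; right; apply/orP; right; lra.
have key h : nm h = t ->
    nm (g c + l1 * h + l2 * h ^+ 2) ^+ 2 - 2 * Pm * eta * t ^+ 2 <= nm (g (c + h)) ^+ 2.
  move=> ht; have := H h; rewrite ht => /(_ td1).
  set P := g c + _ + _.
  have -> : g (c + h) - g c - l1 * h - l2 * h ^+ 2 = g (c + h) - P by rewrite /P; ring.
  set E := eta * t ^+ 2; move=> hE.
  have hP : nm P <= Pm.
    apply: le_trans (nmD _ _) _; rewrite /Pm; apply: lerD.
      by apply: le_trans (nmD _ _) _; rewrite lerD2l nmM ler_piMr ?nm_ge0 // ht.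
    by rewrite nmM ler_piMr ?nm_ge0 // nmX ht expr_le1 // ltW.
  have h1 : nm P - nm (g (c + h)) <= E.
    by apply: le_trans hE; rewrite nmB nm_sub.
  have -> : 2 * Pm * eta * t ^+ 2 = 2 * Pm * E by rewrite /E; ring.
  have E0 : 0 <= E by rewrite /E mulr_ge0 ?sqr_ge0 // ltW.
  have p0 := nm_ge0 P; have q0 := nm_ge0 (g (c + h)).
  rewrite !expr2; have [hh|hh] := leP (nm P) (nm (g (c + h))); nra.
pose T : C := t%:C.
have nT : nm T = t by rewrite nmR gtr0_norm.
have niT : nm ('i * T) = t by rewrite nmM nm_i mul1r.
have K1 := key T nT; have K2 := key ('i * T) niT.
have K3 := key (- T) (etrans (nmN _) nT).
have K4 := key (- ('i * T)) (etrans (nmN _) niT).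
have tE := nm_four_points (g c) (l1 * T) (l2 * T ^+ 2).
have cE := nm_four_points c T 0.
have U1 := U (c + T); have U2 := U (c + 'i * T).
have U3 := U (c - T); have U4 := U (c - 'i * T).
rewrite [c + _]addrC addrK nT in U1; rewrite [c + _]addrC addrK niT in U2.
rewrite [c + _]addrC addrK nmN nT in U3; rewrite [c + _]addrC addrK nmN niT in U4.
have i2 : ('i : C) ^+ 2 = -1 by exact: sqr_i.
have s2 : g c + l1 * ('i * T) + l2 * ('i * T) ^+ 2 = g c + 'i * (l1 * T) - l2 * T ^+ 2.
  by rewrite exprMn i2; ring.
have s3 : g c + l1 * (- T) + l2 * (- T) ^+ 2 = g c - l1 * T + l2 * T ^+ 2.
  by rewrite sqrrN; ring.
have s4 : g c + l1 * (- ('i * T)) + l2 * (- ('i * T)) ^+ 2 = g c - 'i * (l1 * T) - l2 * T ^+ 2.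
  by rewrite sqrrN exprMn i2; ring.
rewrite s2 in K2; rewrite s3 in K3; rewrite s4 in K4.
rewrite !(addr0, subr0) nm0 expr0n addr0 nT in cE.
have {}U1 := U1 td; have {}U2 := U2 td; have {}U3 := U3 td; have {}U4 := U4 td.
rewrite [T + c]addrC in U1; rewrite ['i * T + c]addrC in U2.
rewrite [- T + c]addrC in U3; rewrite [- ('i * T) + c]addrC in U4.
have y0 := sqr_ge0 (nm (l1 * T)); have w0 := sqr_ge0 (nm (l2 * T ^+ 2)).
have t20 : 0 < t ^+ 2 by rewrite exprn_gt0.
have small : 8 * Pm * eta * t ^+ 2 <= 2 * (eps * t ^+ 2).
  rewrite mulrA ler_wpM2r // ?(ltW t20) //.
  have -> : 8 * Pm * eta = 2 * (eta * (4 * Pm)) by ring.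
  by rewrite -etaE ler_wpM2l // ler_wpM2l ?(ltW eta0) // ler_wpM2l // lerDl.
have et : 0 < eps * t ^+ 2 by rewrite mulr_gt0.
have cE' : eps * nm (c + T) ^+ 2 + eps * nm (c + 'i * T) ^+ 2 +
   eps * nm (c - T) ^+ 2 + eps * nm (c - 'i * T) ^+ 2 = 4 * (eps * nm c ^+ 2) + 4 * (eps * t ^+ 2).
  by rewrite -!mulrDr cE; ring.
move: K1 K2 K3 K4 U1 U2 U3 U4 tE cE' y0 w0 small et; lra.
Qed.

(** [|g| ^ 2 + eps * |z| ^ 2] attains its maximum on the compact set [K], and by [no_interior_max]
    not where [g] is holomorphic in the interior, hence at a point where [|g| <= M]; then [eps]
    tends to 0. No connectedness is involved. *)
Lemma maximum_principle (K : set C) g (B M : R) :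
  (forall z, K z -> nm z <= B) ->
  (forall z, ~ K z -> exists2 d : R, 0 < d & forall w, nm (w - z) < d -> ~ K w) ->
  (forall z, K z -> ccont g z) ->
  (forall z, K z -> nm (g z) <= M \/
     (hol g z /\ exists2 d : R, 0 < d & forall w, nm (w - z) < d -> K w)) ->
  forall z, K z -> nm (g z) <= M.
Proof.
move=> bK oK cg bd z Kz.
have B0 : 0 <= B by apply: le_trans (bK z Kz); exact: nm_ge0.
have main (eps : R) : 0 < eps -> 0 <= M /\ nm (g z) ^+ 2 <= M ^+ 2 + eps * B ^+ 2.
  move=> e0; pose u w := nm (g w) ^+ 2 + eps * nm w ^+ 2.
  have cu w : ccont (fun w => (nm (g w) ^+ 2 + eps * nm w ^+ 2)%:C) w -> forall e : R, 0 < e ->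
      exists2 d : R, 0 < d & forall v, K v -> nm (v - w) < d -> `|u v - u w| <= e.
    move=> H e /H[d d0 {}H]; exists d => // v _ /H.
    by rewrite -rmorphB nmR.
  have cn f w : ccont f w -> ccont (fun w => (nm (f w))%:C) w.
    move=> H e /H[d d0 {}H]; exists d => // v /H; apply: le_trans.
    rewrite -rmorphB nmR ler_norml nm_sub andbT lerNl opprB.
    by rewrite [nm (_ - f w)]nmB nm_sub.
  have cu' w : K w -> ccont (fun w => (nm (g w) ^+ 2 + eps * nm w ^+ 2)%:C) w.
    move=> Kw; have c1 := cn g w (cg w Kw).
    have c2 := cn id w (cder_ccont (cder_id w)).
    have := ccontD (ccontM c1 c1) (ccontZ eps%:C (ccontM c2 c2)).
    by under eq_fun do rewrite -!rmorphM -rmorphD -!expr2.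
  have [|c Kc Hc] := EVT_complex _ bK oK (fun w Kw => cu w (cu' w Kw)).
    by exists z.
  have [cM|[hc [d d0 dK]]] := bd c Kc; last first.
    have [w wd] := no_interior_max hc e0 d0.
    by rewrite ltNge => /negP[]; exact: Hc (dK w wd).
  have M0 : 0 <= M by apply: le_trans cM; exact: nm_ge0.
  split=> //; have := Hc z Kz; rewrite /u => uz.
  apply: le_trans (_ : nm (g z) ^+ 2 + eps * nm z ^+ 2 <= _).
    by rewrite lerDl mulr_ge0 ?sqr_ge0 // ltW.
  apply: le_trans uz _; apply: lerD.
    by apply: lerXn2r; rewrite ?nnegrE ?nm_ge0.
  by rewrite ler_wpM2l ?(ltW e0) //; apply: lerXn2r; rewrite ?nnegrE ?nm_ge0 // bK.
have [M0 _] := main 1 ltr01.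
rewrite -(ler_pXn2r (n := 2)) ?nnegrE ?nm_ge0 //.
apply/ler_addgt0Pl => e e0; rewrite addrC.
have B1 : 0 < B ^+ 2 + 1 by rewrite ltr_pwDr // sqr_ge0.
have [_ H] := main (e / (B ^+ 2 + 1)) (divr_gt0 e0 B1).
apply: le_trans H _; rewrite lerD2l mulrAC ler_pdivrMr // ler_wpM2l ?lerDl //.
exact: ltW.
Qed.

Lemma maximum_disc g c r M : (forall w, nm (w - c) <= r -> hol g w) ->
  (forall w, nm (w - c) = r -> nm (g w) <= M) ->
  forall w, nm (w - c) <= r -> nm (g w) <= M.
Proof.
move=> hg bg; apply: (@maximum_principle [set w | nm (w - c) <= r] _ (nm c + r)).
- by move=> w /= wr; have := nm_sub w c; lra.
- by move=> w; exact: closed_disc_compl.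
- by move=> w /hg; exact: hol_ccont.
- move=> w /= wr; have [e|ne] := eqVneq (nm (w - c)) r; first by left; exact: bg.
  have lt : nm (w - c) < r by rewrite lt_neqAle ne.
  right; split; first exact: hg.
  exists (r - nm (w - c)); first by rewrite subr_gt0.
  by move=> v vw; apply: le_trans (nmtri _ w _) _; lra.
Qed.

Definition dquot F a w := if w == a then derive1 F a else (F w - F a) / (w - a).

Lemma hol_dquot F a w : hol F a -> hol F w -> hol (dquot F a) w.
Proof.
have [->|wa] := eqVneq w a => hFa hFw.
  have [r r0 hr] := hol_open hFa; exists r => //.
  apply: (@removable_quotient _ F (derive1 F)) => [|v /hr|].
  - apply: hol_ball_derive1 => v /hr/hol_cder h; by exists (derive1 F v).
  - exact: hol_cder.
  - by rewrite subrr nm0.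
have d0 : 0 < nm (w - a) by rewrite nm_gt0 subr_eq0.
apply: (@hol_near (fun w => (F w - F a) / (w - a)) _ _ _ d0).
  by move=> v; rewrite /dquot; case: eqP => // ->; rewrite nmB ltxx.
apply: holM; first exact: holB (hol_cst _ _).
by apply: holV; [exact: holB (hol_id _) (hol_cst _ _)|rewrite subr_eq0].
Qed.

(** Maximum principle for [dquot g c]: it is at most [M / r] on the boundary circle, and its value
    at [c] is the derivative. *)
Lemma schwarz g c r M : 0 < r -> (forall w, nm (w - c) <= r -> hol g w) ->
  (forall w, nm (w - c) <= r -> nm (g w - g c) <= M) ->
  nm (derive1 g c) <= M / r /\
  forall w, nm (w - c) <= r -> nm (g w - g c) <= M / r * nm (w - c).
Proof.
move=> r0 hg bg; have cr : nm (c - c) <= r by rewrite subrr nm0 ltW.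
have H : forall w, nm (w - c) <= r -> nm (dquot g c w) <= M / r.
  apply: maximum_disc => w wr; first by apply: hol_dquot; exact: hg.
  have wc : w != c by apply: contraTneq isT => E; move: wr r0; rewrite E subrr nm0 => <-; rewrite ltxx.
  by rewrite /dquot (negbTE wc) nmM nmV wr ler_wpM2r ?invr_ge0 ?(ltW r0) // bg // wr.
split; first by have := H c cr; rewrite /dquot eqxx.
move=> w wr; have := H w wr; rewrite /dquot; case: eqP => [-> _|/eqP wc].
  by rewrite !subrr nm0 mulr0.
by rewrite nmM nmV ler_pdivrMr // nm_gt0 subr_eq0.
Qed.

Lemma cauchy_estimate1 g c r M : 0 < r -> (forall w, nm (w - c) <= r -> hol g w) ->
  (forall w, nm (w - c) <= r -> nm (g w) <= M) ->
  nm (derive1 g c) <= 2 * M / r.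
Proof.
move=> r0 hg bg; apply: (proj1 (schwarz r0 hg _)) => w wr.
have cr : nm (c - c) <= r by rewrite subrr nm0 ltW.
by apply: le_trans (nmBle _ _) _; have := bg w wr; have := bg c cr; lra.
Qed.

(** The first-order estimate is iterated, each derivative giving up [r / J] of the radius and so
    costing a factor [2 * J / r]. *)
Lemma cauchy_estimate g c r M (J j : nat) : 0 < r -> (0 < J)%N -> (j <= J)%N ->
  (forall w, nm (w - c) <= r -> hol g w) ->
  (forall w, nm (w - c) <= r -> nm (g w) <= M) ->
  nm (derive1n j g c) <= (2 * J%:R / r) ^+ j * M.
Proof.
move=> r0 J0 jJ hg bg; have JR : 0 < J%:R :> R by rewrite ltr0n.
have step : forall i, (i <= J)%N -> forall w, nm (w - c) <= r * (1 - i%:R / J%:R) ->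
    nm (derive1n i g w) <= (2 * J%:R / r) ^+ i * M.
  elim=> [_ w|i IH iJ w].
    by rewrite mul0r subr0 mulr1 expr0 mul1r; exact: bg.
  have rJ0 : 0 < r / J%:R by rewrite divr_gt0.
  have E : r * (1 - i.+1%:R / J%:R) = r * (1 - i%:R / J%:R) - r / J%:R.
    by rewrite -natr1; field; rewrite gt_eqF.
  rewrite E => wr; rewrite derive1nS exprSr.
  have -> : (2 * J%:R / r) ^+ i * (2 * J%:R / r) * M =
    2 * ((2 * J%:R / r) ^+ i * M) / (r / J%:R).
    by field; rewrite !gt_eqF.
  have iJ' : 0 <= i%:R / J%:R :> R by rewrite divr_ge0.
  apply: (cauchy_estimate1 rJ0) => v vw.
    apply: hol_derive1n; apply: hg; apply: le_trans (nmtri _ w _) _.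
    have : 0 <= r * (i%:R / J%:R) by rewrite mulr_ge0 // ltW.
    by move: wr vw; rewrite mulrBr mulr1; lra.
  apply: IH; first exact: ltnW.
  by apply: le_trans (nmtri _ w _) _; lra.
apply: step => //; rewrite subrr nm0 mulr_ge0 ?(ltW r0) // subr_ge0.
by rewrite ler_pdivrMr // mul1r ler_nat.
Qed.

End MaximumPrinciple.

(** * Local growth of holomorphic functions *)

Section LocalComparison.
Context {R : realType}.
Local Notation C := (Cplx R).
Implicit Types (f g h u : C -> C) (z w a c : C) (r d T : R) (s : seq C).

(** [u] is the primitive of [h' / h] vanishing at [c]. Only [|h|] is wanted, so the real exponential
    suffices: [phi], which is [|h| ^ 2 * exp (- 2 Re u)] along the segment from [c] to [w], has
    derivative 0. *)
Lemma nonvanishing_log h c r : 0 < r -> (forall w, nm (w - c) < r -> hol h w) ->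
  (forall w, nm (w - c) < r -> h w != 0) ->
  exists u, [/\ u c = 0, forall w, nm (w - c) < r -> hol u w &
    forall w, nm (w - c) < r -> nm (h w) = nm (h c) * expR (complex.Re (u w))].
Proof.
move=> r0 hh h0; pose q w := derive1 h w * (h w)^-1.
have hq w : nm (w - c) < r -> hol q w.
  move=> wr; apply: holM; first exact/hol_derive1/hh.
  by apply: holV; [exact: hh|exact: h0].
have [U hU] : exists U, forall w, nm (w - c) < r -> cder U w (q w).
  by apply: primitive_ball => // w /hq/hol_cder k; exists (derive1 q w).
pose u w := U w - U c.
have du w : nm (w - c) < r -> cder u w (q w).
  by move=> wr; apply: cder_eq (cderB (hU w wr) (cder_cst _ w)) (subr0 _).
exists u; split; first by rewrite /u subrr.
  move=> w wr; exists (r - nm (w - c)); first by rewrite subr_gt0.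
  move=> v vw; exists (q v); apply: du.
  by apply: le_lt_trans (nmtri _ w _) _; lra.
move=> w wr; pose gam (t : R) := c + t%:C * (w - c).
have gr (t : R) : 0 <= t <= 1 -> nm (gam t - c) < r.
  by move=> t01; apply: nm_seg_lt => //; rewrite subrr nm0.
pose phi t := nm (h (gam t)) ^+ 2 * expR (- 2 * complex.Re (1 * u (gam t))).
have dphi (t : R) : 0 <= t <= 1 -> is_derive t (1 : R) phi 0.
  move=> t01; have gt := gr t t01.
  have k1 := rder_line (hol_cder (hh _ gt)); have k2 := rder_line (du _ gt).
  have n1 := is_derive_nm_sqr k1; have a3 := rder_Re 1 k2.
  have e1 : is_derive t (1 : R) (fun t => - 2 * complex.Re (1 * u (gam t)))
      (- 2 * complex.Re (1 * (q (gam t) * (w - c)))).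
    by have := is_deriveZ (-2) a3.
  have e2 := is_derive1_comp (is_derive_expR _) e1.
  apply: is_derive_eq (is_deriveM n1 e2) _.
  rewrite /GRing.scale /= -/(gam t); set E := expR _.
  have y0 := h0 _ gt; set lv := derive1 h (gam t) * (w - c); set y := h (gam t).
  have -> : q (gam t) * (w - c) = lv * y^-1 by rewrite /q /lv mulrAC.
  have lvE : lv = lv * y^-1 * y by rewrite divfK.
  rewrite [in X in _ + X]lvE nm_sqr.
  move: (lv * y^-1) => [k1' k2']; move: y {y0 lvE} => [y1 y2].
  by rewrite /= !(mul1r, mul0r, subr0); clear; ring.
have [||x _] := @MVT_segment R phi (fun=> 0) 0 1 ler01.
- by move=> t; rewrite in_itv /= => /andP[t0 t1]; apply: dphi; rewrite !ltW.
- apply: derivable_within_continuous => t; rewrite in_itv /= => t01.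
  by have [] := dphi t t01.
rewrite mul0r => /eqP; rewrite subr_eq0 /phi /gam rmorph0 rmorph1 mul0r addr0.
rewrite !mul1r [c + _]addrC subrK {2}/u subrr /= mulr0 expR0 mulr1.
have -> : - 2 * complex.Re (u w) = - complex.Re (u w) *+ 2 by rewrite mulNr mulr_natl mulNrn.
rewrite mulr2n expRD -expr2 -exprMn eqrXn2 ?mulr_ge0 ?nm_ge0 ?expR_ge0 // => /eqP <-.
by rewrite -mulrA -expRD addNr expR0 mulr1.
Qed.

(** As [Re u <= T], the function [phi = u / (2 T - u)] is bounded by 1 and vanishes at [c]. By
    Schwarz it is at most 1/2 on the half disc, so that [2 |u| <= |2 T - u| <= 2 T + |u|]. *)
Lemma borel_caratheodory u c r r' T : 0 < r' -> r' < r -> 0 < T -> u c = 0 ->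
  (forall w, nm (w - c) < r -> hol u w) ->
  (forall w, nm (w - c) < r -> complex.Re (u w) <= T) ->
  forall w, nm (w - c) <= r' / 2 -> nm (u w) <= 2 * T.
Proof.
move=> r0 rr T0 uc hu uT; pose v w := (2 * T)%:C - u w.
have vn w : nm (w - c) < r -> v w != 0.
  move=> /uT h; apply/eqP => /(congr1 (@complex.Re R)).
  by rewrite ReD ReN /=; lra.
have uv w : nm (w - c) < r -> nm (u w) <= nm (v w).
  move=> /uT h; rewrite -(ler_pXn2r (n := 2)) ?nnegrE ?nm_ge0 // !nm_sqr /v.
  by case: (u w) h => a b /= h; nra.
pose phi w := u w * (v w)^-1.
have lt w : nm (w - c) <= r' -> nm (w - c) < r by move=> h; apply: le_lt_trans rr.
have hphi w : nm (w - c) <= r' -> hol phi w.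
  move=> /lt wr; apply: holM; first exact: hu.
  by apply: holV; [apply: holB (hol_cst _ _) (hu _ wr)|exact: vn].
have [|_ H] := @schwarz _ phi c r' 1 r0 hphi.
  move=> w /lt wr; rewrite /phi uc mul0r subr0 nmM nmV.
  by rewrite ler_pdivrMr ?mul1r ?uv // nm_gt0 vn.
move=> w wr; have wr' : nm (w - c) <= r' by lra.
have := H w wr'; rewrite /phi uc mul0r subr0 nmM nmV.
have vp : 0 < nm (v w) by rewrite nm_gt0 vn // lt.
have hw : 1 / r' * nm (w - c) <= 1 / 2.
  by rewrite mulrAC ler_pdivrMr // mul1r; lra.
move=> /le_trans /(_ hw); rewrite ler_pdivrMr //.
have : nm (v w) <= 2 * T + nm (u w).
  by apply: le_trans (nmBle _ _) _; rewrite nmR ger0_norm ?lerD2r //; lra.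
lra.
Qed.

(** Pigeonhole: the [size s + 1] candidates are at mutual distance at least [2 * e], so an element
    of [s] is within [e] of at most one of them. *)
Lemma free_radius (s : seq R) (lo e : R) : 0 < e ->
  exists2 m : nat, (m <= size s)%N &
    forall x, x \in s -> e <= `|lo + (2 * m%:R + 1) * e - x|.
Proof.
move=> e0; apply: contrapT => Hno.
have bad (m : 'I_(size s).+1) : exists i : 'I_(size s),
    `|lo + (2 * m%:R + 1) * e - s`_i| < e.
  apply: contrapT => H; apply: Hno; exists m; first by rewrite -ltnS.
  move=> x xs; rewrite leNgt; apply/negP => hx; apply: H.
  have xi : (index x s < size s)%N by rewrite index_mem.
  by exists (Ordinal xi); rewrite /= nth_index.
have [F HF] := choice bad.
have close (p q : nat) : `|p%:R - q%:R : R| < 1 -> p = q.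
  rewrite ltr_norml => /andP[h1 h2]; apply/eqP.
  rewrite eqn_leq -(ltnS p) -(ltnS q) -!(ltr_nat R) -[p.+1%:R]natr1 -[q.+1%:R]natr1.
  by apply/andP; split; lra.
have Finj : injective F.
  move=> m m' E; apply: val_inj => /=.
  have h1 := HF m; have h2 := HF m'; rewrite -E in h2.
  apply: close; rewrite -(ltr_pM2r (mulr_gt0 (@ltr0Sn R 1) e0)).
  rewrite -[X in _ * X]gtr0_norm ?mulr_gt0 // -normrM mul1r.
  move: h1 h2; rewrite !ltr_norml => /andP[? ?] /andP[? ?].
  by apply/andP; split; lra.
by have := leq_card F Finj; rewrite !card_ord ltnn.
Qed.

Definition root_prod s w := \prod_(a <- s) (w - a).

Lemma expR_half_le3 : expR (1 / 2) <= 3 :> R.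
Proof.
have h : 1 / 2 <= expR (- (1 / 2)) :> R by have := expR_ge1Dx (- (1 / 2) : R); lra.
have p := expR_gt0 (1 / 2 : R); have : expR (1 / 2) * expR (- (1 / 2)) = 1 :> R.
  by rewrite -expRD subrr expR0.
nra.
Qed.

Lemma nm_root_prod_ge s w (x : R) : 0 <= x -> (forall a, a \in s -> x <= nm (w - a)) ->
  x ^+ size s <= nm (root_prod s w).
Proof.
move=> x0; rewrite /root_prod nm_prod; elim: s => [|a s IH] H; first by rewrite big_nil.
rewrite big_cons exprS ler_pM ?exprn_ge0 ?H ?mem_head // IH // => b bs.
by rewrite H // inE bs orbT.
Qed.

Lemma nm_root_prod_le s w (x : R) : (forall a, a \in s -> nm (w - a) <= x) ->
  nm (root_prod s w) <= x ^+ size s.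
Proof.
rewrite /root_prod nm_prod; elim: s => [|a s IH] H; first by rewrite big_nil.
rewrite big_cons exprS ler_pM ?prodr_ge0 ?nm_ge0 ?H ?mem_head //.
  by move=> b _; exact: nm_ge0.
by rewrite IH // => b bs; rewrite H // inE bs orbT.
Qed.

Section Factor.
Variables (g : C -> C) (c : C) (d T : R).
Hypotheses (d0 : 0 < d) (gc0 : g c != 0)
  (hg : forall w, nm (w - c) <= d -> hol g w)
  (bg : forall w, nm (w - c) <= d -> nm (g w) <= expR T * nm (g c)).

(** A partial factorisation: [s] lists, with multiplicity, some zeros of [g] in the disc of radius
    [d / 4], and [h] may retain others. The roots are kept well inside the disc of radius [d] where
    [g] is bounded. *)
Definition factored s h := [/\ forall w, nm (w - c) <= d -> hol h w,
  forall w, nm (w - c) <= d -> g w = root_prod s w * h w &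
  forall a, a \in s -> nm (a - c) <= d / 4].

(** A substitute for Jensen's formula: a root [a] has [|w - a| >= 3 * d / 4] on the boundary circle
    but [|c - a| <= d / 4], so it improves the bound on [h] relative to [h c] by a factor 3. *)
Lemma factored_bound s h : factored s h ->
  forall w, nm (w - c) <= d -> nm (h w) <= expR T * nm (h c) / 3 ^+ size s.
Proof.
move=> [hh gE sa]; have cd : nm (c - c) <= d by rewrite subrr nm0 ltW.
apply: maximum_disc => // w wd; rewrite ler_pdivlMr ?exprn_gt0 //.
have d40 : 0 < d / 4 by rewrite divr_gt0.
rewrite -(ler_pM2r (exprn_gt0 (size s) d40)).
have h1 : (3 * (d / 4)) ^+ size s <= nm (root_prod s w).
  apply: nm_root_prod_ge; first by rewrite mulr_ge0 // ltW.
  by move=> a /sa ha; have := nmtri w a c; rewrite wd; lra.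
have h2 : nm (root_prod s c) <= (d / 4) ^+ size s.
  by apply: nm_root_prod_le => a /sa; rewrite nmB.
have wd' : nm (w - c) <= d by rewrite wd.
have := bg wd'; rewrite (gE w wd') (gE c cd) !nmM => h3.
rewrite -mulrA -exprMn.
apply: le_trans (_ : nm (h w) * nm (root_prod s w) <= _).
  by rewrite ler_wpM2l ?nm_ge0.
rewrite mulrC; apply: le_trans h3 _; rewrite -mulrA ler_wpM2l ?expR_ge0 // mulrC.
by rewrite ler_wpM2l ?nm_ge0.
Qed.

(** At [w = c] the previous bound reads [3 ^ N <= exp T], and [exp (1 / 2) <= 3]. *)
Lemma factored_size s h : factored s h -> (size s)%:R <= 2 * T.
Proof.
move=> H; have [_ gE _] := H; have cd : nm (c - c) <= d by rewrite subrr nm0 ltW.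
have hc : 0 < nm (h c).
  rewrite nm_gt0; apply: contraNneq gc0 => E; by rewrite (gE c cd) E mulr0.
have := factored_bound H cd; rewrite ler_pdivlMr ?exprn_gt0 // mulrC ler_pM2r // => h3.
have : expR (1 / 2 * (size s)%:R) <= expR T.
  apply: le_trans h3; rewrite mulrC expRM_natl.
  by apply: lerXn2r; rewrite ?nnegrE ?expR_ge0 ?expR_half_le3.
by rewrite ler_expR; lra.
Qed.

(** While [h] has a zero in the small disc, [dquot] splits it off; [factored_size] prevents this
    from going on forever. *)
Lemma factored_exists : exists s h, factored s h /\
  forall w, nm (w - c) <= d / 4 -> h w != 0.
Proof.
apply: contrapT => Hno.
have build n : exists s h, factored s h /\ size s = n.
  elim: n => [|n [s [h [H sz]]]].
    exists [::], g; split=> //; split=> // w wd.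
    by rewrite /root_prod big_nil mul1r.
  have [a ad ha] : exists2 a, nm (a - c) <= d / 4 & h a = 0.
    apply: contrapT => H'; apply: Hno; exists s, h; split=> // w wd.
    by apply/eqP => E; apply: H'; exists w.
  have [hh gE sa] := H; have add : nm (a - c) <= d by move: d0 ad; lra.
  exists (a :: s), (dquot h a); split; last by rewrite /= sz.
  split.
  - by move=> w wd; apply: hol_dquot; exact: hh.
  - move=> w wd; rewrite gE // /root_prod big_cons /dquot -/(root_prod s w).
    case: eqP => [->|/eqP wa]; first by rewrite ha subrr !(mulr0, mul0r).
    by rewrite ha subr0; field; rewrite subr_eq0.
  - by move=> b; rewrite inE => /orP[/eqP ->|/sa].
have [s [h [H sz]]] := build (Num.truncn (2 * T)).+1.
have := factored_size H; rewrite sz leNgt => /negP; apply.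
by rewrite truncnS_gt.
Qed.

End Factor.

Lemma root_prod_ratio s z w (eta delta : R) : 0 < eta ->
  (forall a, a \in s -> eta <= nm (z - a)) -> nm (w - z) <= delta ->
  nm (root_prod s w) <= nm (root_prod s z) * expR (delta / eta * (size s)%:R).
Proof.
move=> eta0 za wz; have delta0 : 0 <= delta by apply: le_trans wz; exact: nm_ge0.
rewrite /root_prod !nm_prod; elim: s za => [|a s IH] za.
  by rewrite !big_nil mulr0 expR0 mulr1.
rewrite !big_cons /= -natr1 mulrDr mulr1 expRD [expR _ * expR _]mulrC mulrACA.
rewrite ler_pM ?nm_ge0 ?prodr_ge0 // => [b _||]; first exact: nm_ge0.
  apply: le_trans (_ : nm (z - a) * (1 + delta / eta) <= _).
    have ha := za a (mem_head _ _); have := nmtri w z a.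
    have : delta <= nm (z - a) * (delta / eta).
      by rewrite mulrA ler_pdivlMr // mulrC ler_wpM2r.
    lra.
  by rewrite ler_wpM2l ?nm_ge0 // expR_ge1Dx.
by apply: IH => b bs; apply: za; rewrite inE bs orbT.
Qed.

(** The logarithm [u] of [h] has real part at most [T], so [|u| <= 2 * T] within [d / 10] of [c] by
    Borel-Caratheodory with [r' = d / 5]. Cauchy's estimate on discs of radius [d / 20] then makes
    [u] Lipschitz with constant [80 * T / d]. *)
Lemma nonvanishing_harnack h c d T : 0 < d -> 0 < T ->
  (forall w, nm (w - c) < d / 4 -> hol h w) ->
  (forall w, nm (w - c) < d / 4 -> h w != 0) ->
  (forall w, nm (w - c) < d / 4 -> nm (h w) <= expR T * nm (h c)) ->
  forall z w, nm (z - c) <= d / 20 -> nm (w - c) <= d / 20 ->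
  nm (h w) <= nm (h z) * expR (80 * T / d * nm (w - z)).
Proof.
move=> d0 T0 hh hn0 bh z w zd wd; have d4 : 0 < d / 4 by rewrite divr_gt0.
have [u [uc hu hE]] := nonvanishing_log d4 hh hn0.
have hc0 : 0 < nm (h c) by rewrite nm_gt0 hn0 // subrr nm0.
have uT v : nm (v - c) < d / 4 -> complex.Re (u v) <= T.
  move=> vd; have := bh v vd.
  by rewrite (hE v vd) mulrC ler_pM2r // ler_expR.
have u2T v : nm (v - c) <= d / 10 -> nm (u v) <= 2 * T.
  move=> vd; apply: (@borel_caratheodory u c (d / 4) (d / 5)) => //; lra.
have ulip : nm (u w - u z) <= 80 * T / d * nm (w - z).
  apply: (@mean_value_segment _ u (derive1 u)) => t t01;
    set v := z + _; have vd : nm (v - c) <= d / 20 by apply: nm_seg_le.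
    by apply: hol_cder; apply: hu; lra.
  have -> : 80 * T / d = 2 * (2 * T) / (d / 20) by field; rewrite gt_eqF.
  apply: cauchy_estimate1; first by rewrite divr_gt0.
    by move=> x xv; apply: hu; have := nmtri x v c; lra.
  by move=> x xv; apply: u2T; have := nmtri x v c; lra.
rewrite (hE w); last lra.
rewrite (hE z); last lra.
rewrite -mulrA ler_wpM2l ?nm_ge0 // -expRD ler_expR -lerBlDl.
apply: le_trans ulip; rewrite -ReN -ReD.
by apply: le_trans (Re_le_nm _); exact: ler_norm.
Qed.

(* Factor [g] as a product over its [O(T)] zeros near [c] times a nonvanishing
   function, for which Harnack's inequality holds; the pigeonhole principle gives
   a radius at distance at least [~ d / T] from the moduli of all the zeros. *)
Lemma comparison_circle g c d T : 0 < d -> 1 <= T -> g c != 0 ->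
  (forall w, nm (w - c) <= d -> hol g w) ->
  (forall w, nm (w - c) <= d -> nm (g w) <= expR T * nm (g c)) ->
  exists2 rho, d / 80 <= rho <= d / 40 & forall z, nm (z - c) = rho ->
    g z != 0 /\ forall w, nm (w - z) <= d / (1000 * (T + 1) ^+ 2) ->
      nm (g w) <= expR 2 * nm (g z).
Proof.
move=> d0 T1 gc0 hg bg.
have [s [h [H hn0]]] := factored_exists d0 gc0 hg bg.
have NT := factored_size d0 gc0 bg H.
have Hb := factored_bound d0 bg H.
have [hh gE sa] := H.
have T0 : 0 < T by lra.
have dd w : nm (w - c) < d / 4 -> nm (w - c) <= d by move: d0; lra.
have h3 : expR T * nm (h c) / 3 ^+ size s <= expR T * nm (h c).
  rewrite ler_pdivrMr ?exprn_gt0 // ler_peMr //.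
    by rewrite mulr_ge0 ?expR_ge0 ?nm_ge0.
  by rewrite exprn_ege1 // ler1n.
have harnack := @nonvanishing_harnack h c d T d0 T0 (fun w wd => hh w (dd w wd))
  (fun w wd => hn0 w (ltW wd)) (fun w wd => le_trans (Hb w (dd w wd)) h3).
pose N := size s.
(* The [N + 1] candidate radii, [2 * eta] apart, exactly fill the width [d / 80] between [d / 80]
   and [d / 40]. *)
pose eta := d / (160 * (N.+1)%:R).
have N1 : 0 < N.+1%:R :> R by rewrite ltr0n.
have eta0 : 0 < eta by rewrite divr_gt0 // mulr_gt0.
have [m mN Hm] := @free_radius [seq nm (a - c) | a <- s] (d / 80) eta eta0.
rewrite size_map -/N in mN.
pose rho := d / 80 + (2 * m%:R + 1) * eta.
have mN' : m%:R + 1 <= N.+1%:R :> R by rewrite natr1 ler_nat.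
have m0 : 0 <= m%:R :> R by rewrite ler0n.
have etaN : eta * N.+1%:R = d / 160 by rewrite /eta; field; rewrite gt_eqF.
have rlo : d / 80 <= rho by rewrite lerDl mulr_ge0 ?(ltW eta0) //; lra.
have rhi : rho <= d / 40.
  have : (2 * m%:R + 1) * eta <= 2 * N.+1%:R * eta by apply: ler_wpM2r; [exact: ltW|lra].
  rewrite /rho -mulrA [_ * eta in leRHS]mulrC etaN; lra.
exists rho; first by rewrite rlo rhi.
clear - NT T1 d0 gE hn0 sa rhi Hm eta0 etaN N1 harnack.
(* From [N <= 2 * T] both [delta / eta * N] and [80 * T / d * delta] are at most 1: the root product
   and the nonvanishing factor each cost one factor [expR 1]. *)
move=> z zr; set delta := d / (1000 * (T + 1) ^+ 2).
have za a : a \in s -> eta <= nm (z - a).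
  move=> as_; have := Hm _ (map_f _ as_); rewrite -/rho => /le_trans; apply.
  rewrite -zr ler_norml; have := nmtri a z c; have := nmtri z a c; rewrite (nmB a z).
  by clear; move=> ? ?; apply/andP; split; lra.
have zd : nm (z - c) <= d / 40 by rewrite zr.
have zd' : nm (z - c) <= d by move: zd d0; clear; lra.
split.
  rewrite gE // mulf_neq0 ?hn0 //; last by move: zd d0; clear; lra.
  rewrite -nm_gt0; apply: lt_le_trans (exprn_gt0 (size s) eta0) _.
  by apply: nm_root_prod_ge => //; exact: ltW.
move=> w wz.
have TT : 4 <= (T + 1) ^+ 2.
  by move: T1; clear; have := sqr_ge0 (T - 1); rewrite !expr2; lra.
have T10 : 0 < 1000 * (T + 1) ^+ 2 by move: TT; clear; lra.
have dE : delta * (1000 * (T + 1) ^+ 2) = d by rewrite divfK ?gt_eqF.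
have delta0 : 0 < delta by exact: divr_gt0.
have deltad : delta <= d / 40.
  have : delta * 40 <= delta * (1000 * (T + 1) ^+ 2).
    by apply: ler_wpM2l; [exact: ltW|move: TT; clear; lra].
  by rewrite dE; clear; lra.
have wd : nm (w - c) <= d / 20 by move: (nmtri w z c) wz zd deltad; clear; lra.
have zd2 : nm (z - c) <= d / 20 by move: zd d0; clear; lra.
have wd' : nm (w - c) <= d by move: wd d0; clear; lra.
rewrite gE // (gE z) // !nmM.
have -> : expR 2 * (nm (root_prod s z) * nm (h z)) =
  (nm (root_prod s z) * expR 1) * (nm (h z) * expR 1).
  by rewrite mulrACA -expRD mulrC; congr (_ * expR _); clear; lra.
apply: ler_pM; rewrite ?nm_ge0 //.
  apply: le_trans (root_prod_ratio eta0 za wz) _.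
  rewrite ler_wpM2l ?nm_ge0 // ler_expR -/N.
  rewrite mulrAC ler_pdivrMr // mul1r -(ler_pM2r N1) etaN -dE.
  rewrite -[leLHS]mulrA -[leRHS]mulrA; apply: ler_wpM2l; first exact: ltW.
  have NN : N.+1%:R = N%:R + 1 :> R by rewrite natr1.
  have n0 : 0 <= N%:R :> R by rewrite ler0n.
  by rewrite NN expr2; move: NT n0 T1; rewrite -/N; clear; nra.
apply: le_trans (harnack z w zd2 wd) _; rewrite ler_wpM2l ?nm_ge0 // ler_expR.
apply: le_trans (_ : 80 * T / d * delta <= _).
  rewrite ler_wpM2l // divr_ge0 ?(ltW d0) // mulr_ge0 //.
  by move: T1; clear; lra.
rewrite mulrAC ler_pdivrMr // mul1r -dE [leRHS]mulrC; apply: ler_wpM2r; first exact: ltW.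
by move: T1; clear; rewrite expr2; nra.
Qed.

End LocalComparison.

(** * Propagation of lower bounds and the estimate of the coefficient [A 0] *)

Section LowerBound.
Context {R : realType}.
Local Notation C := (Cplx R).
Implicit Types (f g h : C -> C) (z w a c y v : C) (r T s : R).

(** The maximum principle for [f w / (w - c) ^ p] on the annulus. An integer exponent [p], adjusted
    in each application, replaces the logarithmic interpolation of Hadamard's theorem. *)
Lemma power_three_circles f c (s1 s3 B : R) p : 0 < s1 ->
  (forall w, s1 <= nm (w - c) <= s3 -> hol f w) ->
  (forall w, nm (w - c) = s1 -> nm (f w) <= B * s1 ^+ p) ->
  (forall w, nm (w - c) = s3 -> nm (f w) <= B * s3 ^+ p) ->
  forall w, s1 <= nm (w - c) <= s3 -> nm (f w) <= B * nm (w - c) ^+ p.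
Proof.
move=> s10 hf f1 f3; pose g w := f w * ((w - c) ^+ p)^-1.
have pos w : s1 <= nm (w - c) <= s3 -> 0 < nm (w - c) ^+ p.
  by move=> /andP[h _]; rewrite exprn_gt0 //; apply: lt_le_trans h.
have hg w : s1 <= nm (w - c) <= s3 -> hol g w.
  move=> h; apply: holM; first exact: hf.
  apply: holV; first by apply: holX; exact: holB (hol_id _) (hol_cst _ _).
  by rewrite -nm_gt0 nmX pos.
have gE w : s1 <= nm (w - c) <= s3 -> (nm (g w) <= B) = (nm (f w) <= B * nm (w - c) ^+ p).
  by move=> h; rewrite /g nmM nmV nmX ler_pdivrMr // pos.
suff H : forall w, s1 <= nm (w - c) <= s3 -> nm (g w) <= B.
  by move=> w ws; rewrite -gE // H.
apply: (@maximum_principle _ [set w | s1 <= nm (w - c) <= s3] g (nm c + s3)).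
- by move=> w /= /andP[_ ws]; have := nm_sub w c; lra.
- move=> w /= /negP; rewrite negb_and -!ltNge => /orP[h|h].
    exists (s1 - nm (w - c)); first by rewrite subr_gt0.
    move=> u; rewrite nmB => hu /andP[h1 _].
    by have := nmtri u w c; rewrite (nmB u w); lra.
  exists (nm (w - c) - s3); first by rewrite subr_gt0.
  by move=> u; rewrite nmB => hu /andP[_ h1]; have := nmtri w u c; lra.
- by move=> w /hg; exact: hol_ccont.
- move=> w /= ws; have [e1|n1] := eqVneq (nm (w - c)) s1.
    by left; rewrite gE // e1 f1.
  have [e3|n3] := eqVneq (nm (w - c)) s3; first by left; rewrite gE // e3 f3.
  move: (ws) => /andP[h1 h3]; right; split; first exact: hg.
  have {}h1 : s1 < nm (w - c) by rewrite lt_neqAle eq_sym n1.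
  have {}h3 : nm (w - c) < s3 by rewrite lt_neqAle n3.
  exists (Num.min (nm (w - c) - s1) (s3 - nm (w - c))).
    by rewrite lt_min !subr_gt0 h1.
  move=> u; rewrite lt_min => /andP[u1 u3].
  have := nmtri u w c; have := nmtri w u c; rewrite (nmB w u).
  by move=> k1 k2; apply/andP; split; lra.
Qed.

Lemma exp_unbounded (q X : R) : 1 < q -> exists p, X <= q ^+ p.
Proof.
move=> q1; have q0 : 0 < q by lra.
have lq : 0 < ln q by rewrite ln_gt0.
exists (Num.truncn (`|X / ln q|)).+1.
have -> : q ^+ (Num.truncn `|X / ln q|).+1 =
    expR ((Num.truncn `|X / ln q|).+1%:R * ln q).
  by rewrite expRM_natl lnK.
apply: le_trans (_ : (Num.truncn `|X / ln q|).+1%:R * ln q <= _).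
  rewrite -ler_pdivrMr //; apply: le_trans (ler_norm _) _.
  by apply: ltW; rewrite truncnS_gt.
by apply: le_trans (expR_ge1Dx _); lra.
Qed.

(* By the maximum principle for [f z / z ^ p] on an annulus, [f] cannot decay
   faster than a fixed power of [r] on the whole circle of radius [r]. *)
Lemma max_modulus_ge f (rho : R) z0 :
  (forall w, 0 < nm w < rho -> hol f w) -> 0 < nm z0 < rho -> f z0 != 0 ->
  exists p, exists2 B : R, 0 < B & forall r, 0 < r <= nm z0 ->
    exists2 y, nm y = r & B * r ^+ p <= nm (f y).
Proof.
move=> hf /andP[z00 z0r] fz0; pose r1 := (nm z0 + rho) / 2.
have r01 : nm z0 < r1 by rewrite /r1; lra.
have r1r : r1 < rho by rewrite /r1; lra.
have [M HM] : exists M : R, forall w, nm w = r1 -> nm (f w) <= M.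
  apply: (@nm_bounded _ [set w | nm w = r1] f r1).
  - by move=> w /= ->.
  - move=> w /= /eqP h; exists `|nm w - r1|; first by rewrite normr_gt0 subr_eq0.
    move=> u hu E; have := nm_sub u w; have := nm_sub w u; rewrite E (nmB w u).
    by move: hu; rewrite lter_normr => /orP[]; lra.
  - by move=> w /= h; apply/hol_ccont/hf; rewrite h; lra.
have m0 : 0 < nm (f z0) by rewrite nm_gt0.
(* With this [p], the bound [M] on the outer circle is at most [B * r1 ^+ p], although
   [B * nm z0 ^+ p] is only half of [nm (f z0)]. If [f] were below [B * r ^+ p] on the inner circle
   too, the value at [z0] would be contradicted. *)
have [|p Hp] := @exp_unbounded (r1 / nm z0) (2 * M / nm (f z0)).
  by rewrite ltr_pdivlMr // mul1r.
pose B := nm (f z0) / (2 * nm z0 ^+ p).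
have zp : 0 < nm z0 ^+ p by rewrite exprn_gt0.
have B0 : 0 < B by rewrite divr_gt0 // mulr_gt0.
exists p, B => // r /andP[r0 rz].
apply: contrapT => H.
have inner w : nm (w - 0) = r -> nm (f w) <= B * r ^+ p.
  rewrite subr0 => wr; rewrite leNgt; apply/negP => h; apply: H.
  by exists w => //; exact: ltW.
have outer w : nm (w - 0) = r1 -> nm (f w) <= B * r1 ^+ p.
  rewrite subr0 => wr; apply: le_trans (HM w wr) _.
  move: Hp; rewrite exprMn exprVn ler_pdivrMr // => Hp.
  rewrite /B mulrAC ler_pdivlMr ?mulr_gt0 //.
  have : 2 * M * nm z0 ^+ p <= nm (f z0) * r1 ^+ p.
    rewrite -ler_pdivlMr //; apply: le_trans Hp _.
    by rewrite mulrC mulrA.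
  by rewrite mulrCA mulrA.
have := @power_three_circles f 0 r r1 B p r0 _ inner outer z0.
rewrite !subr0 => h.
have : nm (f z0) <= B * nm z0 ^+ p.
  apply: h; last by rewrite rz ltW.
  by move=> w; rewrite subr0 => /andP[w1 w2]; apply: hf; lra.
have -> : B * nm z0 ^+ p = nm (f z0) / 2 by rewrite /B; field; rewrite gt_eqF.
by move: m0; lra.
Qed.

Lemma two_le_expR1 : 2 <= expR 1 :> R.
Proof. by have := expR_ge1Dx (1 : R); lra. Qed.

Lemma expR_half_le2 : expR (1 / 2) <= 2 :> R.
Proof.
have h : 1 / 2 <= expR (- (1 / 2)) :> R by have := expR_ge1Dx (- (1 / 2) : R); lra.
have p := expR_gt0 (1 / 2 : R); have : expR (1 / 2) * expR (- (1 / 2)) = 1 :> R.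
  by rewrite -expRD subrr expR0.
nra.
Qed.

(** Three circles of radii [s], [|y - c| <= 2 * s] and [4 * s]: were [f] too small on the inner
    disc, the bound [exp T] on the outer circle would force [|f y| <= exp (- a) / 2]. The new
    exponent is linear in [a] and [T], so a fixed number of steps still costs only [O(T)]. *)
Lemma lower_bound_step f c s T (a : R) y : 0 < s -> 1 <= T -> 0 <= a ->
  (forall w, s <= nm (w - c) <= 4 * s -> hol f w /\ nm (f w) <= expR T) ->
  nm (y - c) <= 2 * s -> expR (- a) <= nm (f y) ->
  exists2 x, nm (x - c) <= s & expR (- (3 * a + 6 * T)) <= nm (f x).
Proof.
move=> s0 T1 a0 hf yc fy; apply: contrapT => Hno.
have small x : nm (x - c) <= s -> nm (f x) < expR (- (3 * a + 6 * T)).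
  by move=> xs; rewrite ltNge; apply/negP => h; apply: Hno; exists x.
have sy : s < nm (y - c).
  rewrite ltNge; apply/negP => /small; rewrite ltNge => /negP; apply.
  by apply: le_trans fy; rewrite ler_expR; lra.
(* [p / 2 >= 1 + T + a] gives the outer bound through [exp (1 / 2) <= 2]; [p + 1 <= 2 * a + 6 * T],
   which uses [1 <= T], gives the inner one through [2 <= exp 1]. *)
pose p := (Num.truncn (2 * (1 + T + a))).+1.
have p1 : 2 * (1 + T + a) <= p%:R by apply: ltW; rewrite /p truncnS_gt.
have p2 : p%:R <= 2 * (1 + T + a) + 1.
  rewrite /p -natr1 lerD2r truncn_le //; lra.
have two_hi : expR (p%:R * (1 / 2)) <= 2 ^+ p :> R.
  by rewrite expRM_natl; apply: lerXn2r; rewrite ?nnegrE ?expR_ge0 ?expR_half_le2.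
have two_lo : 2 ^+ p <= expR p%:R :> R.
  have := expRM_natl p (1 : R); rewrite mulr1 => ->.
  by apply: lerXn2r; rewrite ?nnegrE ?expR_ge0 ?two_le_expR1.
pose B := expR (- a) / (2 * (2 * s) ^+ p).
have sp : 0 < (2 * s) ^+ p by rewrite exprn_gt0 // mulr_gt0.
have B0 : 0 < B by rewrite divr_gt0 ?expR_gt0 // mulr_gt0.
have BE : B * (2 * s) ^+ p = expR (- a) / 2 by rewrite /B; field; rewrite gt_eqF.
have inner w : nm (w - c) = s -> nm (f w) <= B * s ^+ p.
  move=> ws; have /small/ltW h : nm (w - c) <= s by rewrite ws.
  apply: le_trans h _.
  have tp : 0 < 2 ^+ p :> R by rewrite exprn_gt0.
  rewrite -(ler_pM2l tp) mulrCA -exprMn BE ler_pdivlMr //.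
  apply: le_trans (_ : expR p%:R * expR (- (3 * a + 6 * T)) * expR 1 <= _).
    apply: ler_pM; rewrite ?mulr_ge0 ?expR_ge0 ?two_le_expR1 ?(ltW tp) //.
    by rewrite ler_wpM2r ?expR_ge0.
  by rewrite -!expRD ler_expR; lra.
have outer w : nm (w - c) = 4 * s -> nm (f w) <= B * (4 * s) ^+ p.
  move=> ws; have [|_ h] := hf w; first by rewrite ws; apply/andP; split; lra.
  apply: le_trans h _; have -> : 4 * s = 2 * (2 * s) by ring.
  rewrite exprMn mulrCA BE mulrA ler_pdivlMr //.
  apply: le_trans (_ : expR T * expR 1 <= _).
    by rewrite ler_wpM2l ?expR_ge0 ?two_le_expR1.
  apply: le_trans (_ : expR (p%:R * (1 / 2)) * expR (- a) <= _).
    by rewrite -!expRD ler_expR; lra.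
  by rewrite ler_wpM2r ?expR_ge0.
have := @power_three_circles f c s (4 * s) B p s0 (fun w ws => proj1 (hf w ws)) inner outer y.
have yy : s <= nm (y - c) <= 4 * s by apply/andP; split; lra.
move=> /(_ yy); apply/negP; rewrite -ltNge; apply: lt_le_trans fy.
apply: le_lt_trans (_ : expR (- a) / 2 < _).
  rewrite -BE ler_wpM2l ?(ltW B0) //.
  by apply: lerXn2r; rewrite ?nnegrE ?nm_ge0 // mulr_ge0 // ltW.
by rewrite ltr_pdivrMr // ltr_pMr ?expR_gt0 //; lra.
Qed.

(** Repeated square roots with nonnegative real part, without arguments: from [v = x ^ 2] one gets
    [|x - 1| |x + 1| = |v - 1|], and [|x + 1| ^ 2 >= 2], so each root halves the squared distance to
    1. *)
Lemma unit_root (i : nat) (zeta : C) : nm zeta = 1 -> exists v, [/\ nm v = 1,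
  v ^+ (2 ^ i) = zeta & nm (v - 1) ^+ 2 <= 4 / 2 ^+ i].
Proof.
move=> nz; elim: i => [|i [v [nv vz v1]]].
  exists zeta; rewrite expn0 expr1 expr0 divr1; split=> //.
  have : nm (zeta - 1) <= 2 by apply: le_trans (nmBle _ _) _; rewrite nz nm1; lra.
  by have := nm_ge0 (zeta - 1); rewrite expr2; nra.
have [x xv x0] : exists2 x : C, x ^+ 2 = v & 0 <= complex.Re x.
  have sv : (sqrtc v : C) ^+ 2 = v by exact: sqr_sqrtc.
  have [h|h] := leP 0 (complex.Re (sqrtc v)); first by exists (sqrtc v).
  by exists (- sqrtc v); [rewrite sqrrN|rewrite ReN oppr_ge0 ltW].
have nx : nm x = 1.
  have : nm x ^+ 2 = 1 by rewrite -nmX xv.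
  move/eqP; rewrite -[X in _ == X](expr1n _ 2).
  by rewrite eqrXn2 ?nm_ge0 // => /eqP.
exists x; split=> //; first by rewrite expnS exprM xv.
have x2 : 2 <= nm (x + 1) ^+ 2.
  have := nm_sqr x; rewrite nx expr1n !nm_sqr ReD ImD /= addr0 => E.
  by rewrite sqrrD expr1n mulr1 mulr2n; lra.
have E : nm (x - 1) ^+ 2 * nm (x + 1) ^+ 2 = nm (v - 1) ^+ 2.
  by rewrite -!nmX -nmM -exprMn -xv subr_sqr_1.
rewrite [2 ^+ i.+1]exprSr invfM mulrA ler_pdivlMr //.
apply: le_trans v1; rewrite -E ler_wpM2l ?sqr_ge0 //.
Qed.

Lemma unit_root_close (kappa : R) : 0 < kappa -> exists J, forall zeta : C,
  nm zeta = 1 -> exists v, [/\ nm v = 1, v ^+ J = zeta & nm (v - 1) <= kappa].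
Proof.
move=> k0; have [i hi] := @half_pow_lt R 4 (kappa ^+ 2) (exprn_gt0 2 k0).
exists (2 ^ i)%N => zeta /(unit_root i)[v [nv vz v1]]; exists v; split=> //.
rewrite -(ler_pXn2r (n := 2)) ?nnegrE ?nm_ge0 ?(ltW k0) //.
by apply: le_trans v1 (ltW hi).
Qed.

(** The points [y * v ^+ i] lead from [y] to [z0] along the circle in [J] steps of length at most
    [kappa * r], and [lower_bound_step] passes from each to the next. [J], hence [Q], depends on
    [kappa] alone; [kappa <= 1 / 8] keeps the discs of radius [4 * kappa * r] in the annulus. *)
Lemma nearby_lower_bound (kappa : R) : 0 < kappa -> kappa <= 1 / 8 ->
  exists2 Q : R, 1 <= Q & forall f r T y z0, 0 < r -> 1 <= T ->
  (forall w, r / 2 <= nm w <= 3 * r / 2 -> hol f w /\ nm (f w) <= expR T) ->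
  nm y = r -> expR (- T) <= nm (f y) -> nm z0 = r ->
  exists2 c, nm (c - z0) <= kappa * r & expR (- (Q * T)) <= nm (f c).
Proof.
move=> k0 k8; have [J HJ] := unit_root_close k0.
pose q i := iter i (fun x : R => 3 * x + 6) 1.
have q1 i : 1 <= q i by elim: i => [|i IH]; rewrite /q /= ?lexx // -/(q i); lra.
exists (q J); first exact: q1.
move=> f r T y z0 r0 T1 hf yr fy z0r.
have y0 : y != 0 by rewrite -nm_gt0 yr.
have [|v [nv vz v1]] := HJ (z0 / y).
  by rewrite nmM nmV z0r yr divff // gt_eqF.
suff H i : exists2 c, nm (c - y * v ^+ i) <= kappa * r & expR (- (q i * T)) <= nm (f c).
  by have := H J; rewrite vz mulrC divfK.
elim: i => [|i [c cy fc]].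
  exists y; first by rewrite expr0 mulr1 subrr nm0 mulr_ge0 // ltW.
  by rewrite /q /= mul1r.
have kr : 0 < kappa * r by rewrite mulr_gt0.
have krr : kappa * r <= r / 8 by have := ler_wpM2r (ltW r0) k8; lra.
have nyv j : nm (y * v ^+ j) = r by rewrite nmM nmX nv expr1n mulr1.
have qT : 0 <= q i * T by rewrite mulr_ge0 //; have := q1 i; lra.
have [w ws|||x xc fx] := @lower_bound_step f (y * v ^+ i.+1) (kappa * r) T (q i * T) c kr T1 qT.
- apply: hf; move: ws => /andP[_ w4].
  have := nm_sub w (y * v ^+ i.+1); have := nm_sub (y * v ^+ i.+1) w.
  rewrite nyv (nmB (y * v ^+ i.+1) w) => h1 h2.
  by apply/andP; split; lra.
- apply: le_trans (nmtri _ (y * v ^+ i) _) _.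
  have -> : y * v ^+ i - y * v ^+ i.+1 = y * v ^+ i * (1 - v) by rewrite exprSr; ring.
  rewrite nmM nyv (nmB 1 v); have := ler_wpM2l (ltW r0) v1; lra.
- exact: fc.
exists x => //; apply: le_trans fx; rewrite ler_expR /q /= -/(q i); lra.
Qed.

(** The inner denominator is the radius [delta] given by [comparison_circle] for [d = r / 4] and the
    bound [(Q + 1) * T]; the left side is the cost of one derivative in [cauchy_estimate]. *)
Lemma derivative_scale_bound (k Q T r : R) : 1 <= k -> 1 <= Q -> 1 <= T -> 0 < r ->
  2 * k / (r / 4 / (1000 * ((Q + 1) * T + 1) ^+ 2)) <=
  8000 * (k * (Q + 2) ^+ 2) * (T ^+ 2 / r).
Proof.
move=> k1 Q1 T1 r0; set S := (Q + 1) * T + 1.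
have S0 : 0 < S by rewrite /S; nra.
have -> : 2 * k / (r / 4 / (1000 * S ^+ 2)) = 8000 * k * S ^+ 2 / r.
  by field; rewrite !gt_eqF.
have -> : 8000 * (k * (Q + 2) ^+ 2) * (T ^+ 2 / r) = 8000 * k * ((Q + 2) * T) ^+ 2 / r.
  by field; rewrite gt_eqF.
apply: ler_wpM2r; first by rewrite invr_ge0 ltW.
apply: ler_wpM2l; first by move: k1; clear; lra.
apply: lerXn2r; rewrite ?nnegrE ?(ltW S0) //.
  by move: Q1 T1; clear; nra.
by rewrite /S; move: Q1 T1; clear; lra.
Qed.

Lemma coefficient_bound k : (0 < k)%N -> exists2 K : R, 0 < K &
  forall (A : nat -> C -> C) f r T y z0, 0 < r <= 1 -> 1 <= T ->
  (forall w, r / 2 <= nm w <= 3 * r / 2 ->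
     [/\ hol f w, nm (f w) <= expR T, hol (A 0%N) w,
         forall j, (0 < j < k)%N -> nm (A j w) <= T &
         derive1n k f w + \sum_(j < k) A j w * derive1n j f w = 0]) ->
  nm y = r -> expR (- T) <= nm (f y) -> nm z0 = r ->
  nm (A 0%N z0) <= K * T * (T ^+ 2 / r) ^+ k.
Proof.
(* With [d = r / 4] the comparison circle has radius at least [d / 80 = r / 320], so [c] within
   [r / 400] of [z0] ensures that it encloses [z0]. *)
move=> k0; have [||Q Q1 HQ] := @nearby_lower_bound (1 / 400); [lra|lra|].
have kR : 1 <= k%:R :> R by rewrite ler1n.
have [D [D1 HD]] : exists D : R, 1 <= D /\ forall T r, 1 <= T -> 0 < r ->
    2 * k%:R / (r / 4 / (1000 * ((Q + 1) * T + 1) ^+ 2)) <= D * (T ^+ 2 / r).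
  exists (8000 * (k%:R * (Q + 2) ^+ 2)); split.
    have : 1 * 9 <= k%:R * (Q + 2) ^+ 2.
      by apply: ler_pM => //; rewrite expr2; move: Q1; clear; nra.
    by clear; lra.
  by move=> T r T1 r0; exact: derivative_scale_bound.
have D0 : 0 < D by apply: lt_le_trans D1.
exists (expR 2 * (k%:R + 1) * D ^+ k).
  by rewrite !mulr_gt0 ?expR_gt0 ?exprn_gt0 //; lra.
move=> A f r T y z0 /andP[r0 r1] T1 H yr fy z0r.
have [w ws|c cz fc] := HQ f r T y z0 r0 T1 _ yr fy z0r.
  by have [h1 h2 _ _ _] := H w ws.
have nc : nm (c - z0) <= r / 400 by move: cz; clear; lra.
have d0 : 0 < r / 4 by rewrite divr_gt0.
have ann w : nm (w - c) <= r / 4 -> r / 2 + r / 100 <= nm w <= 3 * r / 2 - r / 100.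
  move=> wd; have := nmtri w c z0; have := nm_sub w z0; have := nm_sub z0 w.
  rewrite (nmB z0 w) z0r; move: wd nc r0; clear => *.
  by apply/andP; split; lra.
have ann' w : nm (w - c) <= r / 4 -> r / 2 <= nm w <= 3 * r / 2.
  by move=> /ann /andP[h1 h2]; move: h1 h2 r0; clear => *; apply/andP; split; lra.
(* Relative to [f c], which is at least [exp (- Q * T)], the bound [exp T] becomes [exp T']. *)
pose T' := (Q + 1) * T.
have T'1 : 1 <= T' by rewrite /T'; move: Q1 T1; clear; nra.
have fc0 : f c != 0 by rewrite -nm_gt0; apply: lt_le_trans fc; exact: expR_gt0.
have [w wd|w wd|rho /andP[rho1 rho2] Hrho] := @comparison_circle _ f c (r / 4) T' d0 T'1 fc0.
- by have [] := H w (ann' w wd).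
- have [_ h _ _ _] := H w (ann' w wd); apply: le_trans h _.
  apply: le_trans (_ : expR T' * expR (- (Q * T)) <= _).
    by rewrite -expRD ler_expR /T'; clear; lra.
  by rewrite ler_wpM2l ?expR_ge0.
have := HD T r T1 r0; rewrite -/T'.
set delta := r / 4 / (1000 * (T' + 1) ^+ 2) in Hrho *.
have [delta0 deltar] : 0 < delta /\ delta <= r / 1000.
  rewrite /delta; have T'2 : 1 <= (T' + 1) ^+ 2 by rewrite expr2; move: T'1; clear; nra.
  have den0 : 0 < 1000 * (T' + 1) ^+ 2 by move: T'2; clear; lra.
  split; first exact: divr_gt0.
  rewrite ler_pdivrMr; last exact: den0.
  have : r / 4 * 1 <= r / 4 * (T' + 1) ^+ 2 by apply: ler_wpM2l; [exact: ltW|].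
  by move: r0; clear; lra.
set E := D * (T ^+ 2 / r) => dE.
(* This allows the same power [E ^+ k] for all derivatives of order at most [k]. *)
have E1 : 1 <= E.
  rewrite /E -[1]mulr1; apply: ler_pM => //.
  rewrite ler_pdivlMr // mul1r expr2; move: T1 r1; clear; nra.
move: delta delta0 deltar dE Hrho => delta delta0 deltar dE Hrho.
have cz' : nm (z0 - c) <= rho.
  by rewrite nmB; apply: le_trans nc _; move: rho1 r0; clear; lra.
have rd : rho <= r / 4 by move: rho2 d0; clear; lra.
apply: (@maximum_disc _ (A 0%N) c rho) cz' => w wr.
  by have [|_ _ h _ _] := H w; first by apply: ann'; apply: le_trans wr rd.
have wd : nm (w - c) <= r / 4 by rewrite wr.
have [fw0 Hw] := Hrho w wr; have [_ _ _ HA Heq] := H w (ann' w wd).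
have fwp : 0 < nm (f w) by rewrite nm_gt0.
have E0 : 0 <= E by apply: le_trans E1.
have der j : (j <= k)%N -> nm (derive1n j f w) <= expR 2 * E ^+ k * nm (f w).
  move=> jk; have := @cauchy_estimate _ f w delta (expR 2 * nm (f w)) k j delta0 k0 jk.
  move=> h; apply: le_trans (h _ _) _.
  - move=> x xw; have [|h1 _ _ _ _] := H x; last exact: h1.
    have /andP[a1 a2] := ann w wd; have := nm_sub x w; have := nm_sub w x.
    rewrite (nmB w x); move: a1 a2 xw deltar r0; clear => *.
    by apply/andP; split; lra.
  - by move=> x xw; apply: Hw.
  rewrite mulrA [_ * expR 2]mulrC ler_wpM2r ?nm_ge0 // ler_wpM2l ?expR_ge0 //.
  apply: le_trans (_ : E ^+ j <= _); last by rewrite ler_weXn2l.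
  apply: lerXn2r; rewrite ?nnegrE //.
  by rewrite divr_ge0 ?(ltW delta0) // mulr_ge0.
have sumE : A 0%N w * f w = - (derive1n k f w + \sum_(j < k | (0 < j)%N) A j w * derive1n j f w).
  apply/eqP; rewrite -addr_eq0 addrC -addrA; apply/eqP; rewrite -[RHS]Heq; congr (_ + _).
  by rewrite [in RHS](bigD1 (Ordinal k0)) //= addrC; congr (_ + _); apply: eq_bigl => j; rewrite lt0n.
rewrite -(ler_pM2r fwp) -nmM sumE nmN.
apply: le_trans (nmD _ _) _.
have X0 : 0 <= expR 2 * E ^+ k * nm (f w).
  by rewrite !mulr_ge0 ?expR_ge0 ?nm_ge0 ?exprn_ge0.
have T0 : 0 <= T by apply: le_trans T1.
have s1 : nm (\sum_(j < k | (0 < j)%N) A j w * derive1n j f w) <=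
    k%:R * (T * (expR 2 * E ^+ k * nm (f w))).
  apply: le_trans (nm_sum _ _ _) _.
  apply: le_trans (_ : \sum_(j < k | (0 < j)%N) T * (expR 2 * E ^+ k * nm (f w)) <= _).
    apply: ler_sum => j j0; rewrite nmM; apply: ler_pM; rewrite ?nm_ge0 //.
      by apply: HA; rewrite j0 ltn_ord.
    by apply: der; exact: ltnW (ltn_ord j).
  have -> : k%:R * (T * (expR 2 * E ^+ k * nm (f w))) =
      \sum_(j < k) T * (expR 2 * E ^+ k * nm (f w)).
    by rewrite sumr_const card_ord mulr_natl.
  rewrite big_mkcond /=.
  by apply: ler_sum => j _; case: ifP => // _; rewrite mulr_ge0.
have s2 := der k (leqnn k).
have s3 : expR 2 * E ^+ k * nm (f w) <= T * (expR 2 * E ^+ k * nm (f w)).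
  by rewrite ler_peMl.
apply: le_trans (lerD (le_trans s2 s3) s1) _.
have -> : expR 2 * (k%:R + 1) * D ^+ k * T * (T ^+ 2 / r) ^+ k * nm (f w) =
  (k%:R + 1) * (T * (expR 2 * E ^+ k * nm (f w))).
  rewrite /E [(D * _) ^+ k]exprMn.
  by move: (D ^+ k) ((T ^+ 2 / r) ^+ k) => x1 x2; ring.
by rewrite mulrDl mul1r addrC.
Qed.

End LowerBound.

(** * Iterated order of solutions *)

Section UpperBound.
Context {R : realType}.
Local Notation C := (Cplx R).
Implicit Types (f g h : C -> C) (z w a c y v : C).

Lemma nm_inner_le y l :
  `|2 * (complex.Re y * complex.Re l + complex.Im y * complex.Im l)| <= 2 * nm y * nm l.
Proof.
rewrite normrM ger0_norm // -mulrA ler_wpM2l //.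
have -> : complex.Re y * complex.Re l + complex.Im y * complex.Im l =
    complex.Re ((y : R[i])^* * l) by case: (y) => ? ?; case: (l) => ? ? /=; ring.
apply: le_trans (Re_le_nm _) _; rewrite nmM.
by rewrite [X in X * _ <= _](_ : _ = nm y) // /nm normcJ.
Qed.

(* Gronwall's inequality for [\sum_j |f ^ (j)| ^ 2] along the ray through [z0]. *)
Lemma solution_growth (k : nat) (A : nat -> C -> C) f (r r0 B G : R) z0 :
  0 < r -> r <= r0 -> r0 <= 1 -> 0 <= B -> nm z0 = r ->
  (forall w, r <= nm w <= r0 -> [/\ hol f w, forall j, (j < k)%N -> nm (A j w) <= B &
     derive1n k f w + \sum_(j < k) A j w * derive1n j f w = 0]) ->
  (forall w, nm w = r0 -> \sum_(j < k) nm (derive1n j f w) ^+ 2 <= G) ->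
  (0 < k)%N -> nm (f z0) ^+ 2 <= G * expR (2 * k%:R * (1 + k%:R * B)).
Proof.
move=> rp rr0 r01 B0 z0r H HG k0.
pose L := 2 * k%:R * (1 + k%:R * B); have kR : 0 <= k%:R :> R by rewrite ler0n.
have kB : 0 <= k%:R * B by rewrite mulr_ge0.
have L0 : 0 <= L by rewrite /L !mulr_ge0 // addr_ge0.
pose u := z0 / r%:C.
have nu : nm u = 1 by rewrite nmM nmV z0r nmR gtr0_norm // divff // gt_eqF.
have nt (t : R) : r <= t -> nm (0 + t%:C * u) = t.
  by move=> rt; rewrite add0r nmM nu mulr1 nmR ger0_norm //; apply: le_trans rt; exact: ltW.
pose g (t : R) := \sum_(j < k) nm (derive1n j f (0 + t%:C * u)) ^+ 2.
pose dg (t : R) := \sum_(j < k) (let y := derive1n j f (0 + t%:C * u) in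
  let l := derive1n j.+1 f (0 + t%:C * u) * u in
  2 * (complex.Re y * complex.Re l + complex.Im y * complex.Im l)).
have der (t : R) : r <= t <= r0 -> is_derive t (1 : R) g (dg t).
  move=> /andP[rt tr0].
  have -> : g = \sum_(j < k) (fun t : R => nm (derive1n j f (0 + t%:C * u)) ^+ 2).
    by apply/funext => x; rewrite fct_sumE.
  apply: is_derive_sum => j; apply: is_derive_nm_sqr.
  apply: rder_line; rewrite derive1nS; apply: hol_cder; apply: hol_derive1n.
  by have [] := H (0 + t%:C * u); rewrite ?nt // rt.
have g0 t : 0 <= g t by apply: sumr_ge0 => j _; exact: sqr_ge0.
have dgL (t : R) : r <= t <= r0 -> - (L * g t) <= dg t.
  move=> /andP[rt tr0]; set w := 0 + t%:C * u.
  have [hf hA heq] : [/\ hol f w, forall j, (j < k)%N -> nm (A j w) <= B &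
     derive1n k f w + \sum_(j < k) A j w * derive1n j f w = 0].
    by apply: H; rewrite nt // rt.
  pose S := Num.sqrt (g t).
  have S2 : S ^+ 2 = g t by rewrite sqr_sqrtr.
  have S0 : 0 <= S by exact: sqrtr_ge0.
  have fj j : (j < k)%N -> nm (derive1n j f w) <= S.
    move=> jk; rewrite -(ler_pXn2r (n := 2)) ?nnegrE ?nm_ge0 // S2 /g.
    by rewrite (bigD1 (Ordinal jk)) //= lerDl sumr_ge0 // => i _; exact: sqr_ge0.
  have fk : nm (derive1n k f w) <= k%:R * B * S.
    move: heq => /eqP; rewrite addr_eq0 => /eqP ->; rewrite nmN.
    apply: le_trans (nm_sum _ _ _) _.
    have -> : k%:R * B * S = \sum_(j < k) B * S.
      by rewrite sumr_const card_ord -[RHS]mulr_natl mulrA.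
    by apply: ler_sum => j _; rewrite nmM ler_pM ?nm_ge0 ?hA ?fj.
  have fj1 j : (j < k)%N -> nm (derive1n j.+1 f w) <= (1 + k%:R * B) * S.
    rewrite leq_eqVlt => /orP[/eqP ->|jk].
      by apply: le_trans fk _; rewrite mulrDl mul1r lerDr.
    by apply: le_trans (fj _ jk) _; rewrite mulrDl mul1r lerDl mulr_ge0.
  rewrite lerNl /dg -sumrN.
  have -> : L * g t = \sum_(j < k) 2 * S * ((1 + k%:R * B) * S).
    rewrite sumr_const card_ord -[RHS]mulr_natl -S2 /L; ring.
  apply: ler_sum => j _ /=; rewrite -/w.
  apply: le_trans (ler_norm _) _; rewrite normrN.
  apply: le_trans (nm_inner_le _ _) _; rewrite nmM nu mulr1.
  apply: ler_pM; rewrite ?mulr_ge0 ?nm_ge0 //; last exact: fj1.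
  by rewrite ler_wpM2l // fj.
(* The estimate goes inward, from [r0] to [r], so a lower bound on the derivative of [g] is what is
   needed: [psi] is nondecreasing. *)
pose psi : R -> R := g * (fun t => expR (L * t)).
have dpsi (t : R) : r <= t <= r0 -> is_derive t (1 : R) psi (expR (L * t) * (dg t + L * g t)).
  move=> tr; have e1 : is_derive t (1 : R) (fun t : R => L * t) L.
    by have := is_deriveZ L (is_derive_id t (1 : R)); rewrite /GRing.scale /= mulr1.
  have e2 := is_derive1_comp (is_derive_expR _) e1.
  apply: is_derive_eq (is_deriveM (der t tr) e2) _.
  by rewrite /GRing.scale /=; ring.
have [||x xr] := @MVT_segment R psi (fun t => expR (L * t) * (dg t + L * g t)) r r0 rr0.
- by move=> t; rewrite in_itv /= => /andP[t0 t1]; apply: dpsi; rewrite !ltW.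
- apply: derivable_within_continuous => t; rewrite in_itv /= => tr.
  by have [] := dpsi t tr.
rewrite in_itv /= in xr => E.
have mono : g r * expR (L * r) <= g r0 * expR (L * r0).
  rewrite -subr_ge0 [X in _ <= X]E mulr_ge0 ?subr_ge0 // mulr_ge0 ?expR_ge0 //.
  by have := dgL x xr; rewrite -subr_ge0 opprK.
have fg : nm (f z0) ^+ 2 <= g r.
  have -> : z0 = 0 + r%:C * u.
    by rewrite add0r /u mulrC divfK // -nm_eq0 nmR normr_eq0 gt_eqF.
  by rewrite /g (bigD1 (Ordinal k0)) //= lerDl sumr_ge0 // => i _; exact: sqr_ge0.
apply: le_trans fg _; apply: le_trans (_ : g r * expR (L * r) <= _).
  by rewrite ler_peMr // -[1]expR0 ler_expR mulr_ge0 // ltW.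
apply: le_trans mono _; apply: ler_pM; rewrite ?expR_ge0 //.
  by apply: HG; rewrite nt.
by rewrite ler_expR ler_piMr.
Qed.

End UpperBound.

(** * Iterated orders as bounds by exponential towers *)

Section Orders.
Context {R : realType}.
Local Notation C := (Cplx R).
Implicit Types (f g : C -> C) (z w y : C) (r s x : R).

Lemma le_max_modulus f r z : (forall w, nm w = r -> ccont f w) -> nm z = r ->
  nm (f z) <= max_modulus r f.
Proof.
move=> cf zr; apply: sup_upper_bound; last by exists z => //=; rewrite nmE zr.
split; first by exists (nm (f z)), z => //=; rewrite nmE zr.
have [M HM] : exists M : R, forall w, nm w = r -> nm (f w) <= M.
  apply: (@nm_bounded _ [set w | nm w = r] f r) => //.
  - by move=> w /= ->.
  - move=> w /= /eqP h; exists `|nm w - r|; first by rewrite normr_gt0 subr_eq0.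
    move=> u hu E; have := nm_sub u w; have := nm_sub w u; rewrite E (nmB w u).
    by move: hu; rewrite lter_normr => /orP[]; lra.
exists M => _ [w /= wr <-]; apply: HM.
by apply: (@complexI R); rewrite -nmE.
Qed.

Lemma max_modulus_le f r M : 0 <= r -> (forall z, nm z = r -> nm (f z) <= M) ->
  max_modulus r f <= M.
Proof.
move=> r0 H; apply: ge_sup.
  by exists (nm (f r%:C)), (r%:C : C) => //=; rewrite nmE nmR ger0_norm.
by move=> _ [w /= wr <-]; apply: H; apply: (@complexI R); rewrite -nmE.
Qed.

Lemma logp_ge0 x : 0 <= logp x.
Proof. by rewrite /logp le_max lexx orbT. Qed.

Lemma logp_le x (y : R) : 0 <= y -> (logp x <= y) = (x <= expR y).
Proof.
move=> y0; rewrite /logp ge_max y0 andbT; have [x0|x0] := ltP 0 x.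
  by rewrite -[in RHS](@lnK _ x) ?posrE // ler_expR.
rewrite ln0 // y0; apply/esym; apply: le_trans x0 _; exact: expR_ge0.
Qed.

(** For nonnegative [y], [logp] and [expR] form a Galois connection, so the truncations at 0
    disappear from the estimates. *)
Lemma iter_logp_le m x (y : R) : 0 <= y -> (iter m logp x <= y) = (x <= iter m expR y).
Proof.
elim: m y => [//|m IH] y y0.
by rewrite iterS logp_le // IH ?expR_ge0 // -iterSr.
Qed.

Lemma iter_expR_le m (x y : R) : x <= y -> iter m expR x <= iter m expR y.
Proof. by move=> xy; elim: m => [//|m IH]; rewrite !iterS ler_expR. Qed.

(** With [iterated_order_le], this turns upper limits into tower bounds valid for all small [r];
    below 1, [- ln r] is positive and can be cleared from the quotient. *)
Lemma iterated_order_lt n f (s : R) : (iterated_order n f < s%:E)%E -> 0 <= s ->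
  exists2 r0 : R, 0 < r0 & forall r, 0 < r < r0 ->
    max_modulus r f <= iter n.+1 expR (s * - ln r).
Proof.
rewrite /iterated_order limf_esupE => /ereal_inf_lt[_ [V FV <-] Vs] s0.
move: FV => /nbhs_ballP[d d0 dV].
exists (Num.min d 1); first by rewrite lt_min d0 ltr01.
move=> r /andP[r0]; rewrite lt_min => /andP[rd r1].
have Vr : V r by apply: dV => //; rewrite /ball /= sub0r normrN gtr0_norm.
have lr : 0 < - ln r by rewrite oppr_gt0 ln_lt0 // r0.
rewrite -iter_logp_le; last by rewrite mulr_ge0 // ltW.
rewrite -ler_pdivrMr // -lee_fin; apply: le_trans (ltW Vs).
by apply: ereal_sup_ubound; exists r.
Qed.

Lemma iterated_order_le n f (s r0 : R) : 0 <= s -> 0 < r0 ->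
  (forall r, 0 < r < r0 -> max_modulus r f <= iter n.+1 expR (s * - ln r)) ->
  (iterated_order n f <= s%:E)%E.
Proof.
move=> s0 r00 H; rewrite /iterated_order limf_esupE.
pose V := [set r : R | 0 < r < Num.min r0 1].
apply: (@le_trans _ _ (ereal_sup ((fun r => (iter n.+1 logp (max_modulus r f) / - ln r)%:E) @` V))).
  apply: ereal_inf_lbound; exists V => //.
  apply/nbhs_ballP; exists (Num.min r0 1) => /=; first by rewrite lt_min r00 ltr01.
  move=> r; rewrite /ball /= sub0r normrN => hr rp; rewrite /V /= rp /=.
  by rewrite gtr0_norm in hr.
apply: ge_ereal_sup => e [r /andP[rp]]; rewrite lt_min => /andP[rr0 r1] <-.
have lr : 0 < - ln r by rewrite oppr_gt0 ln_lt0 // rp.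
rewrite lee_fin ler_pdivrMr // iter_logp_le; last by rewrite mulr_ge0 // ltW.
by apply: H; rewrite rp.
Qed.

Lemma iterated_order_ge0 n f : (0 <= iterated_order n f)%E.
Proof.
rewrite /iterated_order limf_esupE; apply: le_ereal_inf_tmp => _ [V FV <-].
move: FV => /nbhs_ballP[d d0 dV].
pose r := Num.min d 1 / 2.
have m0 : 0 < Num.min d 1 by rewrite lt_min d0 ltr01.
have r0 : 0 < r by rewrite divr_gt0.
have rm : r < Num.min d 1 by rewrite /r; move: m0; set m := Num.min _ _; lra.
move: (rm); rewrite lt_min => /andP[rd r1].
have Vr : V r by apply: dV => //; rewrite /ball /= sub0r normrN gtr0_norm.
apply: le_trans (_ : ((iter n.+1 logp (max_modulus r f) / - ln r)%:E <= _)%E); last first.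
  by apply: ereal_sup_ubound; exists r.
by rewrite lee_fin divr_ge0 ?logp_ge0 // oppr_ge0 ln_le0 // ltW.
Qed.

Lemma iter_expR_ge0 m x : 0 <= iter m.+1 expR x.
Proof. by rewrite iterS expR_ge0. Qed.

(** One exponential already suffices for a larger [s'] to absorb constant factors, linear terms and
    a shift [c] of the variable. [K] is general because the induction enlarges it at each level. *)
Lemma tower_dominates m (K c s s' : R) : 0 <= K -> 0 <= s -> s < s' ->
  exists X, forall x, X <= x ->
    K * iter m.+1 expR (s * (x + c)) + K * x + K <= iter m.+1 expR (s' * x).
Proof.
move=> K0 s0 ss'; elim: m K K0 => [|m IH] K K0.
  pose D := s' - s; have D0 : 0 < D by rewrite subr_gt0.
  pose a := K * expR (s * c) + K.
  have a0 : 0 <= a by rewrite /a addr_ge0 // mulr_ge0 // expR_ge0.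
  have D2 : 0 < D ^+ 2 / 4 by rewrite divr_gt0 // exprn_gt0.
  exists (Num.max 1 ((a + K) / (D ^+ 2 / 4))) => x.
  rewrite ge_max => /andP[x1]; rewrite ler_pdivrMr // => hx /=.
  have x0 : 0 <= x by lra.
  have e1 : 1 <= expR (s * x) by rewrite -[1]expR0 ler_expR mulr_ge0.
  have -> : s' * x = s * x + D * x by rewrite /D; ring.
  rewrite expRD mulrDr expRD.
  (* Half of the exponent gives [D / 2 * x] and the other half the same again; the resulting square
     beats a linear function once [x] is large. *)
  have big : a + K * x <= expR (D * x).
    have -> : D * x = D / 2 * x + D / 2 * x by field.
    rewrite expRD; have h : D / 2 * x <= expR (D / 2 * x).
      by apply: le_trans (expR_ge1Dx _); lra.
    apply: le_trans (_ : D / 2 * x * (D / 2 * x) <= _); last first.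
      by apply: ler_pM => //; rewrite mulr_ge0 // divr_ge0 // ltW.
    apply: le_trans (_ : x * (a + K) <= _); first by nra.
    have -> : D / 2 * x * (D / 2 * x) = x * (x * (D ^+ 2 / 4)) by field.
    by rewrite ler_wpM2l.
  apply: le_trans (_ : expR (s * x) * (a + K * x) <= _).
    have k0 : 0 <= K * x + K by rewrite addr_ge0 // mulr_ge0.
    by move: e1 k0; rewrite /a; set e := expR _; set e' := expR _; nra.
  by rewrite ler_wpM2l ?expR_ge0.
(* Exponentiating [E + x + (1 + 3 * K)] gives at least [3 * K * exp E * exp x], one third for each
   of the three terms to be absorbed. *)
have [X HX] := IH (1 + 3 * K) ltac:(lra).
exists (Num.max X 0) => x; rewrite ge_max => /andP[/HX hx x0].
rewrite iterS [in leRHS]iterS; set E := iter m.+1 _ _ in hx *.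
set E' := iter m.+1 _ _ in hx *.
have E0 : 0 <= E by exact: iter_expR_ge0.
have Kx : 0 <= K * x by rewrite mulr_ge0.
have KE : 0 <= K * E by rewrite mulr_ge0.
apply: le_trans (_ : expR (E + x + (1 + 3 * K)) <= _); last first.
  by rewrite ler_expR; apply: le_trans hx; lra.
rewrite !expRD.
have h1 : 1 <= expR E by rewrite -[1]expR0 ler_expR.
have h2 : 1 + x <= expR x by exact: expR_ge1Dx.
have h3 : 3 * K <= expR 1 * expR (3 * K).
  by rewrite -expRD; apply: le_trans (expR_ge1Dx _); lra.
have h4 : 1 <= expR E * expR x.
  by rewrite -expRD -[1]expR0 ler_expR addr_ge0.
have h5 : expR E <= expR E * expR x by rewrite ler_peMr ?expR_ge0 //; lra.
have h6 : x <= expR E * expR x.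
  apply: le_trans (_ : 1 * expR x <= _); first by lra.
  by rewrite ler_wpM2r ?expR_ge0.
apply: le_trans (_ : expR E * expR x * (3 * K) <= _); last first.
  by rewrite ler_wpM2l // mulr_ge0 ?expR_ge0.
by move: h4 h5 h6 K0; set a := expR E * expR x; set b := expR E; nra.
Qed.

Lemma ereal_between (e : \bar R) (s : R) : (0 <= e)%E -> (e < s%:E)%E ->
  exists2 t : R, (e < t%:E)%E & t < s.
Proof.
case: e => [r| |] //; rewrite !lte_fin => r0 rs.
by exists ((r + s) / 2); rewrite ?lte_fin; lra.
Qed.

Lemma common_bound k (e : nat -> \bar R) (s : R) : 0 < s ->
  (forall j, (j < k)%N -> (0 <= e j)%E) -> (forall j, (j < k)%N -> (e j < s%:E)%E) ->
  exists2 t : R, 0 < t < s & forall j, (j < k)%N -> (e j < t%:E)%E.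
Proof.
move=> s0; elim: k => [|k IH] e0 es; first by exists (s / 2) => //; lra.
have [||t /andP[t0 ts] Ht] := IH.
- by move=> j jk; apply: e0; exact: ltnW.
- by move=> j jk; apply: es; exact: ltnW.
have [t' et' t's] := ereal_between (e0 k (ltnSn k)) (es k (ltnSn k)).
exists (Num.max t t').
  by rewrite lt_max t0 /= gt_max ts.
move=> j; rewrite ltnS leq_eqVlt => /orP[/eqP ->|/Ht jt].
  by apply: lt_le_trans et' _; rewrite lee_fin le_max lexx orbT.
by apply: lt_le_trans jt _; rewrite lee_fin le_max lexx.
Qed.

Lemma common_radius k (P : nat -> R -> Prop) :
  (forall j, (j < k)%N -> exists2 r0 : R, 0 < r0 & forall r, 0 < r < r0 -> P j r) ->
  exists2 r0 : R, 0 < r0 & forall j r, (j < k)%N -> 0 < r < r0 -> P j r.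
Proof.
elim: k => [|k IH] H; first by exists 1.
have [|r1 r10 H1] := IH; first by move=> j jk; apply: H; exact: ltnW.
have [r2 r20 H2] := H k (ltnSn k).
exists (Num.min r1 r2); first by rewrite lt_min r10.
move=> j r; rewrite ltnS leq_eqVlt => /orP[/eqP ->|jk] /andP[r0];
  rewrite lt_min => /andP[h1 h2]; first by apply: H2; rewrite r0.
by apply: H1; rewrite ?r0.
Qed.

Lemma punctured_discP (rho : R) z : punctured_disc rho z <-> 0 < nm z < rho.
Proof. by rewrite /punctured_disc /= nmE !ltcR. Qed.

Lemma analytic_hol (rho : R) f z : analytic_on (punctured_disc rho) f ->
  0 < nm z < rho -> hol f z.
Proof.
move=> hf /andP[z0 zr]; exists (Num.min (nm z) (rho - nm z)).
  by rewrite lt_min z0 subr_gt0.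
move=> w; rewrite lt_min => /andP[w1 w2]; apply/derivable_cder/hf/punctured_discP.
have := nm_sub w z; have := nm_sub z w; rewrite (nmB z w) => h1 h2.
by apply/andP; split; lra.
Qed.

End Orders.

(** * The two inequalities between the orders *)

Section OrderOfSolutions.
Context {R : realType}.
Local Notation C := (Cplx R).
Variables (rho : R) (k : nat) (A : nat -> C -> C) (f : C -> C).
Hypotheses (k_gt0 : (0 < k)%N)
  (holA : forall j z, (j < k)%N -> 0 < nm z < rho -> hol (A j) z)
  (holf : forall z, 0 < nm z < rho -> hol f z)
  (fE : forall z, 0 < nm z < rho ->
    derive1n k f z + \sum_(j < k) A j z * derive1n j f z = 0).

Lemma order_solution_le n (s s' : R) : 0 < rho -> 0 <= s -> s < s' ->
  (forall j, (j < k)%N -> (iterated_order n (A j) < s%:E)%E) ->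
  (iterated_order n.+1 f <= s'%:E)%E.
Proof.
move=> rho0 s0 ss' As.
have [r1 r10 Hr1] := common_radius (fun j jk => iterated_order_lt (As j jk) s0).
pose r0 := Num.min (Num.min r1 rho) 1 / 2.
have m0 : 0 < Num.min (Num.min r1 rho) 1 by rewrite !lt_min r10 rho0 ltr01.
have r00 : 0 < r0 by rewrite divr_gt0.
have : r0 < Num.min (Num.min r1 rho) 1 by rewrite /r0; move: m0; lra.
rewrite !lt_min -andbA => /and3P[r0r1 r0rho r01].
have fin0 w : nm w = r0 -> 0 < nm w < rho by move=> ->; rewrite r00.
have [G HG] : exists G : R, forall w, nm w = r0 ->
    \sum_(j < k) nm (derive1n j f w) ^+ 2 <= G.
  have bj j : exists M : R, forall w, nm w = r0 -> nm (derive1n j f w) <= M.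
    apply: (@nm_bounded _ [set w | nm w = r0] _ r0) => //.
    - by move=> w /= ->.
    - move=> w /= /eqP h; exists `|nm w - r0|; first by rewrite normr_gt0 subr_eq0.
      move=> u hu E; have := nm_sub u w; have := nm_sub w u; rewrite E (nmB w u).
      by move: hu; rewrite lter_normr => /orP[]; lra.
    - by move=> w /= /fin0 wr; apply/hol_ccont/hol_derive1n/holf.
  have [M HM] := choice bj; exists (\sum_(j < k) M j ^+ 2) => w wr.
  by apply: ler_sum => j _; apply: lerXn2r; rewrite ?nnegrE ?nm_ge0 ?HM //;
     apply: le_trans (HM j w wr); exact: nm_ge0.
have G0 : 0 <= G.
  have := HG (r0%:C : C); rewrite nmR gtr0_norm // => /(_ erefl); apply: le_trans.
  by apply: sumr_ge0 => j _; exact: sqr_ge0.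
have kR : 0 <= k%:R :> R by rewrite ler0n.
(* Chosen to cover the exponent [G + 2 * k * (1 + k * B)]: the coefficient of [B] and the constant
   terms are both at most [K]. *)
pose K : R := 1 + G + 2 * k%:R + 2 * k%:R ^+ 2.
have K0 : 0 <= K by rewrite /K; have := sqr_ge0 (k%:R : R); lra.
have [X HX] := tower_dominates n 0 K0 s0 ss'.
apply: (@iterated_order_le _ _ _ s' (Num.min r0 (expR (- (Num.max X 0))))).
- by apply: ltW; apply: le_lt_trans ss'.
- by rewrite lt_min r00 expR_gt0.
move=> r /andP[rp]; rewrite lt_min => /andP[rr0 rX].
pose x := - ln r.
have xX : Num.max X 0 <= x.
  by rewrite /x lerNr -ler_expR lnK ?posrE // ltW.
have [Xx x0] : X <= x /\ 0 <= x by move: xX; rewrite ge_max => /andP[].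
apply: max_modulus_le; first exact: ltW.
move=> z zr; pose B := iter n.+1 expR (s * x).
have B0 : 0 <= B by exact: iter_expR_ge0.
have H w : r <= nm w <= r0 -> [/\ hol f w, forall j, (j < k)%N -> nm (A j w) <= B &
     derive1n k f w + \sum_(j < k) A j w * derive1n j f w = 0].
  move=> /andP[w1 w2]; have w0 : 0 < nm w by apply: lt_le_trans w1.
  have wrho : 0 < nm w < rho by rewrite w0; apply: le_lt_trans r0rho.
  split; [exact: holf| |exact: fE].
  move=> j jk; apply: le_trans (_ : max_modulus (nm w) (A j) <= _).
    by apply: le_max_modulus => // v vw; apply/hol_ccont/holA; rewrite ?vw.
  apply: le_trans (Hr1 j (nm w) jk _) _.
    by rewrite w0; apply: le_lt_trans r0r1.
  by apply: iter_expR_le; rewrite ler_wpM2l // lerN2 ler_ln ?posrE.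
have := solution_growth rp (ltW rr0) (ltW r01) B0 zr H HG k_gt0 => hf.
have {hf} : nm (f z) <= expR (G + 2 * k%:R * (1 + k%:R * B)).
  rewrite -(ler_pXn2r (n := 2)) ?nnegrE ?nm_ge0 ?expR_ge0 //.
  apply: le_trans hf _; set L := 2 * _ * _.
  have L0 : 0 <= L by rewrite /L !mulr_ge0 // addr_ge0 // mulr_ge0.
  have e1 : G <= expR G by apply: le_trans (expR_ge1Dx _); lra.
  have e2 : 1 <= expR L by rewrite -[1]expR0 ler_expR.
  have e3 : 1 <= expR G by rewrite -[1]expR0 ler_expR.
  rewrite expRD expr2; apply: ler_pM; rewrite ?mulr_ge0 ?expR_ge0 //.
    by apply: le_trans e1 _; rewrite ler_peMr ?expR_ge0.
  by rewrite ler_peMl ?expR_ge0.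
move=> /le_trans; apply; rewrite iterS ler_expR.
apply: le_trans (HX x Xx); rewrite addr0 -/B.
have Kx : 0 <= K * x by rewrite mulr_ge0.
have h : 0 <= (1 + G + 2 * k%:R) * B by rewrite mulr_ge0 //; lra.
have -> : K * B + K * x + K = (1 + G + 2 * k%:R) * B + 2 * k%:R ^+ 2 * B + K * x + K.
  by rewrite /K; ring.
have -> : G + 2 * k%:R * (1 + k%:R * B) = G + 2 * k%:R + 2 * k%:R ^+ 2 * B by ring.
rewrite /K; have := sqr_ge0 (k%:R : R); move: Kx h; rewrite /K; lra.
Qed.

(** The index [n.+1] makes [T] comparable to [expR E] with [E] still a tower of positive height. The
    polynomial bound of [coefficient_bound] then only multiplies [E] by a constant, which
    [tower_dominates] absorbs. *)
Lemma order_coefficient_le n (s s' : R) : 0 <= s -> s < s' ->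
  (exists2 z, 0 < nm z < rho & f z != 0) ->
  (iterated_order n.+2 f < s%:E)%E ->
  (forall j, (0 < j < k)%N -> (iterated_order n.+1 (A j) < s%:E)%E) ->
  (iterated_order n.+1 (A 0%N) <= s'%:E)%E.
Proof.
move=> s0 ss' [zs zsr fzs] fs As.
have [r1 r10 Hr1] := iterated_order_lt fs s0.
have [r2 r20 Hr2] : exists2 r0 : R, 0 < r0 & forall j r, (j < k)%N -> 0 < r < r0 ->
    (0 < j)%N -> max_modulus r (A j) <= iter n.+2 expR (s * - ln r).
  apply: common_radius => j jk; have [j0|j0] := posnP j.
    by exists 1 => // r _; rewrite j0.
  have [|r2 r20 H] := iterated_order_lt (As j _) s0; first by rewrite j0.
  by exists r2 => // r rr _; apply: H.
have [p [B B0 HB]] := max_modulus_ge holf zsr fzs.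
have [K K0 HK] := @coefficient_bound R k k_gt0.
pose b := `|ln B| + 1.
have b1 : 1 <= b by rewrite /b lerDr.
have pR : 0 <= p%:R :> R by rewrite ler0n.
have kR : 0 <= k%:R :> R by rewrite ler0n.
(* The exponent of [T] in [K * T * (T ^+ 2 / r) ^+ k]. *)
pose m : R := 2 * k%:R + 1.
have m1 : 1 <= m by rewrite /m; lra.
pose D : R := K + m * (1 + p%:R + b) + k%:R.
have mpb : m <= m * (1 + p%:R + b) by rewrite ler_peMr //; lra.
have D0 : 0 <= D by rewrite /D; lra.
(* The bounds are needed down to [nm w = r / 2], where [- ln (nm w)] is [x + ln 2]. *)
have [X HX] := tower_dominates n (ln 2) D0 s0 ss'.
pose r3 := Num.min (Num.min (Num.min r1 r2) (Num.min rho (nm zs))) (expR (- (Num.max X 0))).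
have r30 : 0 < r3.
  rewrite !lt_min r10 r20 expR_gt0; move: zsr => /andP[h1 h2].
  by rewrite h1 (lt_trans h1 h2).
apply: (@iterated_order_le _ _ _ s' (r3 / 2)).
- by apply: ltW; apply: le_lt_trans ss'.
- by rewrite divr_gt0.
move=> r /andP[rp rr3]; have r32 : 3 * r / 2 < r3 by lra.
have rr3' : r < r3 by lra.
have : 3 * r / 2 < r3 by []; rewrite !lt_min -!andbA => /and5P[q1 q2 q3 q4 q5].
pose x := - ln r.
have xX : Num.max X 0 <= x.
  rewrite /x lerNr -ler_expR lnK ?posrE //.
  by move: rr3'; rewrite /r3 lt_min => /andP[_ /ltW].
have [Xx x0] : X <= x /\ 0 <= x by move: xX; rewrite ge_max => /andP[].
have rE : r = expR (- x) by rewrite /x opprK lnK.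
have r01 : 0 < r <= 1 by rewrite rp rE -[X in _ <= X]expR0 ler_expR oppr_le0.
apply: max_modulus_le; first exact: ltW.
move=> z0 z0r.
have rzs : 0 < r <= nm zs by rewrite rp; lra.
have [y yr fy] := HB r rzs.
pose E := iter n.+1 expR (s * (x + ln 2)).
have E0 : 0 <= E by exact: iter_expR_ge0.
(* [expR E] bounds [ln |f|] and the coefficients on the annulus; [p%:R * x + b] pays for the lower
   bound [B * r ^+ p] at [y]. *)
pose T := expR E + p%:R * x + b.
have px : 0 <= p%:R * x by rewrite mulr_ge0.
have eE : 1 <= expR E by rewrite -[1]expR0 ler_expR.
have T1 : 1 <= T by rewrite /T; lra.
have lnw w : r / 2 <= nm w -> s * - ln (nm w) <= s * (x + ln 2).
  move=> h; have w0 : 0 < nm w by apply: lt_le_trans h; rewrite divr_gt0.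
  rewrite ler_wpM2l // lerNl opprD /x opprK -ln_div ?posrE //.
  by rewrite ler_ln ?posrE // divr_gt0.
have bound w : r / 2 <= nm w <= 3 * r / 2 ->
     [/\ hol f w, nm (f w) <= expR T, hol (A 0%N) w,
         forall j, (0 < j < k)%N -> nm (A j w) <= T &
         derive1n k f w + \sum_(j < k) A j w * derive1n j f w = 0].
  move=> /andP[w1 w2]; have w0 : 0 < nm w by apply: lt_le_trans w1; rewrite divr_gt0.
  have wrho : 0 < nm w < rho by rewrite w0; apply: le_lt_trans q3.
  have ET : expR E <= T by rewrite /T; lra.
  split; [exact: holf| |exact: holA| |exact: fE].
    apply: le_trans (_ : max_modulus (nm w) f <= _).
      by apply: le_max_modulus => // v vw; apply/hol_ccont/holf; rewrite vw.
    apply: le_trans (Hr1 _ _) _; first by rewrite w0; apply: le_lt_trans q1.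
    rewrite iterS ler_expR; apply: le_trans ET; rewrite iterS ler_expR.
    by apply: iter_expR_le; exact: lnw.
  move=> j /andP[j0 jk]; apply: le_trans (_ : max_modulus (nm w) (A j) <= _).
    by apply: le_max_modulus => // v vw; apply/hol_ccont/holA; rewrite ?vw.
  apply: le_trans (Hr2 j _ jk _ j0) _; first by rewrite w0; apply: le_lt_trans q2.
  apply: le_trans ET; rewrite iterS ler_expR.
  by apply: iter_expR_le; exact: lnw.
have fyT : expR (- T) <= nm (f y).
  apply: le_trans fy; have -> : B * r ^+ p = expR (ln B - p%:R * x).
    by rewrite expRD lnK ?posrE // rE -expRM_natl mulrN.
  rewrite ler_expR /T /b; have := ler_norm (- ln B); rewrite normrN; lra.
apply: le_trans (HK A f r T y z0 r01 T1 bound yr fyT z0r) _.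
have Tle : T <= expR (E + (p%:R * x + b)).
  rewrite expRD; apply: le_trans (_ : expR E * (1 + (p%:R * x + b)) <= _).
    by rewrite /T; move: eE px b1; set e := expR E; set q := p%:R * x; nra.
  by rewrite ler_wpM2l ?expR_ge0 // expR_ge1Dx.
have T0 : 0 <= T by lra.
have Kle : K <= expR K by apply: le_trans (expR_ge1Dx _); lra.
have -> : K * T * (T ^+ 2 / r) ^+ k = K * T ^+ (2 * k).+1 * expR (k%:R * x).
  by rewrite rE expRN invrK expRM_natl exprMn [T ^+ (2 * k).+1]exprS [T ^+ (2 * k)]exprM !mulrA.
rewrite iterS; apply: le_trans (_ : expR (K + (m * (E + (p%:R * x + b)) + k%:R * x)) <= _).
  rewrite !expRD -mulrA; apply: ler_pM; rewrite ?mulr_ge0 ?exprn_ge0 ?expR_ge0 ?(ltW K0) //.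
  rewrite ler_wpM2r ?expR_ge0 //.
  have -> : m * (E + (p%:R * x + b)) = (2 * k).+1%:R * (E + (p%:R * x + b)).
    by congr (_ * _); rewrite /m -[RHS]natr1 natrM.
  rewrite expRM_natl; apply: lerXn2r; rewrite ?nnegrE ?expR_ge0 //.
rewrite ler_expR; apply: le_trans (HX x Xx); rewrite -/E.
have mb : 0 <= m * b by apply: mulr_ge0; lra.
have mp : 0 <= m * p%:R by apply: mulr_ge0; lra.
have DE : D = K + (m + m * p%:R + m * b) + k%:R by rewrite /D; ring.
have h1 : m * E <= D * E by apply: ler_wpM2r => //; rewrite DE; lra.
have h2 : (m * p%:R + k%:R) * x <= D * x by apply: ler_wpM2r => //; rewrite DE; lra.
have h3 : K + m * b <= D by rewrite DE; lra.
move: h1 h2 h3; lra.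
Qed.

End OrderOfSolutions.

Theorem corollary3 (R : realType) (rho : R) (n k : nat)
    (A : nat -> Cplx R -> Cplx R)
    (rho_gt0 : 0 < rho) (n_gt0 : (0 < n)%N) (k_gt0 : (0 < k)%N)
    (A_analytic : forall j, (j < k)%N -> analytic_on (punctured_disc rho) (A j))
    (A0_neq0 : exists2 z, punctured_disc rho z & A 0%N z != 0)
    (A_order : forall j, (0 < j < k)%N ->
       (iterated_order n (A j) < iterated_order n (A 0%N))%E)
    (A0_order : (iterated_order n (A 0%N) < +oo)%E)
    (f : Cplx R -> Cplx R)
    (f_analytic : analytic_on (punctured_disc rho) f)
    (f_neq0 : exists2 z, punctured_disc rho z & f z != 0)
    (f_sol : forall z, punctured_disc rho z ->
       derive1n k f z + \sum_(j < k) A j z * derive1n j f z = 0) :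
  iterated_order n.+1 f = iterated_order n (A 0%N).
Proof.
have holA j z : (j < k)%N -> 0 < nm z < rho -> hol (A j) z.
  by move=> jk; apply: analytic_hol; exact: A_analytic.
have holf z : 0 < nm z < rho -> hol f z by exact: analytic_hol.
have fE z : 0 < nm z < rho -> derive1n k f z + \sum_(j < k) A j z * derive1n j f z = 0.
  by move=> /punctured_discP; exact: f_sol.
have fn0 : exists2 z, 0 < nm z < rho & f z != 0.
  by have [z /punctured_discP zr fz] := f_neq0; exists z.
have A0_ge0 := iterated_order_ge0 n (A 0%N).
have [sg sgE] : exists sg : R, iterated_order n (A 0%N) = sg%:E.
  by case: (iterated_order n (A 0%N)) A0_ge0 A0_order => // r _ _; exists r.
have sg0 : 0 <= sg by rewrite sgE in A0_ge0.
apply/eqP; rewrite eq_le; apply/andP; split.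
  rewrite sgE; apply/lee_addgt0Pr => e e0; rewrite -EFinD.
  apply: (order_solution_le k_gt0 holA holf fE rho_gt0 (s := sg + e / 2)).
  - by rewrite addr_ge0 // divr_ge0 // ltW.
  - lra.
  move=> j jk; apply: (@le_lt_trans _ _ sg%:E); last by rewrite lte_fin; lra.
  rewrite -sgE; have [->//|j0] := posnP j.
  by apply: ltW; apply: A_order; rewrite j0.
rewrite leNgt; apply/negP => lt.
have f_ge0 := iterated_order_ge0 n.+1 f; rewrite sgE in lt.
have sgp : 0 < sg by rewrite -lte_fin; apply: le_lt_trans lt.
(* Index 0, freed by the exclusion of [A 0], carries the order of [f], so that a single [s < sg]
   exceeds all the orders involved. *)
pose e j := if j is 0 then iterated_order n.+1 f else iterated_order n (A j).
have [||s /andP[s0 ssg] Hs] := @common_bound R k e sg sgp.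
- by case=> [|j] jk /=; [exact: f_ge0|exact: iterated_order_ge0].
- by case=> [|j] jk /=; [exact: lt|rewrite -sgE; exact: A_order].
have Hf : (iterated_order n.+1 f < s%:E)%E by exact: (Hs 0%N k_gt0).
have HA j : (0 < j < k)%N -> (iterated_order n (A j) < s%:E)%E.
  by move=> /andP[j0 jk]; have := Hs j jk; case: j j0 jk.
case: n n_gt0 Hf HA sgE {A_order A0_order A0_ge0 lt f_ge0 Hs e} => // m _ Hf HA sgE.
have := order_coefficient_le k_gt0 holA holf fE (s' := (s + sg) / 2) (ltW s0) _ fn0 Hf HA.
rewrite sgE lee_fin => h.
have : sg <= (s + sg) / 2 by apply: h; lra.
lra.
Qed.
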